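(* Let $\lambda\in(0,1)$ and $\alpha_0=\frac{1-\lambda}{1+\lambda}$. Fix $\alpha\in(0,\alpha_0)$ and $\beta\in(\alpha_0,1)$, and suppose that $\alpha$ and $\beta$ are close enough to $\alpha_0$. Let $\Delta=(k/n-\alpha_0)(\alpha_0^{-1}-k/n)$, where $k=k(n)$ are integers. If $k/n\in[\alpha,\beta]$, then as $n\to\infty$ $$\widehat{b_\lambda^n}(k)\sim(-1)^{n-k}\sqrt{\frac{2|\gamma|}{k/n}}\,\frac{1}{|\Delta|^{1/4}}\,\frac{Ai(n^{2/3}\gamma^2)}{n^{1/3}},$$ where $\gamma^2=\gamma^2_{\alpha_0}$ is asymptotically given by $\gamma_{\alpha_0}^2\sim\frac{(\alpha_0-k/n)(1+\lambda)}{(\lambda(1-\lambda))^{1/3}}$ as $k/n\to\alpha_0$. If $k/n\in[\beta^{-1},\alpha^{-1}]$, then as $n\to\infty$ $$\widehat{b_\lambda^n}(k)\sim\sqrt{\frac{2|\gamma|}{k/n}}\,\frac{1}{|\Delta|^{1/4}}\,\frac{Ai(n^{2/3}\gamma^2)}{n^{1/3}},$$ where $\gamma^2=\gamma^2_{\alpha_0^{-1}}$ is asymptotically given by $\gamma_{\alpha_0^{-1}}^2\sim\frac{(k/n-\alpha_0^{-1})(1-\lambda)}{(\lambda(1+\lambda))^{1/3}}$ as $k/n\to\alpha_0^{-1}$.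
   Context: For $\lambda\in(0,1)$, $b_\lambda(z)=\frac{z-\lambda}{1-\lambda z}$, and for integers $n\ge1$, $k\ge0$, $\widehat{b_\lambda^n}(k)=\frac{1}{2i\pi}\int_{\partial\mathbb D}b_\lambda(z)^nz^{-k}\frac{dz}{z}$ is the $k$-th Taylor coefficient at $0$ of $b_\lambda^n$. $Ai$ is the Airy function, $Ai(x)=\frac1\pi\int_0^\infty\cos\left(\frac{t^3}{3}+xt\right)dt$ (improper Riemann integral) for real $x$. Definition of $\gamma^2_{\alpha_0}$ and $\gamma^2_{\alpha_0^{-1}}$ (they depend on $a=k/n$). Put $z_\pm=z_\pm(a)=x\pm\sqrt{x^2-1}$ with $x=\frac{a(1+\lambda^2)-(1-\lambda^2)}{2\lambda a}$ (with $\sqrt{x^2-1}=i\sqrt{1-x^2}$ when $|x|<1$), and $\Phi(z)=\log\left(z^{-a}b_\lambda(z)\right)$, understood as $\log b_\lambda(z)-a\log z$, where for $\gamma_{\alpha_0}$ (with $a$ near $\alpha_0$) $\log$ is the branch with cut $[0,\infty)$ and $\log(-1)=i\pi$, and for $\gamma_{\alpha_0^{-1}}$ (with $a$ near $\alpha_0^{-1}$) $\log$ is the principal branch. In both cases $\gamma^3=\frac34\left[\Phi(z_+)-\Phi(z_-)\right]$, and $\gamma^2$ is the real number with $(\gamma^2)^3=(\gamma^3)^2$; it is positive for $a\notin[\alpha_0,\alpha_0^{-1}]$, negative for $a\in(\alpha_0,\alpha_0^{-1})$, and zero for $a\in\{\alpha_0,\alpha_0^{-1}\}$; $|\gamma|=\sqrt{|\gamma^2|}$.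 When $k/n\in\{\alpha_0,\alpha_0^{-1}\}$ the quotient $\sqrt{|\gamma|}/|\Delta|^{1/4}$ is understood as its limiting value. Meaning of $\sim$: for expressions without oscillating sign, $f\sim g$ means $f/g\to1$. For expressions with an oscillating factor it is used in the customary sense in which one writes $Ai(-x)\sim x^{-1/4}\pi^{-1/2}\cos\left(\frac23x^{3/2}-\frac\pi4\right)$ as $x\to+\infty$, that is, up to an error that is $o(1)$ relative to the amplitude: writing $x=n^{2/3}\gamma^2$, the ratio of the two sides tends to $1$ when $x\ge0$, and equality holds with $Ai(x)$ replaced by $Ai(x)+o\left((1+|x|)^{-1/4}\right)$ when $x<0$. *)

(* Defs.v *)
From Stdlib Require Import Reals Lra Lia.
From Coquelicot Require Import Coquelicot.
Open Scope R_scope.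

Definition blaschke (lam : R) (z : C) : C := ((z - lam) / (1 - lam * z))%C.

Definition cis (t : R) : C := (cos t, sin t).

(* Contour integral over the positively oriented unit circle, z = cis t. *)
Definition circle_integral (f : C -> C) : C :=
  RInt (V := C_R_CompleteNormedModule)
    (fun t : R => (f (cis t) * (Ci * cis t))%C) 0 (2 * PI).

Definition blaschke_coef (lam : R) (n k : nat) : C :=
  (/ (2 * Ci * PI) *
   circle_integral (fun z => blaschke lam z ^ n * / z ^ k * / z))%C.

Definition Airy (x : R) : R :=
  / PI * RInt_gen (V := R_CompleteNormedModule)
           (fun t : R => cos (t ^ 3 / 3 + x * t))
           (at_point 0) (Rbar_locally p_infty).

(* [Carg th z] is the argument of z <> 0 in (th, th + 2 * PI], so that
   [Clog th] is the branch of the logarithm cut along the ray of direction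
   th: [Clog (- PI)] is the principal branch, and [Clog 0] is the branch with
   cut [0, +oo) and value i * PI at -1. *)
Definition Carg (th : R) (z : C) : R :=
  iota (T := R_CompleteNormedModule)
    (fun t : R => th < t <= th + 2 * PI /\ z = (Cmod z * cis t)%C).

Definition Clog (th : R) (z : C) : C := (ln (Cmod z), Carg th z).

Definition alpha0 (lam : R) : R := (1 - lam) / (1 + lam).

Definition Delta (lam a : R) : R := (a - alpha0 lam) * (/ alpha0 lam - a).

Definition xcrit (lam a : R) : R :=
  (a * (1 + lam ^ 2) - (1 - lam ^ 2)) / (2 * lam * a).

(* The square root of x ^ 2 - 1, equal to i * sqrt (1 - x ^ 2) when |x| < 1:
   the real [sqrt] vanishes on negative numbers. *)
Definition sqrt_xx1 (x : R) : C := (sqrt (x ^ 2 - 1), sqrt (1 - x ^ 2)).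

Definition zplus (lam a : R) : C := (xcrit lam a + sqrt_xx1 (xcrit lam a))%C.
Definition zminus (lam a : R) : C := (xcrit lam a - sqrt_xx1 (xcrit lam a))%C.

(* In what follows th selects the branch of the logarithm. *)
Definition Phi (th lam a : R) (z : C) : C :=
  (Clog th (blaschke lam z) - a * Clog th z)%C.

Definition gamma3 (th lam a : R) : C :=
  (3 / 4 * (Phi th lam a (zplus lam a) - Phi th lam a (zminus lam a)))%C.

Definition gamma2 (th lam a : R) : R :=
  iota (T := R_CompleteNormedModule)
    (fun g : R => (RtoC g ^ 3 = gamma3 th lam a ^ 2)%C).

Definition gamma_abs (th lam a : R) : R := sqrt (Rabs (gamma2 th lam a)).

Definition gamma_Delta_quotient (th lam a : R) : R :=
  sqrt (gamma_abs th lam a) / Rpower (Rabs (Delta lam a)) (1 / 4).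

(* The quotient |gamma|^(1/2) / |Delta|^(1/4), extended by its limit to the
   points a = alpha0 and a = / alpha0, where it reads 0 / 0. *)
Definition gamma_Delta_factor (th lam a : R) : R :=
  if Req_EM_T (Delta lam a) 0
  then real (Lim (gamma_Delta_quotient th lam) a)
  else gamma_Delta_quotient th lam a.

(* sqrt (2 |gamma| / a) * |Delta|^(-1/4) * n^(-1/3), for a = k / n. *)
Definition amplitude (th lam : R) (n k : nat) : R :=
  sqrt (2 / (INR k / INR n)) * gamma_Delta_factor th lam (INR k / INR n)
  / Rpower (INR n) (1 / 3).

Definition airy_arg (th lam : R) (n k : nat) : R :=
  Rpower (INR n) (2 / 3) * gamma2 th lam (INR k / INR n).

(* u n ~ A n * Airy (x n): along the n with x n >= 0 the ratio tends to 1;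
   along the n with x n < 0, where Airy oscillates and has zeros, the equality
   holds up to an error o((1 + |x n|)^(-1/4)) added to Airy (x n). *)
Definition airy_equiv (u : nat -> C) (A x : nat -> R) : Prop :=
  filterlim (fun n => (u n / (A n * Airy (x n))%R)%C)
    (within (fun n => 0 <= x n) eventually) (locally (RtoC 1)) /\
  exists e : nat -> C,
    filterlim e (within (fun n => x n < 0) eventually) (locally (RtoC 0)) /\
    eventually (fun n => x n < 0 ->
      u n = (A n * (Airy (x n) + e n * Rpower (1 + Rabs (x n)) (- (1 / 4))))%C).

(* Main.v *)
Require Import Defs.
From Stdlib Require Import Reals Lra Lia.
From Coquelicot Require Import Coquelicot.
Open Scope R_scope.

(** By the parametrization [z = exp (i t)] and conjugation symmetry, the coefficient is [1 / PI]
    times the integral over [[0, PI]] of [cos (n v t)], where [v t] is the argument of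
    [z^(-a) b_lam z] and [a = k / n]. The phase [v] has two critical points [+- s], which coalesce
    as [a] tends to an end of [[alpha0, 1 / alpha0]] and turn into two real saddle points [exp (+- r)]
    beyond that end. The Airy function is the model of this: [PI Airy x] is the integral over the
    half line of [cos (t^3 / 3 + x t)], with critical points [+- sqrt (- x)]. The number [gamma^2] is
    defined so that for [x = n^(2/3) gamma^2] the critical values of both phases agree: their modulus
    is [2/3 |x|^(3/2)].

    Both integrals are evaluated, each by itself, and the results compared. The method depends on
    the size and sign of [x]:

    - For bounded [x], [a] is so close to the end that [v] may be replaced by its cubic Taylor
      polynomial in a window of width a multiple of [n^(-1/3)], and van der Corput's test bounds the
      rest of both integrals ([transition_regime], [near_transition]).

    - For [x] towards minus infinity the two critical points are many oscillations apart. The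
      estimate [stationary_phase] on a window around a stationary point applies to the coefficient
      and to the Airy integral and gives in both cases one Fresnel integral with the same phase
      [2/3 |x|^(3/2)], divided by [b = sqrt (n v'')], resp. by [bA = sqrt (2 |x|^(1/2))]
      ([oscillatory_regime], [airy_oscillatory], [far_oscillatory]).

    - For [x] towards plus infinity both contours are moved to pass through a saddle point; Laplace's
      method ([laplace_window]) turns both integrals into the same Gaussian integral times
      [exp (- 2/3 x^(3/2))], with the same two scales ([saddle_regime], [airy_recessive],
      [far_saddle]).

    So the ratio of the coefficient to [Airy x] is [bA / b], and this is the amplitude of the theorem
    because of the identity [|v''| = a |Delta|^(1/2)] at the critical points ([curv_Delta],
    [curvh_Delta], [amplitude_ratio]). Near the end of the range its limit is computed from the
    leading terms of [gamma^2] and [Delta], which are both linear in [a] ([gamma2_near],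
    [famp_near]). On bounded sets of [x >= 0] an absolute error is a relative one because the Airy
    function is positive there ([airy_lower_bound]). No constant depends on [a],
    so the estimates are uniform in a neighbourhood of the end ([uniform_asymptotics]) and apply to
    arbitrary sequences [k n].

    Both ends are treated at once: [z -> - z] moves the coalescence at [z = -1] to [z = 1] and
    replaces [lam] by [- lam], at the price of the factor [(-1)^(n - k)]. *)

(** * Calculus on intervals *)

(* Recurses through products, quotients and powers; linear facts end the branches. *)
Ltac pos :=
  first [ assumption | solve [pos_step] | lra ]
with pos_step :=
  lazymatch goal with
  | |- _ > _ => apply Rlt_gt; pos
  | |- 0 < _ * _ => apply Rmult_lt_0_compat; pos
  | |- 0 < _ / _ => apply Rdiv_lt_0_compat; pos
  | |- 0 < / _ => apply Rinv_0_lt_compat; pos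
  | |- 0 < _ ^ _ => apply pow_lt; pos
  | |- 0 < exp _ => apply exp_pos
  | |- 0 < Rpower _ _ => apply exp_pos
  | |- 0 < Rmin _ _ => apply Rmin_pos; pos
  | |- 0 <= _ * _ => apply Rmult_le_pos; pos
  | |- 0 <= _ / _ => apply Rdiv_le_0_compat; pos
  | |- 0 <= _ ^ 2 => apply pow2_ge_0
  | |- 0 <= _ ^ _ => apply pow_le; pos
  | |- 0 <= Rabs _ => apply Rabs_pos
  | |- 0 <= / _ => apply Rlt_le; pos
  | |- 0 <= exp _ => apply Rlt_le; pos
  end.

Ltac rabs :=
  repeat match goal with
  | H : Rabs _ <= _ |- _ => apply Rabs_le_between in H
  | H : Rabs _ < _ |- _ => apply Rabs_lt_between in H
  end;
  unfold Rdiv in *; first [apply Rabs_le; lra | lra].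

Ltac derivative := auto_derive; trivial; first [ring | field].

Lemma Rabs_scal_le (k x y : R) : 0 <= k -> Rabs x <= y -> Rabs (k * x) <= k * y.
Proof.
  intros Hk Hx. rewrite Rabs_mult, (Rabs_pos_eq k) by auto. now apply Rmult_le_compat_l.
Qed.

Lemma Rabs_eq_0_inv (x : R) : Rabs x = 0 -> x = 0.
Proof. intros H. destruct (Req_dec x 0); auto. exfalso. now apply (Rabs_no_R0 x). Qed.

Lemma inv_bounds (d x : R) : 0 < d <= x -> 0 < / x <= / d.
Proof.
  intros H. split; [apply Rinv_0_lt_compat; lra|]. apply Rinv_le_contravar; lra.
Qed.

Lemma exp_le (x y : R) : x <= y -> exp x <= exp y.
Proof. intros [H| ->]; [left; now apply exp_increasing|lra]. Qed.

Lemma exp_mul_opp (x : R) : exp x * exp (- x) = 1.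
Proof. rewrite <- exp_plus, Rplus_opp_r. apply exp_0. Qed.

(* The rules of derivation in terms of [Rplus], [Rmult], ... rather than of the
   operations of a normed module, so that goals match them syntactically. *)
Lemma is_derive_continuous (f : R -> R) (x l : R) :
  is_derive f x l -> continuous f x.
Proof. intros H; apply (ex_derive_continuous f); exists l; exact H. Qed.

Lemma derive_minus (f g : R -> R) (x l m : R) :
  is_derive f x l -> is_derive g x m -> is_derive (fun y => f y - g y) x (l - m).
Proof. intros Hf Hg; exact (is_derive_minus f g x l m Hf Hg). Qed.

Lemma derive_plus (f g : R -> R) (x l m : R) :
  is_derive f x l -> is_derive g x m -> is_derive (fun y => f y + g y) x (l + m).
Proof. intros Hf Hg; exact (is_derive_plus f g x l m Hf Hg). Qed.

Lemma derive_opp (f : R -> R) (x l : R) :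
  is_derive f x l -> is_derive (fun y => - f y) x (- l).
Proof. intros Hf; exact (is_derive_opp f x l Hf). Qed.

Lemma derive_scal (f : R -> R) (c x l : R) :
  is_derive f x l -> is_derive (fun y => c * f y) x (c * l).
Proof. intros Hf; exact (is_derive_scal f x c l Hf). Qed.

Lemma derive_const (c x : R) : is_derive (fun _ : R => c) x 0.
Proof. exact (is_derive_const c x). Qed.

Lemma derive_id (x : R) : is_derive (fun y : R => y) x 1.
Proof. exact (is_derive_id x). Qed.

Lemma derive_comp (f g : R -> R) (x l m : R) :
  is_derive f (g x) l -> is_derive g x m -> is_derive (fun y => f (g y)) x (l * m).
Proof.
  intros Hf Hg. rewrite Rmult_comm. exact (is_derive_comp f g x l m Hf Hg).
Qed.

(** A bound on derivatives bounds increments: the mean value theorem for [g - f]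
    and [g + f]. Taylor estimates and estimates of integrals all reduce to it. *)
Lemma derive_dominated (f g f' g' : R -> R) (a b : R) :
  a <= b ->
  (forall x, a <= x <= b -> is_derive f x (f' x)) ->
  (forall x, a <= x <= b -> is_derive g x (g' x)) ->
  (forall x, a <= x <= b -> Rabs (f' x) <= g' x) ->
  Rabs (f b - f a) <= g b - g a.
Proof.
  intros Hab Hf Hg Hle.
  assert (key : forall e, e = 1 \/ e = -1 -> 0 <= (g b - g a) - e * (f b - f a)).
  { intros e He.
    destruct (MVT_gen (fun x => g x - e * f x) a b (fun x => g' x - e * f' x))
      as [c [Hc Heq]].
    - rewrite Rmin_left, Rmax_right by lra. intros x Hx.
      apply derive_minus; [apply Hg; lra|].
      apply derive_scal, Hf; lra.
    - rewrite Rmin_left, Rmax_right by lra. intros x Hx.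
      apply continuity_pt_filterlim.
      apply (is_derive_continuous (fun x => g x - e * f x) x (g' x - e * f' x)).
      apply derive_minus; [apply Hg; lra|].
      apply derive_scal, Hf; lra.
    - rewrite Rmin_left, Rmax_right in Hc by lra.
      pose proof (Hle c Hc) as Hc'. apply Rabs_le_between in Hc'.
      replace (g b - g a - e * (f b - f a))
        with (g b - e * f b - (g a - e * f a)) by ring.
      rewrite Heq. apply Rmult_le_pos; [|lra].
      destruct He; subst e; lra. }
  pose proof (key 1 (or_introl eq_refl)).
  pose proof (key (-1) (or_intror eq_refl)).
  apply Rabs_le; lra.
Qed.

Lemma derive_le (f g f' g' : R -> R) (a b : R) :
  a <= b ->
  (forall x, a <= x <= b -> is_derive f x (f' x)) ->
  (forall x, a <= x <= b -> is_derive g x (g' x)) ->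
  (forall x, a <= x <= b -> f' x <= g' x) ->
  f b - f a <= g b - g a.
Proof.
  intros Hab Hf Hg Hle.
  assert (H := derive_dominated (fun _ => 0) (fun x => g x - f x)
                 (fun _ => 0) (fun x => g' x - f' x) a b Hab).
  enough (Rabs (0 - 0) <= g b - f b - (g a - f a)).
  { pose proof (Rabs_pos (0 - 0)); lra. }
  apply H; intros x Hx.
  - apply derive_const.
  - apply derive_minus; [now apply Hg|now apply Hf].
  - rewrite Rabs_R0. specialize (Hle x Hx); lra.
Qed.

Lemma ex_RInt_cont (f : R -> R) (a b : R) :
  (forall x, continuous f x) -> ex_RInt f a b.
Proof. intros H; apply (ex_RInt_continuous (V := R_CompleteNormedModule)); auto. Qed.

Lemma is_derive_RInt_upper (f : R -> R) (a x : R) :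
  (forall x, continuous f x) -> is_derive (fun y => RInt f a y) x (f x).
Proof.
  intros H. apply (is_derive_RInt f _ a).
  - apply filter_forall. intros y.
    apply (RInt_correct (V := R_CompleteNormedModule)). now apply ex_RInt_cont.
  - apply H.
Qed.

Lemma RInt_dominated (f G g : R -> R) (a b : R) :
  a <= b -> (forall x, continuous f x) ->
  (forall x, a <= x <= b -> is_derive G x (g x)) ->
  (forall x, a <= x <= b -> Rabs (f x) <= g x) ->
  Rabs (RInt f a b) <= G b - G a.
Proof.
  intros Hab Hc HG Hle.
  replace (RInt f a b) with (RInt f a b - RInt f a a).
  - apply (derive_dominated (fun y => RInt f a y) G f g); auto.
    intros x _. now apply is_derive_RInt_upper.
  - rewrite RInt_point. unfold zero; simpl; ring.
Qed.

Lemma RInt_close (f g : R -> R) (a b e : R) :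
  a <= b -> (forall x, continuous f x) -> (forall x, continuous g x) ->
  (forall x, a <= x <= b -> Rabs (f x - g x) <= e) ->
  Rabs (RInt f a b - RInt g a b) <= e * (b - a).
Proof.
  intros Hab Hf Hg Hle.
  replace (RInt f a b - RInt g a b) with (RInt (fun x => f x - g x) a b).
  - replace (e * (b - a)) with (e * b - e * a) by ring.
    apply (RInt_dominated _ (fun x => e * x) (fun _ => e)); auto.
    + intros x. apply (continuous_minus f g); auto.
    + intros x _. derivative.
  - apply (RInt_minus f g); now apply ex_RInt_cont.
Qed.

Lemma RInt_split (f : R -> R) (a b c : R) :
  (forall x, continuous f x) -> RInt f a c = RInt f a b + RInt f b c.
Proof.
  intros H. symmetry. apply (RInt_Chasles f); now apply ex_RInt_cont.
Qed.

Lemma continuous_cos_comp (f : R -> R) (x : R) :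
  continuous f x -> continuous (fun y => cos (f y)) x.
Proof.
  intros H. apply (continuous_comp f cos); auto.
  apply continuity_pt_filterlim, continuity_cos.
Qed.

Lemma continuous_sin_comp (f : R -> R) (x : R) :
  continuous f x -> continuous (fun y => sin (f y)) x.
Proof.
  intros H. apply (continuous_comp f sin); auto.
  apply continuity_pt_filterlim, continuity_sin.
Qed.

Lemma continuous_exp_comp (f : R -> R) (x : R) :
  continuous f x -> continuous (fun y => exp (f y)) x.
Proof.
  intros H. apply (continuous_comp f exp); auto.
  apply continuity_pt_filterlim, derivable_continuous_pt, derivable_pt_exp.
Qed.

Lemma continuous_affine (f : R -> R) (u v x : R) :
  (forall x, continuous f x) -> continuous (fun y => f (u * y + v)) x.
Proof.
  intros H. apply (continuous_comp (fun y => u * y + v) f); auto.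
  apply (is_derive_continuous _ _ u). derivative.
Qed.

Lemma cos_lipschitz (x y : R) : Rabs (cos x - cos y) <= Rabs (x - y).
Proof.
  assert (H : forall a b, a <= b -> Rabs (cos b - cos a) <= b - a).
  { intros a b Hab.
    apply (derive_dominated cos (fun x => x) (fun x => - sin x) (fun _ => 1)); auto.
    - intros; apply is_derive_cos.
    - intros; apply derive_id.
    - intros z _. rewrite Rabs_Ropp. apply Rabs_le, SIN_bound. }
  destruct (Rle_dec x y).
  - rewrite (Rabs_minus_sym x y), (Rabs_minus_sym (cos x)).
    rewrite (Rabs_pos_eq (y - x)) by lra. now apply H.
  - rewrite (Rabs_pos_eq (x - y)) by lra. apply H; lra.
Qed.

Lemma sin_le_pos (y : R) : 0 <= y -> sin y <= y.
Proof.
  intros H. pose proof (derive_le sin (fun x => x) cos (fun _ => 1) 0 y H) as K.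
  rewrite sin_0 in K.
  enough (sin y - 0 <= y - 0) by lra. apply K.
  - intros; apply is_derive_sin.
  - intros; apply derive_id.
  - intros; apply COS_bound.
Qed.

Lemma one_minus_cos_bounds (y : R) : 0 <= 1 - cos y <= y ^ 2 / 2.
Proof.
  split; [pose proof (COS_bound y); lra|].
  assert (H : forall y, 0 <= y -> 1 - cos y <= y ^ 2 / 2).
  { intros z Hz.
    pose proof (derive_le (fun x => - cos x) (fun x => x ^ 2 / 2) sin (fun x => x) 0 z Hz) as K.
    cbv beta in K. rewrite cos_0 in K.
    enough (- cos z - - (1) <= z ^ 2 / 2 - 0 ^ 2 / 2) by lra. apply K.
    - intros; derivative.
    - intros; derivative.
    - intros x Hx; apply sin_le_pos; lra. }
  destruct (Rle_dec 0 y); [now apply H|].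
  rewrite <- cos_neg. replace (y ^ 2) with ((- y) ^ 2) by ring. apply H; lra.
Qed.

Lemma lipschitz_on (f f' : R -> R) (a b k : R) :
  (forall x, a <= x <= b -> is_derive f x (f' x)) ->
  (forall x, a <= x <= b -> Rabs (f' x) <= k) ->
  forall x y, a <= x <= b -> a <= y <= b -> Rabs (f y - f x) <= k * Rabs (y - x).
Proof.
  intros Hf Hk.
  assert (H : forall x y, a <= x -> x <= y -> y <= b -> Rabs (f y - f x) <= k * (y - x)).
  { intros x y H1 H2 H3.
    replace (k * (y - x)) with (k * y - k * x) by ring.
    apply (derive_dominated f (fun x => k * x) f' (fun _ => k)); auto.
    - intros; apply Hf; lra.
    - intros. derivative.
    - intros; apply Hk; lra. }
  intros x y Hx Hy. destruct (Rle_dec x y).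
  - rewrite (Rabs_pos_eq (y - x)) by lra. apply H; lra.
  - rewrite Rabs_minus_sym, (Rabs_minus_sym y), (Rabs_pos_eq (x - y)) by lra.
    apply H; lra.
Qed.

Lemma sin_cubic (s : R) : 0 <= s -> 0 <= s - sin s <= s ^ 3 / 6.
Proof.
  intros Hs. pose proof (sin_le_pos s Hs). split; [lra|].
  enough ((s - sin s) - (0 - sin 0) <= s ^ 3 / 6 - 0 ^ 3 / 6) by (rewrite sin_0 in *; lra).
  apply (derive_le (fun s => s - sin s) (fun s => s ^ 3 / 6) (fun s => 1 - cos s) (fun s => s ^ 2 / 2)); auto.
  - intros; derivative.
  - intros; derivative.
  - intros x _. apply one_minus_cos_bounds.
Qed.

Lemma cos_quartic (s : R) : 0 <= s -> 0 <= s ^ 2 / 2 - (1 - cos s) <= s ^ 4 / 24.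
Proof.
  intros Hs. pose proof (one_minus_cos_bounds s). split; [lra|].
  enough ((s ^ 2 / 2 - (1 - cos s)) - (0 ^ 2 / 2 - (1 - cos 0)) <= s ^ 4 / 24 - 0 ^ 4 / 24)
    by (rewrite cos_0 in *; lra).
  apply (derive_le (fun s => s ^ 2 / 2 - (1 - cos s)) (fun s => s ^ 4 / 24)
    (fun s => s - sin s) (fun s => s ^ 3 / 6)); auto.
  - intros; derivative.
  - intros; derivative.
  - intros x Hx. apply sin_cubic; lra.
Qed.

Lemma sin_lower (s : R) : 0 <= s <= 1 -> s / 2 <= sin s.
Proof.
  intros Hs. pose proof (sin_cubic s ltac:(lra)) as H.
  assert (s ^ 3 <= s) by nra. lra.
Qed.

Lemma one_minus_cos_lower (s : R) : 0 <= s <= PI -> s ^ 2 / 64 <= 1 - cos s.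
Proof.
  intros Hs. pose proof PI_4.
  assert (H1 : forall x, 0 <= x <= 1 -> x ^ 2 / 4 <= 1 - cos x).
  { intros x Hx. pose proof (cos_quartic x ltac:(lra)) as Hq.
    replace (x ^ 4) with (x ^ 2 * x ^ 2) in Hq by ring.
    assert (0 <= x ^ 2 <= 1) by nra. nra. }
  destruct (Rle_dec s 1) as [h|h].
  - specialize (H1 s ltac:(lra)). nra.
  - specialize (H1 1 ltac:(lra)).
    pose proof (cos_decreasing_1 1 s ltac:(lra) ltac:(lra) ltac:(lra) ltac:(lra) ltac:(lra)).
    nra.
Qed.

Lemma cosh_le_2 (x : R) : 0 <= x <= 1 -> 1 <= cosh x <= 2.
Proof.
  intros Hx. unfold cosh.
  pose proof (exp_mul_opp x). pose proof (exp_pos x). pose proof (exp_pos (- x)).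
  pose proof (exp_ineq1_le x). pose proof (exp_le x 1 ltac:(lra)). pose proof exp_le_3.
  split; nra.
Qed.

Lemma sinh_bounds (x : R) : 0 <= x <= 1 -> x <= sinh x <= 2 * x.
Proof.
  intros Hx. 
  assert (H0 : sinh 0 = 0) by (unfold sinh; rewrite Ropp_0; lra).
  assert (D : forall t, is_derive sinh t (cosh t)).
  { intros t. apply is_derive_Reals, derivable_pt_lim_sinh. }
  split.
  - enough (x - 0 <= sinh x - sinh 0) by lra.
    apply (derive_le (fun t => t) sinh (fun _ => 1) cosh); try lra.
    + intros; apply derive_id.
    + intros; apply D.
    + intros t Ht. apply cosh_le_2; lra.
  - enough (sinh x - sinh 0 <= 2 * x - 2 * 0) by lra.
    apply (derive_le sinh (fun t => 2 * t) cosh (fun _ => 2)); try lra.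
    + intros; apply D.
    + intros; derivative.
    + intros t Ht. apply cosh_le_2; lra.
Qed.

Lemma cosh_bounds (x : R) :
  0 <= x <= 1 -> x ^ 2 / 2 <= cosh x - 1 <= x ^ 2 /\ cosh x - 1 - x ^ 2 / 2 <= x ^ 4 / 12.
Proof.
  intros Hx.
  assert (H0 : sinh 0 = 0) by (unfold sinh; rewrite Ropp_0; lra).
  assert (H1 : cosh 0 = 1) by (unfold cosh; rewrite Ropp_0, exp_0; lra).
  assert (D : forall t, is_derive sinh t (cosh t)).
  { intros t. apply is_derive_Reals, derivable_pt_lim_sinh. }
  assert (D' : forall t, is_derive cosh t (sinh t)).
  { intros t. apply is_derive_Reals, derivable_pt_lim_cosh. }
  assert (A : forall y, 0 <= y <= 1 -> y ^ 2 / 2 <= cosh y - 1 <= y ^ 2).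
  { intros y Hy. split.
    - enough (y ^ 2 / 2 - 0 ^ 2 / 2 <= cosh y - cosh 0) by lra.
      apply (derive_le (fun t => t ^ 2 / 2) cosh (fun t => t) sinh); try lra.
      + intros; derivative.
      + intros; apply D'.
      + intros t Ht. apply sinh_bounds; lra.
    - enough (cosh y - cosh 0 <= y ^ 2 - 0 ^ 2) by lra.
      apply (derive_le cosh (fun t => t ^ 2) sinh (fun t => 2 * t)); try lra.
      + intros; apply D'.
      + intros; derivative.
      + intros t Ht. apply sinh_bounds; lra. }
  split; [now apply A|].
  assert (B : forall y, 0 <= y <= 1 -> sinh y - y <= y ^ 3 / 3).
  { intros y Hy.
    enough ((sinh y - y) - (sinh 0 - 0) <= y ^ 3 / 3 - 0 ^ 3 / 3) by lra.
    apply (derive_le (fun t => sinh t - t) (fun t => t ^ 3 / 3) (fun t => cosh t - 1) (fun t => t ^ 2)); try lra.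
    - intros t _. apply derive_minus; [apply D|apply derive_id].
    - intros; derivative.
    - intros t Ht. apply A; lra. }
  enough ((cosh x - x ^ 2 / 2) - (cosh 0 - 0 ^ 2 / 2) <= x ^ 4 / 12 - 0 ^ 4 / 12) by lra.
  apply (derive_le (fun t => cosh t - t ^ 2 / 2) (fun t => t ^ 4 / 12) (fun t => sinh t - t) (fun t => t ^ 3 / 3)); try lra.
  - intros t _. apply derive_minus; [apply D'|]. derivative.
  - intros; derivative.
  - intros t Ht. apply B; lra.
Qed.

(** First derivative test of van der Corput: [cos phi] is the derivative of
    [sin phi / p] up to a term dominated by the derivative of [- 1 / p], and [p] is monotone. *)
Lemma van_der_corput (phi p q : R -> R) (u v m : R) :
  u <= v -> 0 < m ->
  (forall s, is_derive phi s (p s)) ->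
  (forall s, u <= s <= v -> is_derive p s (q s)) ->
  (forall s, u <= s <= v -> 0 <= q s) ->
  m <= p u \/ p v <= - m ->
  Rabs (RInt (fun s => cos (phi s)) u v) <= 2 / m.
Proof.
  intros Huv Hm Hphi Hp Hq Hsgn.
  assert (mono : forall s t, u <= s <= t -> t <= v -> p s <= p t).
  { intros s t Hs Ht.
    enough (0 - 0 <= p t - p s) by lra.
    apply (derive_le (fun _ => 0) p (fun _ => 0) q); try lra.
    - intros; apply derive_const.
    - intros; apply Hp; lra.
    - intros; apply Hq; lra. }
  assert (Hp0 : forall s, u <= s <= v -> p s <> 0).
  { intros s Hs. pose proof (mono u s ltac:(lra) ltac:(lra)).
    pose proof (mono s v ltac:(lra) ltac:(lra)). destruct Hsgn; lra. }
  assert (Hc : forall s, continuous (fun s => cos (phi s)) s).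
  { intros s. apply continuous_cos_comp, (is_derive_continuous _ _ _ (Hphi s)). }
  assert (H : Rabs ((RInt (fun s => cos (phi s)) u v - sin (phi v) / p v)
              - (RInt (fun s => cos (phi s)) u u - sin (phi u) / p u))
              <= - / p v - - / p u).
  { apply (derive_dominated
      (fun s => RInt (fun s => cos (phi s)) u s - sin (phi s) / p s)
      (fun s => - / p s)
      (fun s => sin (phi s) * (q s / (p s) ^ 2)) (fun s => q s / (p s) ^ 2)); auto.
    - intros s Hs.
      replace (sin (phi s) * (q s / p s ^ 2))
        with (cos (phi s) - (cos (phi s) * p s * p s - sin (phi s) * q s) / (p s) ^ 2)
        by (field; auto).
      apply derive_minus.
      + now apply (is_derive_RInt_upper (fun s => cos (phi s))).
      + apply (is_derive_div (fun s => sin (phi s)) p); auto.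
        apply (derive_comp sin phi s (cos (phi s)) (p s)); auto. apply is_derive_sin.
    - intros s Hs.
      replace (q s / p s ^ 2) with (- (- q s / p s ^ 2)) by (field; auto).
      apply derive_opp. apply is_derive_inv; auto.
    - intros s Hs. rewrite Rabs_mult.
      assert (0 <= q s / p s ^ 2).
      { apply Rmult_le_pos; [now apply Hq|].
        left; apply Rinv_0_lt_compat. specialize (Hp0 s Hs). nra. }
      rewrite (Rabs_pos_eq (q s / p s ^ 2)) by auto.
      pose proof (SIN_bound (phi s)).
      assert (Rabs (sin (phi s)) <= 1) by (apply Rabs_le; lra). nra. }
  rewrite RInt_point in H. unfold zero in H; simpl in H.
  apply Rabs_le_between in H.
  assert (Hs : forall w, u <= w <= v -> Rabs (sin (phi w) / p w) <= / Rabs (p w)).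
  { intros w Hw. unfold Rdiv. rewrite Rabs_mult, Rabs_inv.
    assert (Rabs (sin (phi w)) <= 1) by (apply Rabs_le, SIN_bound).
    assert (0 < / Rabs (p w)) by (apply Rinv_0_lt_compat, Rabs_pos_lt; auto). nra. }
  pose proof (Hs u ltac:(lra)) as Hu. pose proof (Hs v ltac:(lra)) as Hv.
  pose proof (mono u v ltac:(lra) ltac:(lra)) as Hmv.
  apply Rabs_le_between in Hu. apply Rabs_le_between in Hv.
  assert (Hinv : forall t, m <= t -> / t <= / m).
  { intros t Ht; apply Rinv_le_contravar; lra. }
  destruct Hsgn as [Hs1|Hs1].
  - rewrite (Rabs_pos_eq (p u)) in Hu by lra. rewrite (Rabs_pos_eq (p v)) in Hv by lra.
    pose proof (Hinv (p u) Hs1). apply Rabs_le. unfold Rdiv. lra.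
  - rewrite (Rabs_left (p u)) in Hu by lra. rewrite (Rabs_left (p v)) in Hv by lra.
    pose proof (Hinv (- p v) ltac:(lra)) as Hi. rewrite !Rinv_opp in *.
    apply Rabs_le. unfold Rdiv. lra.
Qed.

(** * Shifting a contour *)

Definition cont2 (f : R -> R -> R) (r s : R) : Prop :=
  continuous (fun p : R * R => f (fst p) (snd p)) (r, s).

(** [u + i v] is a holomorphic function of [s + i r]; the fields are the
    Cauchy-Riemann equations, written with the derivatives [us] and [vs] along the real
    direction only, and the continuity that differentiation under the integral needs. *)
Record conjugate_on (lo hi : R) (u v us vs : R -> R -> R) : Prop := {
  conj_ur : forall r s, lo < r < hi -> is_derive (fun r => u r s) r (- vs r s);
  conj_vr : forall r s, lo < r < hi -> is_derive (fun r => v r s) r (us r s);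
  conj_us : forall r s, lo < r < hi -> is_derive (u r) s (us r s);
  conj_vs : forall r s, lo < r < hi -> is_derive (v r) s (vs r s);
  conj_cu : forall r s, lo < r < hi -> cont2 u r s;
  conj_cv : forall r s, lo < r < hi -> cont2 v r s;
  conj_cus : forall r s, lo < r < hi -> cont2 us r s;
  conj_cvs : forall r s, lo < r < hi -> cont2 vs r s }.

Lemma cont2_comp1 (f : R -> R) (g : R -> R -> R) (r s : R) :
  continuous f (g r s) -> cont2 g r s -> cont2 (fun r s => f (g r s)) r s.
Proof.
  intros Hf Hg. unfold cont2.
  apply (continuous_comp (fun p : R * R => g (fst p) (snd p)) f); auto.
Qed.

Lemma cont2_plus (f g : R -> R -> R) (r s : R) :
  cont2 f r s -> cont2 g r s -> cont2 (fun r s => f r s + g r s) r s.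
Proof. intros Hf Hg. exact (continuous_plus _ _ _ Hf Hg). Qed.

Lemma cont2_minus (f g : R -> R -> R) (r s : R) :
  cont2 f r s -> cont2 g r s -> cont2 (fun r s => f r s - g r s) r s.
Proof. intros Hf Hg. exact (continuous_minus _ _ _ Hf Hg). Qed.

Lemma cont2_opp (f : R -> R -> R) (r s : R) :
  cont2 f r s -> cont2 (fun r s => - f r s) r s.
Proof. intros Hf. exact (continuous_opp _ _ Hf). Qed.

Lemma cont2_mult (f g : R -> R -> R) (r s : R) :
  cont2 f r s -> cont2 g r s -> cont2 (fun r s => f r s * g r s) r s.
Proof.
  intros Hf Hg.
  exact (continuous_mult (fun p : R * R => f (fst p) (snd p))
           (fun p : R * R => g (fst p) (snd p)) _ Hf Hg).
Qed.

Lemma cont2_const (c r s : R) : cont2 (fun _ _ => c) r s.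
Proof. apply continuous_const. Qed.

Lemma cont2_fst (r s : R) : cont2 (fun r _ => r) r s.
Proof. apply (continuous_fst (U := R_UniformSpace) (V := R_UniformSpace)). Qed.

Lemma cont2_snd (r s : R) : cont2 (fun _ s => s) r s.
Proof. apply (continuous_snd (U := R_UniformSpace) (V := R_UniformSpace)). Qed.

Lemma cont2_derivable (f : R -> R) (l : R) (g : R -> R -> R) (r s : R) :
  is_derive f (g r s) l -> cont2 g r s -> cont2 (fun r s => f (g r s)) r s.
Proof.
  intros Hf. apply cont2_comp1, (is_derive_continuous f _ _ Hf).
Qed.

Lemma cont2_exp (g : R -> R -> R) (r s : R) :
  cont2 g r s -> cont2 (fun r s => exp (g r s)) r s.
Proof. apply (cont2_derivable exp (exp (g r s))), is_derive_exp. Qed.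

Lemma cont2_cos (g : R -> R -> R) (r s : R) :
  cont2 g r s -> cont2 (fun r s => cos (g r s)) r s.
Proof. apply (cont2_derivable cos (- sin (g r s))), is_derive_cos. Qed.

Lemma cont2_sin (g : R -> R -> R) (r s : R) :
  cont2 g r s -> cont2 (fun r s => sin (g r s)) r s.
Proof. apply (cont2_derivable sin (cos (g r s))), is_derive_sin. Qed.

Lemma cont2_atan (g : R -> R -> R) (r s : R) :
  cont2 g r s -> cont2 (fun r s => atan (g r s)) r s.
Proof. apply (cont2_derivable atan (/ (1 + (g r s)²))), is_derive_atan. Qed.

Lemma cont2_ln (g : R -> R -> R) (r s : R) :
  0 < g r s -> cont2 g r s -> cont2 (fun r s => ln (g r s)) r s.
Proof. intros H. apply (cont2_derivable ln (/ (g r s))), is_derive_ln, H. Qed.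

Lemma cont2_div (f g : R -> R -> R) (r s : R) :
  g r s <> 0 -> cont2 f r s -> cont2 g r s -> cont2 (fun r s => f r s / g r s) r s.
Proof.
  intros H Hf Hg. apply cont2_mult; auto.
  apply (cont2_derivable Rinv (- 1 / (g r s) ^ 2)); auto.
  apply (is_derive_inv (fun x => x)); auto. apply derive_id.
Qed.

Lemma cont2_pow (n : nat) (f : R -> R -> R) (r s : R) :
  cont2 f r s -> cont2 (fun r s => f r s ^ n) r s.
Proof.
  intros Hf. induction n; [apply cont2_const|]. simpl. now apply cont2_mult.
Qed.

(* Recurses on the head symbol; denominators and arguments of [ln] are left as goals. *)
Ltac prove_cont2 :=
  match goal with
  | |- cont2 (fun _ _ => ?c) _ _ => apply (cont2_const c)
  | |- cont2 (fun r _ => r) _ _ => apply cont2_fst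
  | |- cont2 (fun _ s => s) _ _ => apply cont2_snd
  | |- cont2 (fun r s => @?f r s + @?g r s) _ _ => apply (cont2_plus f g); prove_cont2
  | |- cont2 (fun r s => @?f r s - @?g r s) _ _ => apply (cont2_minus f g); prove_cont2
  | |- cont2 (fun r s => - @?f r s) _ _ => apply (cont2_opp f); prove_cont2
  | |- cont2 (fun r s => @?f r s * @?g r s) _ _ => apply (cont2_mult f g); prove_cont2
  | |- cont2 (fun r s => @?f r s / @?g r s) _ _ =>
      apply (cont2_div f g); [|prove_cont2|prove_cont2]
  | |- cont2 (fun r s => @?f r s ^ ?n) _ _ => apply (cont2_pow n f); prove_cont2
  | |- cont2 (fun r s => exp (@?f r s)) _ _ => apply (cont2_exp f); prove_cont2
  | |- cont2 (fun r s => cos (@?f r s)) _ _ => apply (cont2_cos f); prove_cont2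
  | |- cont2 (fun r s => sin (@?f r s)) _ _ => apply (cont2_sin f); prove_cont2
  | |- cont2 (fun r s => atan (@?f r s)) _ _ => apply (cont2_atan f); prove_cont2
  | |- cont2 (fun r s => ln (@?f r s)) _ _ => apply (cont2_ln f); [|prove_cont2]
  | |- _ => idtac
  end.

(** Cauchy's theorem on thin rectangles: for a holomorphic integrand the derivative
    across the line of integration is [i] times the derivative along it, so that only the
    values at the two ends of the line contribute. *)
Lemma derive_shifted_integral (lo hi : R) (u v us vs : R -> R -> R) (c d r : R) :
  conjugate_on lo hi u v us vs -> lo < r < hi -> 
  is_derive (fun r => RInt (fun s => exp (u r s) * cos (v r s)) c d) r
    (- (exp (u r d) * sin (v r d) - exp (u r c) * sin (v r c))).
Proof.
  intros [Dur Dvr Dus Dvs Cu Cv Cus Cvs] Hr.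
  set (g := fun r s => exp (u r s) * (- vs r s * cos (v r s) - us r s * sin (v r s))).
  assert (Hg : forall r s, lo < r < hi ->
            is_derive (fun r => exp (u r s) * cos (v r s)) r (g r s)).
  { intros r' s Hr'.
    replace (g r' s) with
      (plus (mult (exp (u r' s) * (- vs r' s)) (cos (v r' s)))
            (mult (exp (u r' s)) (- sin (v r' s) * us r' s)))
      by (unfold g, plus, mult; simpl; ring).
    apply (is_derive_mult (fun r => exp (u r s)) (fun r => cos (v r s))).
    - apply (derive_comp exp (fun r => u r s)); auto. apply is_derive_exp.
    - apply (derive_comp cos (fun r => v r s) r' (- sin (v r' s))); auto.
      apply is_derive_cos.
    - intros x y. apply Rmult_comm. }
  assert (Hloc : locally r (fun y => lo < y < hi)).
  { apply (open_and (fun y => lo < y) (fun y => y < hi)); auto.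
    - apply open_gt.
    - apply open_lt. }
  assert (Hc2 : forall s, cont2 g r s).
  { intros s. unfold g.
    apply cont2_mult; [now apply cont2_exp, Cu|].
    apply cont2_minus; apply cont2_mult.
    - now apply cont2_opp, Cvs.
    - now apply cont2_cos, Cv.
    - now apply Cus.
    - now apply cont2_sin, Cv. }
  assert (Hcs : forall y s, lo < y < hi -> continuous (fun s => exp (u y s) * cos (v y s)) s).
  { intros y s Hy. apply (continuous_mult (fun s => exp (u y s)) (fun s => cos (v y s))).
    - apply continuous_exp_comp, (is_derive_continuous _ _ _ (Dus y s Hy)).
    - apply continuous_cos_comp, (is_derive_continuous _ _ _ (Dvs y s Hy)). }
  assert (E : RInt (fun s => Derive (fun r => exp (u r s) * cos (v r s)) r) c d
              = - (exp (u r d) * sin (v r d) - exp (u r c) * sin (v r c))).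
  { rewrite (RInt_ext _ (fun s => g r s)).
    2:{ intros s _. now apply is_derive_unique, Hg. }
    apply (is_RInt_unique (V := R_CompleteNormedModule)).
    replace (- (exp (u r d) * sin (v r d) - exp (u r c) * sin (v r c)))
      with (minus (- (exp (u r d) * sin (v r d))) (- (exp (u r c) * sin (v r c))))
      by (unfold minus, plus, opp; simpl; ring).
    apply (is_RInt_derive (V := R_CompleteNormedModule)
             (fun s => - (exp (u r s) * sin (v r s))) (fun s => g r s)).
    - intros s _.
      replace (g r s) with
        (- (plus (mult (exp (u r s) * us r s) (sin (v r s)))
             (mult (exp (u r s)) (cos (v r s) * vs r s))))
        by (unfold g, plus, mult; simpl; ring).
      apply derive_opp.
      apply (is_derive_mult (fun s => exp (u r s)) (fun s => sin (v r s))).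
      + apply (derive_comp exp (u r)); auto. apply is_derive_exp.
      + apply (derive_comp sin (v r)); auto. apply is_derive_sin.
      + intros x y. apply Rmult_comm.
    - intros s _. 
      apply (continuous_comp_2 (fun _ : R => r) (fun s : R => s) g).
      + apply continuous_const.
      + apply continuous_id.
      + apply Hc2. }
  rewrite <- E.
  apply (is_derive_RInt_param (fun r s => exp (u r s) * cos (v r s))).
  - revert Hloc. apply filter_imp. intros y Hy t _. exists (g y t). now apply Hg.
  - intros t _. apply (continuity_2d_pt_ext_loc g).
    + destruct Hloc as [eps He]. exists eps. intros y s Hy _. symmetry.
      apply is_derive_unique, Hg, He, Hy.
    + apply continuity_2d_pt_filterlim, Hc2.
  - revert Hloc. apply filter_imp. intros y Hy. apply ex_RInt_cont. intros; now apply Hcs.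
Qed.

(** * Windows around a stationary point and around a maximum *)

Lemma RInt_affine (f : R -> R) (u v a b : R) :
  u <> 0 -> (forall x, continuous f x) ->
  RInt (fun y => f (u * y + v)) a b = / u * RInt f (u * a + v) (u * b + v).
Proof.
  intros Hu Hf.
  assert (Hc : forall x, continuous (fun y => f (u * y + v)) x).
  { intros x. now apply continuous_affine. }
  assert (E : RInt (fun y => u * f (u * y + v)) a b = u * RInt (fun y => f (u * y + v)) a b).
  { apply (RInt_scal (V := R_CompleteNormedModule) (fun y => f (u * y + v)) a b u).
    now apply ex_RInt_cont. }
  assert (E2 : RInt (fun y => u * f (u * y + v)) a b = RInt f (u * a + v) (u * b + v)).
  { apply (RInt_comp_lin f). now apply ex_RInt_cont. }
  apply (Rmult_eq_reg_l u); auto. rewrite <- E, E2, <- Rmult_assoc, Rinv_r, Rmult_1_l; auto.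
Qed.

Definition fresnel (W c : R) : R := RInt (fun v => cos (c + v ^ 2 / 2)) (- W) W.

Lemma continuous_fresnel (c s : R) : continuous (fun v => cos (c + v ^ 2 / 2)) s.
Proof.
  apply (is_derive_continuous _ _ (- s * sin (c + s ^ 2 / 2))).
  auto_derive; trivial. unfold pow, Rdiv. field.
Qed.

(** Stationary phase with explicit constants. In the window [|s - s0| <= W / b] the phase is
    replaced by its quadratic Taylor polynomial; outside, the phase is monotone and
    van der Corput's test applies. Two integrals with the same [phi s0] are to be compared
    through the same window and the same truncated Fresnel integral; the error is
    small compared with the main term [1 / b] as soon as [W] and then [b * s0] are large,
    uniformly in [s0]. *)
Lemma stationary_phase (phi p q : R -> R) (L s0 b K W : R) :
  0 < s0 -> 3 / 2 * s0 <= L -> 0 < b -> 0 <= K -> 0 < W ->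
  (forall s, is_derive phi s (p s)) -> (forall s, is_derive p s (q s)) ->
  (forall s, 0 <= s <= L -> 0 <= q s) ->
  p s0 = 0 ->
  (forall s, Rabs (s - s0) <= s0 / 2 ->
     Rabs (q s - b ^ 2) <= K * b ^ 2 * Rabs (s - s0) / s0) ->
  2 * W <= b * s0 -> 2 * K * W <= b * s0 ->
  Rabs (RInt (fun s => cos (phi s)) 0 L - / b * fresnel W (phi s0))
    <= / b * (8 / W + 2 * K * W ^ 4 / (b * s0)).
Proof.
  intros Hs0 HL Hb HK HW Hphi Hp Hq Hp0 Hlip HW1 HW2.
  set (w := W / b).
  assert (Hw : 0 < w) by (unfold w; pos).
  assert (Hbw : b * w = W) by (unfold w; field; lra).
  assert (Hws : w <= s0 / 2) by nra.
  set (k := K * b ^ 2 * w / s0).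
  assert (Hk0 : 0 <= k) by (unfold k; pos).
  assert (Hks : k * s0 = K * b ^ 2 * w) by (unfold k; field; lra).
  assert (Hkb : k <= b ^ 2 / 2).
  { apply Rmult_le_reg_r with s0; auto. rewrite Hks.
    replace (K * b ^ 2 * w) with (b * (K * (b * w))) by ring. rewrite Hbw. nra. }
  set (I := fun s => s0 - w <= s <= s0 + w).
  assert (Hqk : forall s, I s -> Rabs (q s - b ^ 2) <= k).
  { intros s Hs. unfold I in Hs.
    assert (Rabs (s - s0) <= w) by (apply Rabs_le; lra).
    eapply Rle_trans; [apply Hlip; lra|].
    unfold k, Rdiv. apply Rmult_le_compat_r; [pos|]. apply Rmult_le_compat_l; pos. }
  assert (Hpk : forall s, I s -> Rabs (p s - b ^ 2 * (s - s0)) <= k * w).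
  { intros s Hs. unfold I in *.
    pose proof (lipschitz_on (fun s => p s - b ^ 2 * (s - s0)) (fun s => q s - b ^ 2)
      (s0 - w) (s0 + w) k) as Hl.
    assert (Rabs (s - s0) <= w) by (apply Rabs_le; lra).
    replace (p s - b ^ 2 * (s - s0))
      with ((p s - b ^ 2 * (s - s0)) - (p s0 - b ^ 2 * (s0 - s0))) by (rewrite Hp0; ring).
    eapply Rle_trans; [apply Hl; auto; try lra|].
    - intros x _. apply derive_minus; auto. derivative.
    - apply Rmult_le_compat_l; auto. }
  assert (Hphik : forall s, I s ->
            Rabs (cos (phi s) - cos (phi s0 + (b * s + - (b * s0)) ^ 2 / 2)) <= k * w * w).
  { intros s Hs. unfold I in *.
    eapply Rle_trans; [apply cos_lipschitz|].
    assert (Rabs (s - s0) <= w) by (apply Rabs_le; lra).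
    pose proof (lipschitz_on (fun s => phi s - b ^ 2 * (s - s0) ^ 2 / 2)
      (fun s => p s - b ^ 2 * (s - s0)) (s0 - w) (s0 + w) (k * w)) as Hl.
    replace (phi s - (phi s0 + (b * s + - (b * s0)) ^ 2 / 2))
      with ((phi s - b ^ 2 * (s - s0) ^ 2 / 2) - (phi s0 - b ^ 2 * (s0 - s0) ^ 2 / 2)) by field.
    eapply Rle_trans; [apply Hl; auto; try lra|].
    - intros x _. apply derive_minus; auto. derivative.
    - apply Rmult_le_compat_l; pos. }
  assert (Hc : forall s, continuous (fun s => cos (phi s)) s).
  { intros s. apply continuous_cos_comp, (is_derive_continuous _ _ _ (Hphi s)). }
  assert (Hf : forall s, continuous (fun s => cos (phi s0 + (b * s + - (b * s0)) ^ 2 / 2)) s).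
  { intros s. apply (continuous_affine (fun v => cos (phi s0 + v ^ 2 / 2))).
    intros; apply continuous_fresnel. }
  assert (Hin : Rabs (RInt (fun s => cos (phi s)) (s0 - w) (s0 + w) - / b * fresnel W (phi s0))
                <= k * w * w * (2 * w)).
  { replace (/ b * fresnel W (phi s0)) with
      (RInt (fun s => cos (phi s0 + (b * s + - (b * s0)) ^ 2 / 2)) (s0 - w) (s0 + w)).
    - replace (2 * w) with (s0 + w - (s0 - w)) by ring.
      apply RInt_close; auto; lra.
    - rewrite (RInt_affine (fun v => cos (phi s0 + v ^ 2 / 2))) by (try lra; intros; apply continuous_fresnel).
      unfold fresnel. f_equal. f_equal; rewrite <- Hbw; ring. }
  assert (Hout1 : Rabs (RInt (fun s => cos (phi s)) (s0 + w) L) <= 2 / (b * W / 2)).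
  { apply (van_der_corput phi p q); auto; try lra.
    - nra.
    - intros; apply Hq; lra.
    - left. specialize (Hpk (s0 + w) ltac:(unfold I; lra)).
      apply Rabs_le_between in Hpk. rewrite <- Hbw. nra. }
  assert (Hout2 : Rabs (RInt (fun s => cos (phi s)) 0 (s0 - w)) <= 2 / (b * W / 2)).
  { apply (van_der_corput phi p q); auto; try lra.
    - nra.
    - intros; apply Hq; lra.
    - right. specialize (Hpk (s0 - w) ltac:(unfold I; lra)).
      apply Rabs_le_between in Hpk. rewrite <- Hbw. nra. }
  rewrite (RInt_split _ 0 (s0 - w) L) by auto.
  rewrite (RInt_split _ (s0 - w) (s0 + w) L) by auto.
  replace (/ b * (8 / W + 2 * K * W ^ 4 / (b * s0)))
    with (2 / (b * W / 2) + (k * w * w * (2 * w) + 2 / (b * W / 2))).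
  2:{ unfold k, w. field. repeat split; lra. }
  rabs.
Qed.

Definition half_gauss (W : R) : R := RInt (fun v => exp (- (v ^ 2 / 2))) 0 W.

Lemma continuous_half_gauss (s : R) : continuous (fun v => exp (- (v ^ 2 / 2))) s.
Proof.
  apply (is_derive_continuous _ _ (- s * exp (- (s ^ 2 / 2)))).
  auto_derive; trivial. unfold pow, Rdiv. field.
Qed.

Lemma exp_neg_le_inv (y : R) : 0 < y -> exp (- y) <= / y.
Proof.
  intros Hy. rewrite exp_Ropp. apply Rinv_le_contravar; auto.
  pose proof (exp_ineq1 y ltac:(lra)). lra.
Qed.

Lemma exp_lipschitz_neg (x y : R) : x <= 0 -> y <= 0 -> Rabs (exp x - exp y) <= Rabs (x - y).
Proof.
  intros Hx Hy. rewrite <- (Rmult_1_l (Rabs (x - y))).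
  apply (lipschitz_on exp exp (Rmin x y) (Rmax x y)).
  - intros; apply is_derive_exp.
  - intros z [_ Hz]. rewrite Rabs_pos_eq by pos. rewrite <- exp_0. apply exp_le.
    eapply Rle_trans; [exact Hz|now apply Rmax_lub].
  - split; [apply Rmin_r|apply Rmax_r].
  - split; [apply Rmin_l|apply Rmax_l].
Qed.

(** Laplace's method with explicit constants, for the real part of [exp (x + i v)] and in the
    form of [stationary_phase]: only the shape of [x] and [v] in the window [b * s <= W]
    matters, beyond a Gaussian bound. *)
Lemma laplace_window (x v : R -> R) (L b k eta W : R) :
  0 < b -> 0 < k -> 0 < W -> W <= b * L ->
  (forall s, continuous x s) -> (forall s, continuous v s) ->
  (forall s, 0 <= s <= L -> x s <= - (k * (b * s) ^ 2)) ->
  (forall s, 0 <= s -> b * s <= W -> Rabs (x s + (b * s) ^ 2 / 2) + Rabs (v s) <= eta) ->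
  Rabs (RInt (fun s => exp (x s) * cos (v s)) 0 L - / b * half_gauss W)
    <= / b * (eta * W + / (k * W)).
Proof.
  intros Hb Hk HW HWL Hx Hv Hneg Hwin.
  set (E := fun s => exp (x s) * cos (v s)).
  assert (HE : forall s, continuous E s).
  { intros s. apply (continuous_mult (fun s => exp (x s)) (fun s => cos (v s))).
    - now apply continuous_exp_comp.
    - now apply continuous_cos_comp. }
  assert (Hcos : forall s, Rabs (E s) <= exp (x s)).
  { intros s. rewrite <- (Rmult_1_r (exp (x s))). apply Rabs_scal_le; [pos|].
    apply Rabs_le, COS_bound. }
  assert (Hin : forall s, 0 <= s -> b * s <= W -> Rabs (E s - exp (- ((b * s) ^ 2 / 2))) <= eta).
  { intros s Hs Hs2. specialize (Hwin s Hs Hs2).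
    assert (Hx0 : x s <= 0).
    { pose proof (Hneg s ltac:(nra)). assert (0 <= k * (b * s) ^ 2) by pos. lra. }
    pose proof (pow2_ge_0 (b * s)).
    pose proof (exp_lipschitz_neg (x s) (- ((b * s) ^ 2 / 2)) Hx0 ltac:(lra)) as T1.
    replace (x s - - ((b * s) ^ 2 / 2)) with (x s + (b * s) ^ 2 / 2) in T1 by ring.
    pose proof (cos_lipschitz (v s) 0) as T2. rewrite cos_0, Rminus_0_r in T2.
    pose proof (exp_le _ _ Hx0) as T3. rewrite exp_0 in T3. pose proof (exp_pos (x s)).
    pose proof (Rabs_pos (cos (v s) - 1)).
    replace (E s - exp (- ((b * s) ^ 2 / 2)))
      with (exp (x s) * (cos (v s) - 1) + (exp (x s) - exp (- ((b * s) ^ 2 / 2))))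
      by (unfold E; ring).
    eapply Rle_trans; [apply Rabs_triang|]. rewrite Rabs_mult, (Rabs_pos_eq (exp (x s))) by lra.
    nra. }
  set (w := W / b).
  assert (Hw : 0 < w) by (unfold w; pos).
  assert (Hbw : b * w = W) by (unfold w; field; lra).
  assert (HwL : w <= L) by nra.
  assert (Hg : forall s, continuous (fun s => exp (- ((b * s + 0) ^ 2 / 2))) s).
  { intros s. apply (continuous_affine (fun v => exp (- (v ^ 2 / 2)))), continuous_half_gauss. }
  assert (H1 : Rabs (RInt E 0 w - / b * half_gauss W) <= eta * w).
  { replace (/ b * half_gauss W) with (RInt (fun s => exp (- ((b * s + 0) ^ 2 / 2))) 0 w).
    - replace (eta * w) with (eta * (w - 0)) by ring.
      apply RInt_close; auto; try lra.
      intros s Hs. rewrite Rplus_0_r. apply Hin; nra.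
    - rewrite (RInt_affine (fun v => exp (- (v ^ 2 / 2)))) by (try lra; apply continuous_half_gauss).
      unfold half_gauss. f_equal. f_equal; rewrite <- ?Hbw; ring. }
  assert (H2 : Rabs (RInt E w L) <= - / (k * b ^ 2 * L) - - / (k * b ^ 2 * w)).
  { apply (RInt_dominated E (fun s => - / (k * b ^ 2 * s)) (fun s => / (k * (b * s) ^ 2))); auto.
    - intros s Hs. assert (0 < k * b ^ 2 * s) by pos.
      auto_derive; [lra|]. field. repeat split; lra.
    - intros s Hs. assert (0 < k * (b * s) ^ 2) by pos.
      eapply Rle_trans; [apply Hcos|]. eapply Rle_trans; [|now apply exp_neg_le_inv].
      apply exp_le, Hneg. lra. }
  assert (H3 : 0 < / (k * b ^ 2 * L)) by pos.
  rewrite (RInt_split E 0 w L) by auto.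
  replace (/ b * (eta * W + / (k * W))) with (eta * w + / (k * b ^ 2 * w)).
  2:{ rewrite <- Hbw. field. repeat split; lra. }
  rabs.
Qed.

(** * The Airy function *)

Definition airy_trunc (x L : R) : R := RInt (fun t => cos (t ^ 3 / 3 + x * t)) 0 L.

Lemma derive_airy_phase (x t : R) :
  is_derive (fun t => t ^ 3 / 3 + x * t) t (t ^ 2 + x).
Proof. auto_derive; trivial. field. Qed.

Lemma continuous_airy_integrand (x t : R) :
  continuous (fun t => cos (t ^ 3 / 3 + x * t)) t.
Proof. apply continuous_cos_comp, (is_derive_continuous _ _ _ (derive_airy_phase x t)). Qed.

Lemma airy_tail (x u v m : R) :
  0 <= u <= v -> 0 < m <= u ^ 2 + x -> 
  Rabs (airy_trunc x v - airy_trunc x u) <= 2 / m.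
Proof.
  intros Huv Hm. unfold airy_trunc.
  rewrite (RInt_split _ 0 u v) by apply continuous_airy_integrand.
  replace (_ + _ - _) with (0 + RInt (fun t => cos (t ^ 3 / 3 + x * t)) u v) by ring.
  rewrite Rplus_0_l.
  apply (van_der_corput (fun t => t ^ 3 / 3 + x * t) (fun t => t ^ 2 + x) (fun t => 2 * t)); try lra.
  - intros; apply derive_airy_phase.
  - intros; derivative.
  - intros; lra.
Qed.

Lemma airy_trunc_limit (x : R) :
  exists l : R, filterlim (airy_trunc x) (Rbar_locally p_infty) (locally l).
Proof.
  apply (filterlim_locally_cauchy (U := R_CompleteSpace)).
  intros eps. pose proof (cond_pos eps) as He.
  set (m := 4 / eps).
  assert (Hm : 0 < m) by (unfold m; pos).
  set (B := Rabs x + m + 1). pose proof (Rle_abs (- x)) as Hx.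
  rewrite Rabs_Ropp in Hx. pose proof (Rabs_pos x) as Hx'.
  assert (key : forall u v, B < u -> u <= v -> Rabs (airy_trunc x v - airy_trunc x u) < eps).
  { intros u v Hu Hv. apply Rle_lt_trans with (2 / m).
    - apply airy_tail; unfold B in *; [lra|]. split; nra.
    - replace (2 / m) with (eps / 2) by (unfold m; field; lra). lra. }
  exists (fun u => B < u). split.
  - exists B. auto.
  - intros u v Hu Hv. destruct (Rle_dec u v).
    + now apply key.
    + apply ball_sym. apply key; lra.
Qed.

Lemma is_Airy (x : R) :
  filterlim (airy_trunc x) (Rbar_locally p_infty) (locally (PI * Airy x)).
Proof.
  destruct (airy_trunc_limit x) as [l Hl].
  replace (PI * Airy x) with l; auto.
  unfold Airy.
  assert (E : RInt_gen (V := R_CompleteNormedModule)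
    (fun t : R => cos (t ^ 3 / 3 + x * t)) (at_point 0) (Rbar_locally p_infty) = l).
  { apply (@is_RInt_gen_unique R_CompleteNormedModule (at_point 0) (Rbar_locally p_infty)).
    - apply Proper_StrongProper; apply at_point_filter.
    - apply Proper_StrongProper; apply Rbar_locally_filter.
    - intros P HP. 
      apply (Filter_prod _ _ _ (fun a => a = 0) (fun b => P (airy_trunc x b))).
      + reflexivity.
      + exact (Hl P HP).
      + intros a b Ha Hb. exists (airy_trunc x b). split; auto. simpl. subst a.
        apply (RInt_correct (V := R_CompleteNormedModule)), ex_RInt_cont, continuous_airy_integrand. }
  rewrite E. field. apply PI_neq0.
Qed.

Lemma airy_remainder (x L m : R) :
  0 <= L -> 0 < m <= L ^ 2 + x -> Rabs (PI * Airy x - airy_trunc x L) <= 2 / m.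
Proof.
  intros HL Hm. apply le_epsilon. intros e He.
  destruct (is_Airy x (ball (PI * Airy x) (mkposreal e He)) (locally_ball _ _)) as [B HB].
  set (v := Rmax L (B + 1)).
  specialize (HB v). pose proof (Rmax_l L (B + 1)). pose proof (Rmax_r L (B + 1)).
  fold v in H, H0. specialize (HB ltac:(lra)).
  unfold ball in HB; simpl in HB; unfold AbsRing_ball, abs, minus, plus, opp in HB; simpl in HB.
  pose proof (airy_tail x L v m ltac:(lra) Hm) as Ht.
  rabs.
Qed.

(** A modulus of continuity for the Airy function, uniform on bounded sets: cut both
    integrals at [L], where the tails are small by van der Corput. *)
Lemma airy_lipschitz (x y L m : R) :
  0 <= L -> 0 < m -> m <= L ^ 2 + x -> m <= L ^ 2 + y ->
  Rabs (PI * Airy x - PI * Airy y) <= L ^ 2 * Rabs (x - y) + 4 / m.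
Proof.
  intros HL Hm Hx Hy.
  pose proof (airy_remainder x L m HL ltac:(lra)) as H1.
  pose proof (airy_remainder y L m HL ltac:(lra)) as H2.
  assert (H3 : Rabs (airy_trunc x L - airy_trunc y L) <= L * Rabs (x - y) * (L - 0)).
  { apply RInt_close; auto using continuous_airy_integrand.
    intros t Ht. eapply Rle_trans; [apply cos_lipschitz|].
    replace (t ^ 3 / 3 + x * t - (t ^ 3 / 3 + y * t)) with (t * (x - y)) by ring.
    rewrite Rabs_mult, (Rabs_pos_eq t) by lra.
    apply Rmult_le_compat_r; [apply Rabs_pos|lra]. }
  apply Rabs_le_between in H1. apply Rabs_le_between in H2. apply Rabs_le_between in H3.
  replace (L ^ 2 * Rabs (x - y)) with (L * Rabs (x - y) * (L - 0)) by ring.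
  unfold Rdiv in *. apply Rabs_le. lra.
Qed.

(** The stationary point of the Airy phase with argument [- r^2] is [r], with second
    derivative [2 r] and phase [- 2/3 r^3]; the bound for truncated integrals passes to the
    limit because it does not depend on the upper end. *)
Lemma airy_oscillatory (r b W : R) :
  0 < r -> 0 < b -> b ^ 2 = 2 * r -> 0 < W -> 2 * W <= b * r ->
  Rabs (PI * Airy (- r ^ 2) - / b * fresnel W (- (2 / 3 * r ^ 3)))
    <= / b * (8 / W + 2 * 1 * W ^ 4 / (b * r)).
Proof.
  intros Hr Hb Hbr HW HW2. apply le_epsilon. intros e He.
  set (m := 2 / e). assert (Hm : 0 < m) by (unfold m; pos).
  set (L := 2 * r + m + 1).
  pose proof (airy_remainder (- r ^ 2) L m ltac:(unfold L; lra) ltac:(unfold L; split; nra)) as H1.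
  replace (2 / m) with e in H1 by (unfold m; field; lra).
  assert (H2 : Rabs (airy_trunc (- r ^ 2) L - / b * fresnel W (- (2 / 3 * r ^ 3)))
    <= / b * (8 / W + 2 * 1 * W ^ 4 / (b * r))).
  { replace (- (2 / 3 * r ^ 3)) with (r ^ 3 / 3 + - r ^ 2 * r) by field.
    apply (stationary_phase (fun t => t ^ 3 / 3 + - r ^ 2 * t) (fun t => t ^ 2 + - r ^ 2)
      (fun t => 2 * t) L r b 1 W); try lra.
    - unfold L; lra.
    - intros; apply derive_airy_phase.
    - intros; derivative.
    - intros; lra.
    - intros s _. rewrite Hbr. right.
      replace (2 * s - 2 * r) with (2 * (s - r)) by ring.
      rewrite Rabs_mult, (Rabs_pos_eq 2) by lra. field; lra. }
  rabs.
Qed.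

(** Up to the factor [exp (- 2/3 eta^3)] this is the real part of the Airy integrand with
    argument [eta^2] on the horizontal line through its saddle point [i eta]. *)
Definition airy_saddle (eta s : R) : R := exp (- (eta * s ^ 2)) * cos (s ^ 3 / 3).

Lemma continuous_airy_saddle (eta s : R) : continuous (airy_saddle eta) s.
Proof.
  apply (is_derive_continuous _ _
    (- (2 * eta * s) * exp (- (eta * s ^ 2)) * cos (s ^ 3 / 3)
     - s ^ 2 * exp (- (eta * s ^ 2)) * sin (s ^ 3 / 3))).
  unfold airy_saddle. auto_derive; trivial. unfold pow, Rdiv. field.
Qed.

(** Moving the half line [[0, L]] to height [eta]: the left vertical side is purely
    imaginary, and on the right one the integrand decays like [exp (- L^2 r)]. *)
Lemma airy_shift (eta L : R) :
  0 <= eta -> 0 < L ->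
  Rabs (exp (- (2 / 3 * eta ^ 3)) * RInt (airy_saddle eta) 0 L - airy_trunc (eta ^ 2) L)
    <= / L ^ 2.
Proof.
  intros Heta HL.
  set (u := fun r s => - (s ^ 2 * r) + (r ^ 3 / 3 - eta ^ 2 * r)).
  set (v := fun r s => s ^ 3 / 3 - s * r ^ 2 + eta ^ 2 * s).
  set (us := fun r s => - (2 * s * r)).
  set (vs := fun r s => s ^ 2 - r ^ 2 + eta ^ 2).
  assert (Hconj : conjugate_on (-1) (eta + 1) u v us vs).
  { split; intros r s _; unfold u, v, us, vs.
    - auto_derive; trivial. field.
    - auto_derive; trivial. field.
    - auto_derive; trivial. field.
    - auto_derive; trivial. field.
    all: prove_cont2; lra. }
  set (J := fun r => RInt (fun s => exp (u r s) * cos (v r s)) 0 L).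
  assert (E0 : J 0 = airy_trunc (eta ^ 2) L).
  { unfold J, airy_trunc. apply RInt_ext. intros s _. unfold u, v.
    replace (- (s ^ 2 * 0) + (0 ^ 3 / 3 - eta ^ 2 * 0)) with 0 by field.
    rewrite exp_0, Rmult_1_l. f_equal. field. }
  assert (E1 : J eta = exp (- (2 / 3 * eta ^ 3)) * RInt (airy_saddle eta) 0 L).
  { unfold J. rewrite <- (RInt_scal (V := R_CompleteNormedModule) (airy_saddle eta)).
    - apply RInt_ext. intros s _. unfold u, v, airy_saddle, scal; simpl; unfold mult; simpl.
      rewrite <- (Rmult_assoc (exp (- (2 / 3 * eta ^ 3)))), <- exp_plus. f_equal; f_equal; field.
    - apply ex_RInt_cont, continuous_airy_saddle. }
  rewrite <- E0, <- E1.
  apply Rle_trans with (- (exp (- (L ^ 2 * eta)) / L ^ 2) - - (exp (- (L ^ 2 * 0)) / L ^ 2)).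
  - assert (HL2 : 0 < L ^ 2) by pos.
    apply (derive_dominated J (fun r => - (exp (- (L ^ 2 * r)) / L ^ 2))
      (fun r => - (exp (u r L) * sin (v r L) - exp (u r 0) * sin (v r 0)))
      (fun r => exp (- (L ^ 2 * r)))); auto.
    + intros r Hr. apply (derive_shifted_integral (-1) (eta + 1) u v us vs); auto. lra.
    + intros r _. generalize (L ^ 2) HL2. intros K HK. auto_derive; [lra|]. field. lra.
    + intros r Hr. rewrite Rabs_Ropp.
      replace (sin (v r 0)) with 0.
      2:{ unfold v. replace (0 ^ 3 / 3 - 0 * r ^ 2 + eta ^ 2 * 0) with 0 by field.
          now rewrite sin_0. }
      rewrite Rmult_0_r, Rminus_0_r, Rabs_mult, (Rabs_pos_eq (exp _)) by (left; apply exp_pos).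
      apply Rle_trans with (exp (u r L) * 1).
      * apply Rmult_le_compat_l; [left; apply exp_pos|]. apply Rabs_le, SIN_bound.
      * rewrite Rmult_1_r. unfold u.
        assert (- (L ^ 2 * r) + (r ^ 3 / 3 - eta ^ 2 * r) <= - (L ^ 2 * r)).
        { assert (0 <= r * (eta ^ 2 - r ^ 2 / 3)) by (apply Rmult_le_pos; nra). nra. }
        now apply exp_le.
  - rewrite Rmult_0_r, Ropp_0, exp_0. pose proof (exp_pos (- (L ^ 2 * eta))).
    assert (0 < / L ^ 2) by (apply Rinv_0_lt_compat, pow_lt; lra).
    unfold Rdiv. nra.
Qed.

Lemma airy_saddle_limit (eta e : R) :
  0 <= eta -> 0 < e ->
  exists L0, forall L, L0 <= L ->
    Rabs (exp (2 / 3 * eta ^ 3) * (PI * Airy (eta ^ 2)) - RInt (airy_saddle eta) 0 L) <= e.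
Proof.
  intros Heta He.
  set (C := exp (2 / 3 * eta ^ 3)). assert (HC : 0 < C) by apply exp_pos.
  assert (H3 : 0 < 3 * C / e) by pos.
  exists (1 + 3 * C / e). intros L HL.
  assert (HL1 : 1 <= L) by lra.
  pose proof (airy_shift eta L Heta ltac:(lra)) as H1.
  pose proof (airy_remainder (eta ^ 2) L (L ^ 2) ltac:(lra)
    ltac:(split; [apply pow_lt; lra | pose proof (pow2_ge_0 eta); lra])) as H2.
  replace (exp (- (2 / 3 * eta ^ 3))) with (/ C) in H1 by (unfold C; now rewrite exp_Ropp).
  set (I := RInt (airy_saddle eta) 0 L) in *.
  replace (C * (PI * Airy (eta ^ 2)) - I)
    with (C * ((PI * Airy (eta ^ 2) - airy_trunc (eta ^ 2) L)
                - (/ C * I - airy_trunc (eta ^ 2) L))).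
  2:{ transitivity (C * (PI * Airy (eta ^ 2)) - C * / C * I); [ring|].
      rewrite Rinv_r, Rmult_1_l; [reflexivity|lra]. }
  rewrite Rabs_mult, (Rabs_pos_eq C) by lra.
  assert (H4 : Rabs ((PI * Airy (eta ^ 2) - airy_trunc (eta ^ 2) L)
                - (/ C * I - airy_trunc (eta ^ 2) L)) <= 3 / L ^ 2).
  { rabs. }
  apply Rle_trans with (C * (3 / L ^ 2)); [apply Rmult_le_compat_l; lra|].
  assert (HL2 : 3 * C / e <= L ^ 2) by nra.
  apply Rmult_le_reg_r with (L ^ 2); [nra|].
  replace (C * (3 / L ^ 2) * L ^ 2) with (e * (3 * C / e)) by (field; split; lra).
  apply Rmult_le_compat_l; lra.
Qed.

(** Asymptotics on the recessive side, with [exp (- 2/3 eta^3)] factored out so that the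
    error is relative. *)
Lemma airy_recessive (eta b W : R) :
  0 < eta -> 0 < b -> b ^ 2 = 2 * eta -> 0 < W ->
  Rabs (exp (2 / 3 * eta ^ 3) * (PI * Airy (eta ^ 2)) - / b * half_gauss W)
    <= / b * (W ^ 3 / (3 * b ^ 3) * W + / (1 / 2 * W)).
Proof.
  intros Heta Hb Hbe HW. apply le_epsilon. intros e He.
  destruct (airy_saddle_limit eta e) as [L0 HL0]; try lra.
  set (L := Rmax L0 (W / b)).
  specialize (HL0 L (Rmax_l _ _)).
  assert (HWL : W <= b * L).
  { replace W with (b * (W / b)) by (field; lra).
    apply Rmult_le_compat_l; [lra|]. apply Rmax_r. }
  assert (H : Rabs (RInt (airy_saddle eta) 0 L - / b * half_gauss W)
            <= / b * (W ^ 3 / (3 * b ^ 3) * W + / (1 / 2 * W))).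
  { assert (Hg : forall s, eta * s ^ 2 = (b * s) ^ 2 / 2).
    { intros s. rewrite Rpow_mult_distr, Hbe. field. }
    apply (laplace_window (fun s => - (eta * s ^ 2)) (fun s => s ^ 3 / 3)); try lra.
    - intros s. apply (is_derive_continuous _ _ (- (2 * eta * s))). derivative.
    - intros s. apply (is_derive_continuous _ _ (s ^ 2)). derivative.
    - intros s _. rewrite Hg. lra.
    - intros s Hs Hs2. rewrite Hg, Rplus_opp_l, Rabs_R0, Rplus_0_l, Rabs_pos_eq by pos.
      replace (s ^ 3 / 3) with ((b * s) ^ 3 / (3 * b ^ 3)) by (field; lra).
      unfold Rdiv. apply Rmult_le_compat_r; [pos|]. apply pow_incr. split; [pos|lra]. }
  rabs.
Qed.

(** Positivity of the Airy function, quantified and before the limits [e -> 0] and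
    [L -> oo]. The oscillating factor [cos (t^3/3)] is integrated by parts twice, as
    [(sin (t^3/3))' / t^2] and then as [(1 - cos (t^3/3))' / t^2]; the weights decrease, so
    the integrand that remains is nonnegative. The boundary terms form [Q], and the interval
    [[1, 2]] alone provides the lower bound. *)
Lemma airy_positive_aux (eta e : R) :
  0 <= eta -> 0 < e <= 1 -> forall L, 2 <= L ->
  (1 - cos (1 / 3)) * (10 / 64 * exp (- (eta * 4))) - e * (2 * eta + 4) - / L ^ 2
    <= RInt (airy_saddle eta) 0 L.
Proof.
  intros Heta He L HL.
  set (G := fun t => exp (- (eta * t ^ 2))).
  set (Q := fun t => sin (t ^ 3 / 3) * (G t / t ^ 2)
                     + (1 - cos (t ^ 3 / 3)) * (G t * (2 * eta / t ^ 3 + 2 / t ^ 5))).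
  set (D := fun t => G t * (4 * eta ^ 2 / t ^ 2 + 10 * eta / t ^ 4 + 10 / t ^ 6)).
  assert (HQ : forall t, 0 < t ->
     is_derive Q t (airy_saddle eta t - (1 - cos (t ^ 3 / 3)) * D t)).
  { intros t Ht. unfold Q, D, airy_saddle, G. auto_derive.
    - repeat split; auto; apply Rgt_not_eq; pos.
    - unfold pow, Rdiv. field. lra. }
  assert (HG : forall t, 0 < G t <= 1).
  { intros t. split; [apply exp_pos|]. unfold G. rewrite <- exp_0.
    assert (0 <= eta * t ^ 2) by pos. apply exp_le. lra. }
  assert (HD : forall t, 0 < t -> 0 <= D t).
  { intros t Ht. unfold D. apply Rmult_le_pos; [apply Rlt_le, HG|].
    assert (0 <= 4 * eta ^ 2 / t ^ 2) by pos. assert (0 <= 10 * eta / t ^ 4) by pos.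
    assert (0 <= 10 / t ^ 6) by pos. lra. }
  assert (Hstep : forall a b m, 0 < a <= b ->
     (forall t, a <= t <= b -> m <= (1 - cos (t ^ 3 / 3)) * D t) ->
     Q b - Q a + m * (b - a) <= RInt (airy_saddle eta) a b).
  { intros a b m Hab Hm.
    enough ((Q b + m * b) - (Q a + m * a)
            <= RInt (airy_saddle eta) a b - RInt (airy_saddle eta) a a) as Hs.
    { rewrite RInt_point in Hs. unfold zero in Hs; simpl in Hs. lra. }
    apply (derive_le (fun t => Q t + m * t) (fun t => RInt (airy_saddle eta) a t)
      (fun t => airy_saddle eta t - (1 - cos (t ^ 3 / 3)) * D t + m) (airy_saddle eta)); try lra.
    - intros t Ht. apply derive_plus; [apply HQ; lra|]. derivative.
    - intros t Ht. apply is_derive_RInt_upper, continuous_airy_saddle.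
    - intros t Ht. specialize (Hm t Ht). lra. }
  assert (Hcp : forall y, 0 <= 1 - cos y) by (intros y; pose proof (COS_bound y); lra).
  assert (H0 : Rabs (RInt (airy_saddle eta) 0 e) <= 1 * e - 1 * 0).
  { apply (RInt_dominated _ (fun x => 1 * x) (fun _ => 1)); try lra.
    - apply continuous_airy_saddle.
    - intros x _. derivative.
    - intros x _. unfold airy_saddle. change (exp (- (eta * x ^ 2))) with (G x).
      specialize (HG x). apply Rle_trans with (G x * 1); [|lra].
      apply Rabs_scal_le; [lra|]. apply Rabs_le, COS_bound. }
  assert (H1 : Q 1 - Q e + 0 * (1 - e) <= RInt (airy_saddle eta) e 1).
  { apply Hstep; [lra|]. intros t Ht. apply Rmult_le_pos; auto. apply HD; lra. }
  set (m := (1 - cos (1 / 3)) * (10 / 64 * exp (- (eta * 4)))).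
  assert (H2 : Q 2 - Q 1 + m * (2 - 1) <= RInt (airy_saddle eta) 1 2).
  { apply Hstep; [lra|]. intros t Ht. unfold m.
    assert (Ht2 : 1 <= t ^ 2 <= 4) by nra.
    assert (Ht3 : 1 <= t ^ 3 <= 8) by (simpl in *; nra).
    assert (Ht6 : 1 <= t ^ 6 <= 64).
    { replace (t ^ 6) with (t ^ 3 * t ^ 3) by ring. nra. }
    apply Rmult_le_compat.
    - apply Hcp.
    - pos.
    - pose proof PI2_3_2. pose proof (cos_decr_1 (1 / 3) (t ^ 3 / 3)). lra.
    - unfold D. rewrite (Rmult_comm (10 / 64)). apply Rmult_le_compat.
      + pos.
      + lra.
      + apply exp_le. nra.
      + assert (0 <= 4 * eta ^ 2 / t ^ 2) by pos. assert (0 <= 10 * eta / t ^ 4) by pos.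
        assert (10 / 64 <= 10 / t ^ 6).
        { apply Rmult_le_compat_l; [lra|]. apply Rinv_le_contravar; lra. }
        lra. }
  assert (H3 : Q L - Q 2 + 0 * (L - 2) <= RInt (airy_saddle eta) 2 L).
  { apply Hstep; [lra|]. intros t Ht. apply Rmult_le_pos; auto. apply HD; lra. }
  assert (HQL : - / L ^ 2 <= Q L).
  { unfold Q.
    assert (0 <= (1 - cos (L ^ 3 / 3)) * (G L * (2 * eta / L ^ 3 + 2 / L ^ 5))).
    { apply Rmult_le_pos; auto. apply Rmult_le_pos; [apply Rlt_le, HG|].
      assert (0 <= 2 * eta / L ^ 3) by pos. assert (0 <= 2 / L ^ 5) by pos. lra. }
    assert (- / L ^ 2 <= sin (L ^ 3 / 3) * (G L / L ^ 2)).
    { assert (0 < / L ^ 2) by pos.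
      replace (sin (L ^ 3 / 3) * (G L / L ^ 2)) with ((sin (L ^ 3 / 3) * G L) * / L ^ 2)
        by (unfold Rdiv; ring).
      assert (-1 <= sin (L ^ 3 / 3) * G L).
      { pose proof (SIN_bound (L ^ 3 / 3)). specialize (HG L). nra. }
      nra. }
    lra. }
  assert (HQe : Q e <= e * (2 * eta + 3)).
  { unfold Q.
    assert (He3 : 0 < e ^ 3) by pos.
    pose proof (sin_le_pos (e ^ 3 / 3) ltac:(lra)) as Hs.
    pose proof (one_minus_cos_bounds (e ^ 3 / 3)) as Hc.
    specialize (HG e).
    assert (sin (e ^ 3 / 3) * (G e / e ^ 2) <= e).
    { assert (0 < G e / e ^ 2 <= / e ^ 2).
      { assert (0 < / e ^ 2) by pos. unfold Rdiv; nra. }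
      apply Rle_trans with (e ^ 3 / 3 * (G e / e ^ 2)); [apply Rmult_le_compat_r; lra|].
      apply Rle_trans with (e ^ 3 / 3 * (/ e ^ 2)); [apply Rmult_le_compat_l; lra|].
      replace (e ^ 3 / 3 * / e ^ 2) with (e / 3) by (field; lra). lra. }
    assert ((1 - cos (e ^ 3 / 3)) * (G e * (2 * eta / e ^ 3 + 2 / e ^ 5)) <= e * (2 * eta + 2)).
    { assert (He5 : 0 < / e ^ 5) by pos.
      assert (Hb : 0 <= 2 * eta / e ^ 3 + 2 / e ^ 5 <= (2 * eta + 2) * / e ^ 5).
      { replace (2 * eta / e ^ 3) with (2 * eta * e ^ 2 * / e ^ 5) by (field; lra).
        assert (0 <= e ^ 2 <= 1) by nra. unfold Rdiv.
        assert (0 <= 2 * eta * e ^ 2 <= 2 * eta) by nra. nra. }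
      apply Rle_trans with ((e ^ 3 / 3) ^ 2 / 2 * ((2 * eta + 2) * / e ^ 5)).
      - apply Rmult_le_compat; try lra.
        + apply Rmult_le_pos; lra.
        + nra.
      - replace ((e ^ 3 / 3) ^ 2 / 2 * ((2 * eta + 2) * / e ^ 5)) with (e * (2 * eta + 2) / 18)
          by (field; lra). nra. }
    lra. }
  rewrite (RInt_split _ 0 e L), (RInt_split _ e 1 L), (RInt_split _ 1 2 L)
    by apply continuous_airy_saddle.
  apply Rabs_le_between in H0. lra.
Qed.

Lemma airy_lower_bound (eta : R) :
  0 <= eta ->
  (1 - cos (1 / 3)) * (10 / 64 * exp (- (eta * 4)))
    <= exp (2 / 3 * eta ^ 3) * (PI * Airy (eta ^ 2)).
Proof.
  intros Heta. apply le_epsilon. intros e He.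
  destruct (airy_saddle_limit eta (e / 3) Heta ltac:(lra)) as [L0 HL0].
  set (d := Rmin 1 (e / 3 / (2 * eta + 4))).
  assert (Hd0 : 0 < e / 3 / (2 * eta + 4)) by pos.
  assert (Hd : 0 < d <= 1) by (unfold d; split; [pos | apply Rmin_l]).
  assert (Hd2 : d * (2 * eta + 4) <= e / 3).
  { apply Rle_trans with (e / 3 / (2 * eta + 4) * (2 * eta + 4)).
    - apply Rmult_le_compat_r; [lra|apply Rmin_r].
    - right. field. lra. }
  set (L := Rmax L0 (2 + 3 / e)).
  assert (HL : 2 + 3 / e <= L) by apply Rmax_r.
  assert (H3e : 0 < 3 / e) by pos.
  specialize (HL0 L (Rmax_l _ _)).
  pose proof (airy_positive_aux eta d Heta Hd L ltac:(lra)) as H.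
  assert (/ L ^ 2 <= e / 3).
  { replace (e / 3) with (/ (3 / e)) by (field; lra).
    apply Rinv_le_contravar; nra. }
  apply Rabs_le_between in HL0. lra.
Qed.

(** * The phase of a power of a Blaschke factor *)

(** Both ends of the oscillatory range are treated at once. The end [1 / alpha0], where the
    critical points coalesce at [z = 1], is [mu = lam], [sg = -1]; the end [alpha0], where they
    coalesce at [z = -1], becomes a coalescence at [1] for [mu = - lam] by [z -> - z], and
    there [sg = 1]. The sign [sg] makes the phase convex on [[0, PI]]. *)
Definition admissible (sg mu : R) : Prop :=
  (sg = 1 /\ -1 < mu < 0) \/ (sg = -1 /\ 0 < mu < 1).

(* |1 - mu exp (r + i s)|^2 *)
Definition Qf (mu r s : R) : R := 1 + (mu * exp r) ^ 2 - 2 * (mu * exp r) * cos s.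
Definition lnmod (mu r s : R) : R := ln (Qf mu r s) / 2.
Definition argm (mu r s : R) : R :=
  atan (mu * exp r * sin s / (1 - mu * exp r * cos s)).

(** For [z = exp (i (s + i r))], [b_mu z = z (1 - mu / z) / (1 - mu z)] gives
    [log (z^(-a) b_mu z) = sg (uf + i vf)]: [argm] is a global branch of the argument of
    [1 / (1 - mu z)], because [1 - mu z] stays in the right half plane. *)
Definition uf (sg mu a r s : R) : R :=
  sg * (- ((1 - a) * r) + (lnmod mu r s - lnmod mu (- r) s)).
Definition vf (sg mu a r s : R) : R :=
  sg * ((1 - a) * s + (argm mu r s + argm mu (- r) s)).
Definition us (mu r s : R) : R :=
  - (Rabs mu * (1 - mu ^ 2) * (exp r - exp (- r)) * sin s / (Qf mu r s * Qf mu (- r) s)).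
Definition vs (sg mu a r s : R) : R :=
  sg * (- a + ((1 - (mu * exp r) ^ 2) / Qf mu r s
               + (1 - (mu * exp (- r)) ^ 2) / Qf mu (- r) s) / 2).

Lemma admissible_sg (sg mu : R) : admissible sg mu -> sg * mu = - Rabs mu /\ sg * sg = 1.
Proof.
  intros [[-> H]|[-> H]].
  - rewrite Rabs_left by lra. split; ring.
  - rewrite Rabs_pos_eq by lra. split; ring.
Qed.

Lemma admissible_sg_abs (sg mu : R) : admissible sg mu -> Rabs sg = 1.
Proof. intros [[-> _]|[-> _]]; [apply Rabs_R1|rewrite Rabs_left; lra]. Qed.

Lemma admissible_abs (sg mu : R) : admissible sg mu -> 0 < Rabs mu < 1.
Proof.
  intros [[-> H]|[-> H]].
  - rewrite Rabs_left; lra.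
  - rewrite Rabs_pos_eq; lra.
Qed.

Lemma Rabs_mult_cos (q s : R) : - Rabs q <= q * cos s <= Rabs q.
Proof.
  apply Rabs_le_between. rewrite Rabs_mult. pose proof (Rabs_pos q).
  assert (Rabs (cos s) <= 1) by (apply Rabs_le, COS_bound). nra.
Qed.

Lemma one_minus_qcos_pos (q s : R) : Rabs q < 1 -> 0 < 1 - q * cos s.
Proof. intros Hq. pose proof (Rabs_mult_cos q s). lra. Qed.

Lemma modulus_bounds (q s : R) :
  Rabs q < 1 -> (1 - Rabs q) ^ 2 <= 1 + q ^ 2 - 2 * q * cos s <= 4.
Proof.
  intros Hq. pose proof (Rabs_mult_cos q s). pose proof (Rabs_pos q).
  rewrite <- (pow2_abs q). split; nra.
Qed.

Lemma modulus_split (q s : R) :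
  1 + q ^ 2 - 2 * q * cos s = (1 - q * cos s) ^ 2 + (q * sin s) ^ 2.
Proof.
  pose proof (sin2_cos2 s) as Hs. unfold Rsqr in Hs.
  transitivity (1 + q ^ 2 * (sin s * sin s + cos s * cos s) - 2 * q * cos s); [|ring].
  rewrite Hs. ring.
Qed.

Lemma derive_atan_div (y x : R -> R) (t y' x' : R) :
  0 < x t -> is_derive y t y' -> is_derive x t x' ->
  is_derive (fun t => atan (y t / x t)) t ((y' * x t - y t * x') / (x t ^ 2 + y t ^ 2)).
Proof.
  intros Hx Hy Hx'. pose proof (pow2_ge_0 (y t)).
  replace ((y' * x t - y t * x') / (x t ^ 2 + y t ^ 2))
    with (/ (1 + (y t / x t)²) * ((y' * x t - y t * x') / x t ^ 2)).
  - apply (derive_comp atan (fun t => y t / x t)); [apply is_derive_atan|].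
    apply (is_derive_div y x); auto. lra.
  - unfold Rsqr. field. nra.
Qed.

Lemma Qf_pos (mu r s : R) : Rabs (mu * exp r) < 1 -> 0 < Qf mu r s.
Proof.
  intros H. pose proof (modulus_bounds _ s H) as Hb. unfold Qf.
  assert (0 < (1 - Rabs (mu * exp r)) ^ 2) by pos. lra.
Qed.

Lemma derive_lnmod_r (mu r s : R) : Rabs (mu * exp r) < 1 ->
  is_derive (fun r => lnmod mu r s) r
    (((mu * exp r) ^ 2 - mu * exp r * cos s) / Qf mu r s).
Proof.
  intros H. pose proof (Qf_pos mu r s H) as HQ. unfold lnmod, Qf in *.
  auto_derive; [simpl in HQ; lra|]. field. simpl in HQ. simpl. lra.
Qed.

Lemma derive_lnmod_s (mu r s : R) : Rabs (mu * exp r) < 1 ->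
  is_derive (fun s => lnmod mu r s) s (mu * exp r * sin s / Qf mu r s).
Proof.
  intros H. pose proof (Qf_pos mu r s H) as HQ. unfold lnmod, Qf in *.
  auto_derive; [simpl in HQ; lra|]. field. simpl in HQ. simpl. lra.
Qed.

Lemma derive_argm_r (mu r s : R) : Rabs (mu * exp r) < 1 ->
  is_derive (fun r => argm mu r s) r (mu * exp r * sin s / Qf mu r s).
Proof.
  intros H. pose proof (Qf_pos mu r s H) as HQ. unfold Qf in *. rewrite modulus_split in *.
  replace (mu * exp r * sin s / ((1 - mu * exp r * cos s) ^ 2 + (mu * exp r * sin s) ^ 2))
    with ((mu * exp r * sin s * (1 - mu * exp r * cos s)
           - mu * exp r * sin s * - (mu * exp r * cos s))
          / ((1 - mu * exp r * cos s) ^ 2 + (mu * exp r * sin s) ^ 2)) by (field; lra).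
  apply (derive_atan_div (fun r => mu * exp r * sin s) (fun r => 1 - mu * exp r * cos s)).
  - now apply one_minus_qcos_pos.
  - derivative.
  - derivative.
Qed.

Lemma derive_argm_s (mu r s : R) : Rabs (mu * exp r) < 1 ->
  is_derive (fun s => argm mu r s) s
    ((mu * exp r * cos s - (mu * exp r) ^ 2) / Qf mu r s).
Proof.
  intros H. pose proof (Qf_pos mu r s H) as HQ. unfold Qf in *. rewrite modulus_split in *.
  pose proof (one_minus_qcos_pos _ s H) as H1. unfold argm.
  set (q := mu * exp r) in *.
  replace ((q * cos s - q ^ 2) / ((1 - q * cos s) ^ 2 + (q * sin s) ^ 2))
    with ((q * cos s * (1 - q * cos s) - q * sin s * (q * sin s))
          / ((1 - q * cos s) ^ 2 + (q * sin s) ^ 2)).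
  - apply (derive_atan_div (fun s => q * sin s) (fun s => 1 - q * cos s)); auto; derivative.
  - f_equal. pose proof (sin2_cos2 s) as Hs. unfold Rsqr in Hs.
    replace (q ^ 2) with (q ^ 2 * (sin s * sin s + cos s * cos s)) by (rewrite Hs; ring). ring.
Qed.

(** Half the width, on the logarithmic scale, of the annulus [|mu| < |z| < 1 / |mu|] in which
    [b_mu] has neither zeros nor poles. *)
Definition rmax (mu : R) : R := - ln (Rabs mu).

Lemma rmax_spec (mu r : R) :
  0 < Rabs mu -> r < rmax mu -> Rabs (mu * exp r) < 1.
Proof.
  intros Hm Hr. rewrite Rabs_mult, (Rabs_pos_eq (exp r)) by (left; apply exp_pos).
  rewrite <- (exp_ln (Rabs mu)) at 1 by auto. rewrite <- exp_plus, <- exp_0.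
  apply exp_increasing. unfold rmax in Hr. lra.
Qed.

Lemma rmax_pos (mu : R) : 0 < Rabs mu < 1 -> 0 < rmax mu.
Proof.
  intros H. unfold rmax. pose proof (ln_increasing (Rabs mu) 1 ltac:(lra) ltac:(lra)) as Hl. rewrite ln_1 in Hl. lra.
Qed.

Lemma us_eq (sg mu r s : R) :
  admissible sg mu -> 0 < Qf mu r s -> 0 < Qf mu (- r) s ->
  us mu r s = sg * (mu * exp r * sin s / Qf mu r s - mu * exp (- r) * sin s / Qf mu (- r) s).
Proof.
  intros Ha H1 H2. destruct (admissible_sg _ _ Ha) as [E _].
  unfold us. replace (Rabs mu) with (- (sg * mu)) by lra.
  pose proof (exp_mul_opp r) as Hee.
  assert (E3 : exp r * Qf mu (- r) s - exp (- r) * Qf mu r s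
               = (1 - mu ^ 2) * (exp r - exp (- r))).
  { unfold Qf. transitivity (exp r - exp (- r) + mu ^ 2 * (exp r * exp (- r)) * (exp (- r) - exp r)); [ring|].
    rewrite Hee. ring. }
  apply Rmult_eq_reg_r with (Qf mu r s * Qf mu (- r) s); [|apply Rgt_not_eq; nra].
  transitivity (sg * mu * sin s * ((1 - mu ^ 2) * (exp r - exp (- r)))); [field; lra|].
  rewrite <- E3. field. lra.
Qed.

Lemma vs_eq (sg mu a r s : R) :
  0 < Qf mu r s -> 0 < Qf mu (- r) s ->
  vs sg mu a r s = sg * ((1 - a) + ((mu * exp r * cos s - (mu * exp r) ^ 2) / Qf mu r s
     + (mu * exp (- r) * cos s - (mu * exp (- r)) ^ 2) / Qf mu (- r) s)).
Proof.
  intros H1 H2. unfold vs. f_equal.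
  assert (E : forall x, 0 < Qf mu x s ->
    (1 - (mu * exp x) ^ 2) / Qf mu x s
      = 1 + 2 * ((mu * exp x * cos s - (mu * exp x) ^ 2) / Qf mu x s)).
  { intros x Hx. apply Rmult_eq_reg_r with (Qf mu x s); [|lra].
    transitivity (1 - (mu * exp x) ^ 2); [field; lra|].
    transitivity (Qf mu x s + 2 * (mu * exp x * cos s - (mu * exp x) ^ 2)); [unfold Qf; ring|].
    field; lra. }
  rewrite !E by auto. field. lra.
Qed.

Lemma derive_neg (f : R -> R) (x l : R) :
  is_derive f (- x) l -> is_derive (fun y => f (- y)) x (- l).
Proof.
  intros H. replace (- l) with (l * -1) by ring.
  apply (derive_comp f (fun y => - y)); auto. derivative.
Qed.

(** The Cauchy-Riemann equations for [log (z^(-a) b_mu z)]. *)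
Lemma phase_derivatives (sg mu a r s : R) :
  admissible sg mu -> - rmax mu < r < rmax mu ->
  is_derive (fun r => uf sg mu a r s) r (- vs sg mu a r s) /\
  is_derive (fun r => vf sg mu a r s) r (us mu r s) /\
  is_derive (uf sg mu a r) s (us mu r s) /\
  is_derive (vf sg mu a r) s (vs sg mu a r s).
Proof.
  intros Ha Hr. pose proof (admissible_abs _ _ Ha) as Hm.
  assert (H1 : Rabs (mu * exp r) < 1) by (apply rmax_spec; lra).
  assert (H2 : Rabs (mu * exp (- r)) < 1) by (apply rmax_spec; lra).
  pose proof (Qf_pos mu r s H1) as Q1. pose proof (Qf_pos mu (- r) s H2) as Q2.
  rewrite (vs_eq sg mu a r s), (us_eq sg) by auto. unfold uf, vf.
  assert (Hlin : forall c x, is_derive (fun y => c * y) x c).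
  { intros c x. derivative. }
  split; [|split; [|split]].
  - match goal with |- is_derive _ _ (- (sg * (_ + (?A + ?B)))) =>
      replace (- (sg * ((1 - a) + (A + B)))) with (sg * (- (1 - a) + (- A - - - B))) by ring end.
    apply derive_scal, derive_plus; [apply derive_opp, Hlin|].
    apply derive_minus.
    + match goal with |- is_derive _ _ ?l => replace l with
        (((mu * exp r) ^ 2 - mu * exp r * cos s) / Qf mu r s) by (field; lra) end.
      now apply derive_lnmod_r.
    + apply (derive_neg (fun r => lnmod mu r s)).
      match goal with |- is_derive _ _ ?l => replace l with
        (((mu * exp (- r)) ^ 2 - mu * exp (- r) * cos s) / Qf mu (- r) s) by (field; lra) end.
      now apply derive_lnmod_r.
  - match goal with |- is_derive _ _ (sg * (?A - ?B)) =>
      replace (sg * (A - B)) with (sg * (0 + (A + - B))) by ring end.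
    apply derive_scal, derive_plus; [apply derive_const|].
    apply derive_plus; [now apply derive_argm_r|].
    apply (derive_neg (fun r => argm mu r s)). now apply derive_argm_r.
  - match goal with |- is_derive _ _ (sg * (?A - ?B)) =>
      replace (sg * (A - B)) with (sg * (0 + (A - B))) by ring end.
    apply derive_scal, derive_plus; [apply derive_const|].
    apply derive_minus; now apply derive_lnmod_s.
  - apply derive_scal, derive_plus; [apply Hlin|].
    apply derive_plus; now apply derive_argm_s.
Qed.

Lemma phase_conjugate (sg mu a n : R) :
  admissible sg mu ->
  conjugate_on (- rmax mu) (rmax mu)
    (fun r s => n * uf sg mu a r s) (fun r s => n * vf sg mu a r s)
    (fun r s => n * us mu r s) (fun r s => n * vs sg mu a r s).
Proof.
  intros Ha. pose proof (admissible_abs _ _ Ha) as Hm.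
  assert (B : forall r, - rmax mu < r < rmax mu ->
            Rabs (mu * exp r) < 1 /\ Rabs (mu * exp (- r)) < 1).
  { intros r Hr. split; apply rmax_spec; lra. }
  split; intros r s Hr; destruct (B r Hr) as [B1 B2];
    destruct (phase_derivatives sg mu a r s Ha Hr) as (D1 & D2 & D3 & D4);
    pose proof (Qf_pos mu r s B1) as Q1; pose proof (Qf_pos mu (- r) s B2) as Q2;
    pose proof (one_minus_qcos_pos _ s B1) as C1; pose proof (one_minus_qcos_pos _ s B2) as C2.
  - replace (- (n * vs sg mu a r s)) with (n * - vs sg mu a r s) by ring. now apply derive_scal.
  - now apply derive_scal.
  - now apply derive_scal.
  - now apply derive_scal.
  - unfold uf, lnmod, Qf in *. prove_cont2; lra.
  - unfold vf, argm in *. prove_cont2; lra.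
  - unfold us, Qf in *. prove_cont2. apply Rgt_not_eq; nra.
  - unfold vs, Qf in *. prove_cont2; lra.
Qed.

Definition phase_integral (sg mu a n : R) : R :=
  RInt (fun s => cos (n * vf sg mu a 0 s)) 0 PI.

Lemma argm_0 (mu r : R) : argm mu r 0 = 0.
Proof. unfold argm. rewrite sin_0. unfold Rdiv. rewrite Rmult_0_r, Rmult_0_l. apply atan_0. Qed.

Lemma argm_PI (mu r : R) : argm mu r PI = 0.
Proof. unfold argm. rewrite sin_PI. unfold Rdiv. rewrite Rmult_0_r, Rmult_0_l. apply atan_0. Qed.

Lemma vf_0 (sg mu a r : R) : vf sg mu a r 0 = 0.
Proof. unfold vf. rewrite !argm_0. ring. Qed.

Lemma uf_0 (sg mu a s : R) : uf sg mu a 0 s = 0.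
Proof. unfold uf. rewrite Ropp_0. ring. Qed.

(** The integral over the circle of radius [exp (- r)] does not depend on [r]. For
    [a = k / n] the condition on the sine says that [z^(-k)] is single valued, which makes the
    contributions of the end [s = PI] vanish. *)
Lemma phase_integral_shift (sg mu a n r : R) :
  admissible sg mu -> - rmax mu < r < rmax mu ->
  sin (n * (sg * ((1 - a) * PI))) = 0 ->
  RInt (fun s => exp (n * uf sg mu a r s) * cos (n * vf sg mu a r s)) 0 PI
    = phase_integral sg mu a n.
Proof.
  intros Ha Hr Hsin. pose proof (admissible_abs _ _ Ha) as Hm.
  pose proof (rmax_pos mu Hm) as HR.
  set (J := fun r => RInt (fun s => exp (n * uf sg mu a r s) * cos (n * vf sg mu a r s)) 0 PI).
  assert (E0 : J 0 = phase_integral sg mu a n).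
  { unfold J, phase_integral. apply RInt_ext. intros s _.
    rewrite uf_0, Rmult_0_r, exp_0. apply Rmult_1_l. }
  rewrite <- E0. change (J r = J 0).
  assert (HJ : forall x, - rmax mu < x < rmax mu -> is_derive J x 0).
  { intros x Hx.
    pose proof (derive_shifted_integral _ _ _ _ _ _ 0 PI x (phase_conjugate sg mu a n Ha) Hx) as H.
    cbv beta in H.
    replace (sin (n * vf sg mu a x PI)) with 0 in H.
    2:{ unfold vf. rewrite !argm_PI. symmetry. etransitivity; [|exact Hsin]. f_equal. ring. }
    rewrite vf_0, (Rmult_0_r n), sin_0 in H.
    rewrite !Rmult_0_r, Rminus_0_r, Ropp_0 in H. exact H. }
  pose proof (lipschitz_on J (fun _ => 0) (Rmin r 0) (Rmax r 0) 0) as HL.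
  assert (Hm2 : - rmax mu < Rmin r 0 /\ Rmax r 0 < rmax mu).
  { unfold Rmin, Rmax. destruct (Rle_dec r 0); lra. }
  assert (H : Rabs (J r - J 0) <= 0 * Rabs (r - 0)).
  { apply HL.
    - intros x Hx. apply HJ. lra.
    - intros. rewrite Rabs_R0. lra.
    - split; [apply Rmin_r|apply Rmax_r].
    - split; [apply Rmin_l|apply Rmax_l]. }
  pose proof (Rabs_pos (J r - J 0)).
  apply Rminus_diag_uniq, Rabs_eq_0_inv. lra.
Qed.

(** * The derivative of the phase *)

(** [slope_max mu] is the derivative at [s = 0] of the argument of [b_mu (exp (i s))], that is
    [alpha0] or [1 / alpha0]; [tau] measures the distance of [a] to coalescence, and [cubic] is
    the coefficient of [s^2] in the derivative of the phase at coalescence. *)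
Definition slope_max (mu : R) : R := (1 + mu) / (1 - mu).
Definition tau (sg mu a : R) : R := sg * (slope_max mu - a).
Definition cubic (mu : R) : R := Rabs mu * (1 + mu) / (1 - mu) ^ 3.
(** The derivative [vs] of the phase is [tau + slope_gap (1 - cos s)] at [exp (i s)] and
    [tau + slope_gap (1 - cosh r)] at [exp (- r)]. *)
Definition slope_gap (mu y : R) : R :=
  2 * Rabs mu * slope_max mu * y / ((1 - mu) ^ 2 + 2 * mu * y).

Lemma admissible_bounds (sg mu : R) :
  admissible sg mu -> -1 < mu < 1 /\ 0 < slope_max mu /\ 0 < cubic mu /\
  0 < (1 - Rabs mu) ^ 2 <= (1 - mu) ^ 2.
Proof.
  intros Ha. pose proof (admissible_abs _ _ Ha) as Hm.
  assert (-1 < mu < 1) by (destruct Ha; lra).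
  assert (0 < slope_max mu) by (unfold slope_max; pos).
  repeat split; try lra.
  - unfold cubic; pos.
  - pos.
  - apply pow_incr. pose proof (Rle_abs mu). lra.
Qed.

Lemma slope_gap_spec (sg mu a y : R) :
  admissible sg mu -> 0 < (1 - mu) ^ 2 + 2 * mu * y ->
  sg * (- a + (1 - mu ^ 2) / ((1 - mu) ^ 2 + 2 * mu * y)) = tau sg mu a + slope_gap mu y.
Proof.
  intros Ha Hy. destruct (admissible_sg _ _ Ha) as [E _].
  destruct (admissible_bounds _ _ Ha) as (H1 & _).
  unfold tau, slope_gap, slope_max. replace (Rabs mu) with (- (sg * mu)) by lra.
  apply Rmult_eq_reg_r with ((1 - mu) ^ 2 + 2 * mu * y); [|lra].
  field. lra.
Qed.

Lemma slope_gap_linear (sg mu y d : R) :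
  admissible sg mu -> 0 < d <= (1 - mu) ^ 2 + 2 * mu * y ->
  Rabs (slope_gap mu y - 2 * cubic mu * y) <= 4 * cubic mu / d * y ^ 2.
Proof.
  intros Ha Hd. destruct (admissible_bounds _ _ Ha) as (H1 & H2 & H3 & H4).
  pose proof (admissible_abs _ _ Ha) as Hm.
  replace (slope_gap mu y - 2 * cubic mu * y)
    with (4 * cubic mu * y ^ 2 * (- mu * / ((1 - mu) ^ 2 + 2 * mu * y))).
  2:{ unfold slope_gap, slope_max, cubic. apply Rmult_eq_reg_r with ((1 - mu) ^ 2 + 2 * mu * y); [|lra].
      field. lra. }
  replace (4 * cubic mu / d * y ^ 2) with (4 * cubic mu * y ^ 2 * / d) by (unfold Rdiv; ring).
  destruct (inv_bounds _ _ Hd) as [P Q].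
  apply Rabs_scal_le; [pos|]. rewrite Rabs_mult, Rabs_Ropp, (Rabs_pos_eq (/ _)) by lra. nra.
Qed.

Lemma vs_critical_line (sg mu a s : R) :
  admissible sg mu -> vs sg mu a 0 s = tau sg mu a + slope_gap mu (1 - cos s).
Proof.
  intros Ha. pose proof (admissible_abs _ _ Ha) as Hm.
  assert (H0 : Rabs (mu * exp 0) < 1) by (rewrite exp_0, Rmult_1_r; lra).
  pose proof (Qf_pos mu 0 s H0) as HQ.
  assert (E : Qf mu 0 s = (1 - mu) ^ 2 + 2 * mu * (1 - cos s)).
  { unfold Qf. rewrite exp_0. ring. }
  rewrite <- (slope_gap_spec sg) by (auto; lra).
  unfold vs. rewrite Ropp_0, E, exp_0, Rmult_1_r. field. lra.
Qed.

Lemma vs_imaginary_axis (sg mu a r : R) :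
  admissible sg mu -> Rabs (mu * exp r) < 1 -> Rabs (mu * exp (- r)) < 1 ->
  0 < (1 - mu) ^ 2 + 2 * mu * (1 - cosh r) /\
  (1 - mu * exp r) * (1 - mu * exp (- r)) = (1 - mu) ^ 2 + 2 * mu * (1 - cosh r) /\
  vs sg mu a r 0 = tau sg mu a + slope_gap mu (1 - cosh r).
Proof.
  intros Ha H1 H2.
  pose proof (exp_mul_opp r) as Hee.
  assert (P1 : 0 < 1 - mu * exp r) by (pose proof (Rle_abs (mu * exp r)); lra).
  assert (P2 : 0 < 1 - mu * exp (- r)) by (pose proof (Rle_abs (mu * exp (- r))); lra).
  assert (E : (1 - mu * exp r) * (1 - mu * exp (- r)) = (1 - mu) ^ 2 + 2 * mu * (1 - cosh r)).
  { unfold cosh. transitivity (1 - mu * (exp r + exp (- r)) + mu ^ 2 * (exp r * exp (- r))); [ring|].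
    rewrite Hee. field. }
  assert (P : 0 < (1 - mu) ^ 2 + 2 * mu * (1 - cosh r)).
  { rewrite <- E. now apply Rmult_lt_0_compat. }
  split; [auto|]. split; auto.
  rewrite <- (slope_gap_spec sg), <- E by auto.
  unfold vs, Qf. rewrite cos_0. f_equal. f_equal.
  set (x := mu * exp r) in *. set (y := mu * exp (- r)) in *.
  replace (mu ^ 2) with (x * y).
  2:{ unfold x, y. transitivity (mu ^ 2 * (exp r * exp (- r))); [ring|]. rewrite Hee. ring. }
  replace (1 + x ^ 2 - 2 * x * 1) with ((1 - x) ^ 2) by ring.
  replace (1 + y ^ 2 - 2 * y * 1) with ((1 - y) ^ 2) by ring.
  field. lra.
Qed.

Lemma slope_gap_circle (sg mu : R) : admissible sg mu ->
  exists C, 0 < C /\ forall s, 0 <= s <= 4 ->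
    Rabs (slope_gap mu (1 - cos s) - cubic mu * s ^ 2) <= C * s ^ 3.
Proof.
  intros Ha. destruct (admissible_bounds _ _ Ha) as (H1 & H2 & H3 & H4).
  set (k := 4 * cubic mu / (1 - Rabs mu) ^ 2). assert (Hk : 0 < k) by (unfold k; pos).
  exists (k + cubic mu). split; [lra|]. intros s Hs.
  pose proof (one_minus_cos_bounds s) as Hc. pose proof (cos_quartic s ltac:(lra)) as Hq.
  pose proof (modulus_bounds mu s (proj2 (admissible_abs _ _ Ha))) as Hb.
  pose proof (slope_gap_linear sg mu (1 - cos s) ((1 - Rabs mu) ^ 2) Ha
    ltac:(lra)) as Hl. fold k in Hl.
  assert (Hs4 : s ^ 4 <= 4 * s ^ 3).
  { replace (s ^ 4) with (s * s ^ 3) by ring. apply Rmult_le_compat_r; pos. }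
  assert (0 <= s ^ 3) by pos.
  assert ((1 - cos s) ^ 2 <= s ^ 3).
  { apply Rle_trans with ((s ^ 2 / 2) ^ 2); [apply pow_incr; lra|].
    replace ((s ^ 2 / 2) ^ 2) with (s ^ 4 / 4) by field. lra. }
  assert (k * (1 - cos s) ^ 2 <= k * s ^ 3) by (apply Rmult_le_compat_l; lra).
  assert (0 <= cubic mu * (s ^ 2 / 2 - (1 - cos s)) <= cubic mu * (s ^ 3 / 6)).
  { split; [pos|apply Rmult_le_compat_l; lra]. }
  apply Rabs_le_between in Hl. apply Rabs_le. split; nra.
Qed.

Lemma slope_gap_hyperbolic (sg mu : R) : admissible sg mu ->
  exists C, 0 < C /\ forall r, 0 <= r <= (1 - Rabs mu) / 2 ->
    Rabs (- slope_gap mu (1 - cosh r) - cubic mu * r ^ 2) <= C * r ^ 3.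
Proof.
  intros Ha. destruct (admissible_bounds _ _ Ha) as (H1 & H2 & H3 & H4).
  pose proof (admissible_abs _ _ Ha) as Hm.
  set (k := 4 * cubic mu / ((1 - Rabs mu) ^ 2 / 2)). assert (Hk : 0 < k) by (unfold k; pos).
  exists (k + cubic mu). split; [lra|]. intros r Hr.
  destruct (cosh_bounds r ltac:(lra)) as [Hc Hq].
  assert (Hr2 : r ^ 2 <= (1 - Rabs mu) ^ 2 / 4).
  { replace ((1 - Rabs mu) ^ 2 / 4) with (((1 - Rabs mu) / 2) ^ 2) by field. apply pow_incr; lra. }
  assert (Hmu : - (cosh r - 1) <= mu * (1 - cosh r)) by nra.
  pose proof (slope_gap_linear sg mu (1 - cosh r) ((1 - Rabs mu) ^ 2 / 2) Ha ltac:(lra)) as Hl.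
  fold k in Hl.
  assert (0 <= r ^ 3) by pos.
  assert (r ^ 4 <= r ^ 3) by (replace (r ^ 4) with (r * r ^ 3) by ring; nra).
  assert ((1 - cosh r) ^ 2 <= r ^ 3).
  { replace ((1 - cosh r) ^ 2) with ((cosh r - 1) ^ 2) by ring.
    apply Rle_trans with ((r ^ 2) ^ 2); [apply pow_incr; lra|].
    replace ((r ^ 2) ^ 2) with (r ^ 4) by ring. auto. }
  assert (k * (1 - cosh r) ^ 2 <= k * r ^ 3) by (apply Rmult_le_compat_l; lra).
  assert (0 <= cubic mu * (cosh r - 1 - r ^ 2 / 2) <= cubic mu * (r ^ 3 / 12)).
  { split; [pos|apply Rmult_le_compat_l; lra]. }
  assert (0 <= cubic mu * r ^ 3) by pos.
  apply Rabs_le_between in Hl. apply Rabs_le. split; nra.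
Qed.

(** * Two stationary points *)

Definition curv (mu s : R) : R :=
  2 * Rabs mu * (1 - mu ^ 2) * sin s / (1 + mu ^ 2 - 2 * mu * cos s) ^ 2.

Lemma admissible_modulus (sg mu s : R) :
  admissible sg mu -> (1 - Rabs mu) ^ 2 <= 1 + mu ^ 2 - 2 * mu * cos s <= 4.
Proof. intros Ha. apply modulus_bounds. apply (admissible_abs sg), Ha. Qed.

Lemma vs_circle (sg mu a s : R) : admissible sg mu ->
  vs sg mu a 0 s = sg * (- a + (1 - mu ^ 2) / (1 + mu ^ 2 - 2 * mu * cos s)).
Proof.
  intros Ha. pose proof (admissible_modulus sg mu s Ha).
  pose proof (admissible_bounds _ _ Ha) as (_ & _ & _ & H4).
  unfold vs, Qf. rewrite Ropp_0, exp_0, !Rmult_1_r. field. lra.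
Qed.

Lemma derive_vs (sg mu a s : R) :
  admissible sg mu -> is_derive (vs sg mu a 0) s (curv mu s).
Proof.
  intros Ha. destruct (admissible_sg _ _ Ha) as [E _].
  pose proof (admissible_bounds _ _ Ha) as (_ & _ & _ & H4).
  pose proof (admissible_modulus sg mu s Ha) as Hb.
  apply (is_derive_ext (fun s => sg * (- a + (1 - mu ^ 2) / (1 + mu ^ 2 - 2 * mu * cos s)))).
  - intros t. symmetry. now apply vs_circle.
  - unfold curv. replace (Rabs mu) with (- (sg * mu)) by lra.
    auto_derive; [simpl in Hb; simpl; lra|]. field. simpl in Hb; simpl; lra.
Qed.

Lemma curv_lipschitz (sg mu : R) : admissible sg mu ->
  exists K, 0 < K /\ forall s t, Rabs (curv mu s - curv mu t) <= K * Rabs (s - t).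
Proof.
  intros Ha. pose proof (admissible_abs _ _ Ha) as Hm.
  pose proof (admissible_bounds _ _ Ha) as (H1 & _ & _ & H4).
  set (d := / (1 - Rabs mu) ^ 2). assert (Hd : 0 < d) by (unfold d; pos).
  assert (Hd2 : 0 < d ^ 2) by pos. assert (Hd3 : 0 < d ^ 3) by pos.
  exists (2 * (d ^ 2 + 4 * d ^ 3)). split; [lra|]. intros s t.
  set (c' := fun s => 2 * Rabs mu * (1 - mu ^ 2) * (cos s * (/ (1 + mu ^ 2 - 2 * mu * cos s)) ^ 2
     - 4 * mu * sin s * sin s * (/ (1 + mu ^ 2 - 2 * mu * cos s)) ^ 3)).
  apply (lipschitz_on (curv mu) c' (Rmin s t) (Rmax s t)).
  - intros x _. pose proof (admissible_modulus sg mu x Ha) as Hb.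
    unfold curv, c'. auto_derive.
    + simpl in *. repeat apply Rmult_integral_contrapositive_currified; lra.
    + field. simpl in *; lra.
  - intros x _. unfold c'. pose proof (admissible_modulus sg mu x Ha) as Hb.
    set (D := / (1 + mu ^ 2 - 2 * mu * cos x)).
    assert (HD : 0 < D <= d) by (apply inv_bounds; lra).
    assert (D ^ 2 <= d ^ 2) by (apply pow_incr; lra).
    assert (D ^ 3 <= d ^ 3) by (apply pow_incr; lra).
    assert (0 < D ^ 2) by pos. assert (0 < D ^ 3) by pos.
    assert (Hc : Rabs (cos x) <= 1) by (apply Rabs_le, COS_bound).
    assert (Hs : Rabs (sin x) <= 1) by (apply Rabs_le, SIN_bound).
    rewrite Rabs_mult. apply Rmult_le_compat; try apply Rabs_pos.
    + rewrite Rabs_pos_eq.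
      * assert (0 <= mu ^ 2 <= 1) by nra. nra.
      * apply Rmult_le_pos; [lra|]. nra.
    + eapply Rle_trans; [apply Rabs_triang|]. rewrite Rabs_Ropp.
      apply Rplus_le_compat.
      * rewrite Rabs_mult, (Rabs_pos_eq (D ^ 2)) by lra. pose proof (Rabs_pos (cos x)). nra.
      * rewrite !Rabs_mult, (Rabs_pos_eq (D ^ 3)), (Rabs_pos_eq 4) by lra.
        pose proof (Rabs_pos (sin x)).
        assert (0 <= Rabs mu * Rabs (sin x) <= 1) by nra.
        assert (0 <= Rabs mu * Rabs (sin x) * Rabs (sin x) <= 1) by nra.
        replace (4 * Rabs mu * Rabs (sin x) * Rabs (sin x) * D ^ 3)
          with (4 * ((Rabs mu * Rabs (sin x) * Rabs (sin x)) * D ^ 3)) by ring.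
        apply Rmult_le_compat_l; [lra|]. nra.
  - split; [apply Rmin_r|apply Rmax_r].
  - split; [apply Rmin_l|apply Rmax_l].
Qed.

Lemma curv_lower (sg mu : R) : admissible sg mu ->
  exists k, 0 < k /\ forall s, 0 <= s <= 1 -> k * s <= curv mu s.
Proof.
  intros Ha. pose proof (admissible_abs _ _ Ha) as Hm.
  pose proof (admissible_bounds _ _ Ha) as (H1 & _ & _ & H4).
  assert (Hp : 0 < Rabs mu * (1 - mu ^ 2)) by (apply Rmult_lt_0_compat; nra).
  exists (Rabs mu * (1 - mu ^ 2) / 16). split; [lra|]. intros s Hs.
  pose proof (admissible_modulus sg mu s Ha) as Hb. pose proof (sin_lower s Hs) as Hl.
  unfold curv. set (D := 1 + mu ^ 2 - 2 * mu * cos s) in *.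
  assert (HD2 : / 16 <= / D ^ 2).
  { apply Rinv_le_contravar; [pos|nra]. }
  unfold Rdiv. replace (2 * Rabs mu * (1 - mu ^ 2) * sin s * / D ^ 2)
    with (Rabs mu * (1 - mu ^ 2) * ((2 * sin s) * / D ^ 2)) by ring.
  rewrite (Rmult_assoc (Rabs mu * (1 - mu ^ 2))). apply Rmult_le_compat_l; [lra|].
  rewrite Rmult_comm. apply Rmult_le_compat; lra.
Qed.

Lemma curv_nonneg (sg mu s : R) : admissible sg mu -> 0 <= s <= PI -> 0 <= curv mu s.
Proof.
  intros Ha Hs. pose proof (admissible_abs _ _ Ha) as Hm.
  pose proof (admissible_bounds _ _ Ha) as (H1 & _ & _ & H4).
  pose proof (admissible_modulus sg mu s Ha) as Hb.
  unfold curv. apply Rdiv_le_0_compat; [|apply pow_lt; lra].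
  apply Rmult_le_pos; [|apply sin_ge_0; lra]. apply Rmult_le_pos; [lra|]. nra.
Qed.

Lemma phase_on_circle (sg mu a s : R) :
  admissible sg mu -> is_derive (vf sg mu a 0) s (vs sg mu a 0 s).
Proof.
  intros Ha. pose proof (rmax_pos mu (admissible_abs _ _ Ha)).
  apply (phase_derivatives sg mu a 0 s Ha). lra.
Qed.

Lemma derive_scaled_phase (sg mu a n s : R) : admissible sg mu ->
  is_derive (fun s => n * vf sg mu a 0 s) s (n * vs sg mu a 0 s) /\
  is_derive (fun s => n * vs sg mu a 0 s) s (n * curv mu s).
Proof.
  intros Ha. split; apply derive_scal; [now apply phase_on_circle|now apply derive_vs].
Qed.

(** [K] does not depend on [a]: the relative Lipschitz constant of the second derivative stays
    bounded as the stationary points coalesce, because [curv] vanishes only linearly. *)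
Lemma oscillatory_regime (sg mu : R) : admissible sg mu ->
  exists K, 0 < K /\ forall a n s0 b W,
    0 < n -> 0 < s0 <= 1 -> vs sg mu a 0 s0 = 0 -> 0 < b -> b ^ 2 = n * curv mu s0 ->
    0 < W -> 2 * W <= b * s0 -> 2 * K * W <= b * s0 ->
    Rabs (phase_integral sg mu a n - / b * fresnel W (n * vf sg mu a 0 s0))
      <= / b * (8 / W + 2 * K * W ^ 4 / (b * s0)).
Proof.
  intros Ha. destruct (curv_lipschitz _ _ Ha) as [K1 [HK1 HL]].
  destruct (curv_lower _ _ Ha) as [k [Hk Hlow]].
  exists (K1 / k). split; [now apply Rdiv_lt_0_compat|].
  intros a n s0 b W Hn Hs0 Hp0 Hb Hbn HW HW1 HW2.
  pose proof PI2_3_2.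
  apply (stationary_phase (fun s => n * vf sg mu a 0 s) (fun s => n * vs sg mu a 0 s)
           (fun s => n * curv mu s)); try lra.
  - left; now apply Rdiv_lt_0_compat.
  - intros; now apply derive_scaled_phase.
  - intros; now apply derive_scaled_phase.
  - intros s Hs. apply Rmult_le_pos; [lra|]. now apply (curv_nonneg sg).
  - rewrite Hp0. ring.
  - intros s _. rewrite Hbn. replace (n * curv mu s - n * curv mu s0)
      with (n * (curv mu s - curv mu s0)) by ring.
    rewrite Rabs_mult, (Rabs_pos_eq n) by lra.
    replace (K1 / k * (n * curv mu s0) * Rabs (s - s0) / s0)
      with (n * (K1 * Rabs (s - s0) * (curv mu s0 / (k * s0)))) by (field; lra).
    apply Rmult_le_compat_l; [lra|]. eapply Rle_trans; [apply HL|].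
    rewrite <- (Rmult_1_r (K1 * Rabs (s - s0))) at 1.
    apply Rmult_le_compat_l; [apply Rmult_le_pos; [lra|apply Rabs_pos]|].
    specialize (Hlow s0 ltac:(lra)).
    apply Rmult_le_reg_r with (k * s0); [nra|].
    unfold Rdiv. rewrite Rmult_assoc, Rinv_l; nra.
Qed.

(** * One saddle point inside the disc *)

(** Minus the second derivative of [uf] in [s] at the saddle point [exp (- r)]. *)
Definition curvh (mu r : R) : R :=
  Rabs mu * (1 - mu ^ 2) * (exp r - exp (- r)) / (Qf mu r 0 * Qf mu (- r) 0).

Lemma annulus_bounds (sg mu r : R) :
  admissible sg mu -> 0 <= r <= (1 - Rabs mu) / 2 ->
  Rabs (mu * exp r) <= (1 + Rabs mu) / 2 /\
  Rabs (mu * exp (- r)) <= (1 + Rabs mu) / 2 /\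
  r < rmax mu /\ 2 * r <= exp r - exp (- r) <= 4 * r.
Proof.
  intros Ha Hr. pose proof (admissible_abs _ _ Ha) as Hm.
  pose proof (exp_pos r). pose proof (exp_pos (- r)).
  pose proof (exp_mul_opp r) as Hee.
  pose proof (exp_ineq1_le r) as H1. pose proof (exp_ineq1_le (- r)) as H2.
  split; [|split; [|split]].
  - rewrite Rabs_mult, (Rabs_pos_eq (exp r)) by lra. nra.
  - rewrite Rabs_mult, (Rabs_pos_eq (exp (- r))) by lra. nra.
  - pose proof (exp_ineq1_le (ln (Rabs mu))) as Hl. rewrite exp_ln in Hl by lra.
    unfold rmax. lra.
  - pose proof (sinh_bounds r ltac:(lra)) as Hs. unfold sinh in Hs. lra.
Qed.

Lemma annulus_modulus (sg mu r s : R) :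
  admissible sg mu -> 0 <= r <= (1 - Rabs mu) / 2 ->
  (1 - Rabs mu) ^ 2 / 4 <= Qf mu r s <= 4 /\ (1 - Rabs mu) ^ 2 / 4 <= Qf mu (- r) s <= 4.
Proof.
  intros Ha Hr. pose proof (admissible_abs _ _ Ha) as Hm.
  destruct (annulus_bounds _ _ _ Ha Hr) as (H1 & H2 & _).
  assert (A : forall x, Rabs x <= (1 + Rabs mu) / 2 ->
     (1 - Rabs mu) ^ 2 / 4 <= 1 + x ^ 2 - 2 * x * cos s <= 4).
  { intros x Hx. destruct (modulus_bounds x s ltac:(lra)) as [L U]. split; [|lra].
    eapply Rle_trans; [|exact L].
    replace ((1 - Rabs mu) ^ 2 / 4) with (((1 - Rabs mu) / 2) ^ 2) by field.
    apply pow_incr. lra. }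
  split; now apply A.
Qed.

Lemma curvh_lower (sg mu : R) : admissible sg mu ->
  exists k, 0 < k /\ forall r, 0 <= r <= (1 - Rabs mu) / 2 -> k * r <= curvh mu r.
Proof.
  intros Ha. pose proof (admissible_abs _ _ Ha) as Hm.
  pose proof (admissible_bounds _ _ Ha) as (H1 & _ & _ & H4).
  assert (Hp : 0 < Rabs mu * (1 - mu ^ 2)) by (apply Rmult_lt_0_compat; nra).
  exists (Rabs mu * (1 - mu ^ 2) / 8). split; [lra|]. intros r Hr.
  destruct (annulus_modulus sg mu r 0 Ha Hr) as [Q1 Q2].
  destruct (annulus_bounds _ _ _ Ha Hr) as (_ & _ & _ & He).
  unfold curvh. set (X := Qf mu r 0 * Qf mu (- r) 0).
  assert (HX : / 16 <= / X).
  { apply Rinv_le_contravar; unfold X; nra. }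
  apply Rle_trans with (Rabs mu * (1 - mu ^ 2) * (2 * r) * / 16).
  - right; field.
  - unfold Rdiv. apply Rmult_le_compat; try lra.
    + apply Rmult_le_pos; lra.
    + apply Rmult_le_compat_l; lra.
Qed.

(** On the circle through the saddle point the modulus is largest there, and Gaussian with
    variance governed by [curvh]. *)
Lemma modulus_decay (sg mu : R) : admissible sg mu ->
  exists k, 0 < k /\ forall a r s, 0 <= r <= (1 - Rabs mu) / 2 -> 0 <= s <= PI ->
    uf sg mu a r s - uf sg mu a r 0 <= - (k * (curvh mu r * s ^ 2)).
Proof.
  intros Ha. pose proof (admissible_abs _ _ Ha) as Hm.
  pose proof (admissible_bounds _ _ Ha) as (H1 & _ & _ & H4).
  set (d := ((1 - Rabs mu) ^ 2 / 4) ^ 2).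
  assert (Hd : 0 < d) by (unfold d; pos).
  exists (d / 16 / 64). split; [lra|]. intros a r s Hr Hs.
  destruct (annulus_bounds _ _ _ Ha Hr) as (B1 & B2 & Hrm & He).
  set (N := Rabs mu * (1 - mu ^ 2) * (exp r - exp (- r))).
  assert (HN : 0 <= N).
  { apply Rmult_le_pos; [|lra]. apply Rmult_le_pos; nra. }
  assert (Hp : 0 <= d * curvh mu r <= N).
  { unfold curvh. fold N. destruct (annulus_modulus sg mu r 0 Ha Hr) as [Q1 Q2].
    set (X := Qf mu r 0 * Qf mu (- r) 0).
    assert (HX : d <= X).
    { unfold d, X. replace (((1 - Rabs mu) ^ 2 / 4) ^ 2)
        with (((1 - Rabs mu) ^ 2 / 4) * ((1 - Rabs mu) ^ 2 / 4)) by ring.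
      apply Rmult_le_compat; lra. }
    split; [pos|].
    apply Rmult_le_reg_r with X; [lra|].
    replace (d * (N / X) * X) with (d * N) by (field; lra). nra. }
  assert (Hu : uf sg mu a r s - uf sg mu a r 0
     <= - (d * curvh mu r / 16 * (1 - cos s)) - - (d * curvh mu r / 16 * (1 - cos 0))).
  { apply (derive_le (uf sg mu a r) (fun s => - (d * curvh mu r / 16 * (1 - cos s)))
      (us mu r) (fun s => - (d * curvh mu r / 16 * sin s))); try lra.
    - intros x _. apply phase_derivatives; auto. lra.
    - intros x _. derivative.
    - intros x Hx. unfold us. fold N. apply Ropp_le_contravar.
      destruct (annulus_modulus sg mu r x Ha Hr) as [Q1 Q2].
      assert (0 <= sin x) by (apply sin_ge_0; lra).
      assert (HX : / 16 <= / (Qf mu r x * Qf mu (- r) x)).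
      { apply Rinv_le_contravar; nra. }
      apply Rle_trans with (N * sin x * / 16).
      + assert (d * curvh mu r * sin x <= N * sin x) by (apply Rmult_le_compat_r; lra). lra.
      + unfold Rdiv. apply Rmult_le_compat_l; auto. now apply Rmult_le_pos. }
  rewrite cos_0 in Hu. pose proof (one_minus_cos_lower s Hs) as Hc.
  assert (d * curvh mu r / 16 * (s ^ 2 / 64) <= d * curvh mu r / 16 * (1 - cos s))
    by (apply Rmult_le_compat_l; lra).
  replace (d / 16 / 64 * (curvh mu r * s ^ 2)) with (d * curvh mu r / 16 * (s ^ 2 / 64)) by field.
  lra.
Qed.

Lemma Qf_difference (mu r s : R) : Qf mu r s = Qf mu r 0 + 2 * (mu * exp r) * (1 - cos s).
Proof. unfold Qf. rewrite cos_0. ring. Qed.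

(** The bounds of [modulus_taylor] and [argument_taylor] are cubic in [s] with constants that do
    not depend on [r], hence negligible at the scale [s ~ (n r)^(-1/2)] when [n r^3] is large. *)
Lemma modulus_taylor (sg mu : R) : admissible sg mu ->
  exists C, 0 < C /\ forall a r s, 0 <= r <= (1 - Rabs mu) / 2 -> 0 <= s <= PI ->
    Rabs (uf sg mu a r s - uf sg mu a r 0 + curvh mu r * s ^ 2 / 2) <= C * s ^ 3.
Proof.
  intros Ha. pose proof (admissible_abs _ _ Ha) as Hm.
  pose proof (admissible_bounds _ _ Ha) as (H1 & _ & _ & H4).
  set (d := (1 - Rabs mu) ^ 2 / 4). assert (Hd : 0 < d) by (unfold d; lra).
  set (e := / d ^ 2). assert (He : 0 < e) by (unfold e; pos).
  set (C := 4 * (e + 12 * e ^ 2)).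
  assert (HC : 0 < C) by (unfold C; nra).
  exists C. split; auto. intros a r s Hr Hs. pose proof PI_4.
  destruct (annulus_bounds _ _ _ Ha Hr) as (B1 & B2 & Hrm & Hexp).
  set (N := Rabs mu * (1 - mu ^ 2) * (exp r - exp (- r))).
  assert (HN : 0 <= N <= 4).
  { assert (0 <= mu ^ 2 <= 1) by nra. unfold N.
    assert (0 <= Rabs mu * (1 - mu ^ 2) <= 1) by nra. nra. }
  assert (Hu : Rabs ((uf sg mu a r s + curvh mu r * s ^ 2 / 2)
                     - (uf sg mu a r 0 + curvh mu r * 0 ^ 2 / 2)) <= C * s ^ 4 / 4 - C * 0 ^ 4 / 4).
  { apply (derive_dominated (fun s => uf sg mu a r s + curvh mu r * s ^ 2 / 2)
      (fun s => C * s ^ 4 / 4) (fun s => us mu r s + curvh mu r * s) (fun s => C * s ^ 3)); try lra.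
    - intros x _. apply derive_plus; [apply phase_derivatives; auto; lra|].
      derivative.
    - intros x _. derivative.
    - intros x Hx. unfold us, curvh. fold N.
      destruct (annulus_modulus sg mu r x Ha Hr) as [Q1 Q2].
      destruct (annulus_modulus sg mu r 0 Ha Hr) as [Q3 Q4]. fold d in Q1, Q2, Q3, Q4.
      set (X := Qf mu r x * Qf mu (- r) x). set (X0 := Qf mu r 0 * Qf mu (- r) 0).
      assert (HX : d ^ 2 <= X) by (unfold X; nra).
      assert (HX0 : d ^ 2 <= X0) by (unfold X0; nra).
      assert (Hd2 : 0 < d ^ 2) by pos.
      assert (HiX : 0 < / X <= e) by (apply inv_bounds; lra).
      assert (HiX0 : 0 < / X0 <= e) by (apply inv_bounds; lra).
      pose proof (one_minus_cos_bounds x) as Hc.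
      assert (Hc2 : 0 <= 1 - cos x <= 2) by (pose proof (COS_bound x); lra).
      assert (HXX : Rabs (X - X0) <= 12 * x ^ 2).
      { unfold X, X0. rewrite (Qf_difference mu r x), (Qf_difference mu (- r) x).
        set (q1 := mu * exp r) in *. set (q2 := mu * exp (- r)) in *. set (y := 1 - cos x) in *.
        assert (Hq1 : Rabs q1 <= 1) by lra. assert (Hq2 : Rabs q2 <= 1) by lra.
        set (A := Qf mu r 0) in *. set (B := Qf mu (- r) 0) in *.
        replace ((A + 2 * q1 * y) * (B + 2 * q2 * y) - A * B)
          with (2 * y * (q1 * B + q2 * A + 2 * (q1 * q2 * y))) by ring.
        assert (Rabs (q1 * B + q2 * A + 2 * (q1 * q2 * y)) <= 12).
        { apply Rabs_le_between in Hq1. apply Rabs_le_between in Hq2.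
          assert (-4 <= q1 * B <= 4) by nra. assert (-4 <= q2 * A <= 4) by nra.
          assert (-1 <= q1 * q2 <= 1) by nra. assert (-2 <= q1 * q2 * y <= 2) by nra.
          apply Rabs_le; lra. }
        rewrite Rabs_mult, (Rabs_pos_eq (2 * y)) by lra. nra. }
      replace (- (N * sin x / X) + N / X0 * x)
        with (N * ((x - sin x) * / X + x * ((X - X0) * (/ X * / X0)))).
      2:{ field. split; lra. }
      pose proof (sin_cubic x ltac:(lra)) as Hsx.
      assert (Hx3 : 0 <= x ^ 3) by pos.
      assert (T1 : 0 <= (x - sin x) * / X <= x ^ 3 * e).
      { split; [pos|]. apply Rmult_le_compat; lra. }
      assert (T2 : Rabs (x * ((X - X0) * (/ X * / X0))) <= 12 * x ^ 3 * e ^ 2).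
      { assert (He2 : 0 < / X * / X0 <= e ^ 2).
        { split; [pos|]. simpl. rewrite Rmult_1_r. apply Rmult_le_compat; lra. }
        rewrite !Rabs_mult, (Rabs_pos_eq x) by lra. rewrite <- Rabs_mult, (Rabs_pos_eq (/ X * / X0)) by lra.
        replace (12 * x ^ 3 * e ^ 2) with (x * (12 * x ^ 2 * e ^ 2)) by ring.
        apply Rmult_le_compat_l; [lra|].
        apply Rmult_le_compat; try lra. apply Rabs_pos. }
      rewrite Rabs_mult, (Rabs_pos_eq N) by lra.
      unfold C. replace (4 * (e + 12 * e ^ 2) * x ^ 3) with (4 * (x ^ 3 * e + 12 * x ^ 3 * e ^ 2)) by ring.
      apply Rmult_le_compat; try lra; [apply Rabs_pos|].
      eapply Rle_trans; [apply Rabs_triang|]. rewrite (Rabs_pos_eq ((x - sin x) * / X)) by lra. lra. }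
  replace (uf sg mu a r s - uf sg mu a r 0 + curvh mu r * s ^ 2 / 2)
    with ((uf sg mu a r s + curvh mu r * s ^ 2 / 2) - (uf sg mu a r 0 + curvh mu r * 0 ^ 2 / 2)) by field.
  eapply Rle_trans; [exact Hu|].
  replace (C * s ^ 4 / 4 - C * 0 ^ 4 / 4) with (C * s ^ 3 * (s / 4)) by field.
  rewrite <- (Rmult_1_r (C * s ^ 3)) at 2. apply Rmult_le_compat_l; pos.
Qed.

Lemma argument_taylor (sg mu : R) : admissible sg mu ->
  exists C, 0 < C /\ forall a r s, 0 <= r <= (1 - Rabs mu) / 2 -> 0 <= s ->
    vs sg mu a r 0 = 0 -> Rabs (vf sg mu a r s) <= C * s ^ 3.
Proof.
  intros Ha. pose proof (admissible_abs _ _ Ha) as Hm.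
  pose proof (admissible_bounds _ _ Ha) as (H1 & _ & _ & H4).
  set (d := (1 - Rabs mu) ^ 2 / 4). assert (Hd : 0 < d) by (unfold d; lra).
  set (e := / d). assert (He : 0 < e) by (now apply Rinv_0_lt_compat).
  exists (e ^ 2 / 3). split; [nra|]. intros a r s Hr Hs H0.
  destruct (annulus_bounds _ _ _ Ha Hr) as (B1 & B2 & Hrm & Hexp).
  assert (Hvs : forall x, 0 <= x -> Rabs (vs sg mu a r x) <= e ^ 2 * x ^ 2).
  { intros x Hx. replace (vs sg mu a r x) with (vs sg mu a r x - vs sg mu a r 0) by lra.
    destruct (annulus_modulus sg mu r x Ha Hr) as [Q1 Q2].
    destruct (annulus_modulus sg mu r 0 Ha Hr) as [Q3 Q4]. fold d in Q1, Q2, Q3, Q4.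
    pose proof (one_minus_cos_bounds x) as Hc.
    assert (T : forall q A B, Rabs q <= 1 -> d <= A -> d <= B -> B = A + 2 * q * (1 - cos x) ->
       Rabs ((1 - q ^ 2) / B - (1 - q ^ 2) / A) <= e ^ 2 * x ^ 2).
    { intros q A B Hq HA HB E.
      replace ((1 - q ^ 2) / B - (1 - q ^ 2) / A)
        with ((1 - q ^ 2) * (- (2 * q * (1 - cos x))) * (/ A * / B)).
      2:{ replace (2 * q * (1 - cos x)) with (B - A) by lra. field. lra. }
      assert (HA' : 0 < / A <= e) by (apply inv_bounds; lra).
      assert (HB' : 0 < / B <= e) by (apply inv_bounds; lra).
      assert (HAB : 0 < / A * / B <= e ^ 2).
      { split; [pos|]. simpl. rewrite Rmult_1_r. apply Rmult_le_compat; lra. }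
      rewrite !Rabs_mult, Rabs_Ropp, !Rabs_mult, (Rabs_pos_eq 2), (Rabs_pos_eq (1 - cos x)) by lra.
      rewrite <- Rabs_mult, (Rabs_pos_eq (/ A * / B)) by lra.
      assert (Hq2 : Rabs (1 - q ^ 2) <= 1).
      { apply Rabs_le. apply Rabs_le_between in Hq. split; nra. }
      rewrite (Rmult_comm (e ^ 2)). pose proof (Rabs_pos q).
      pose proof (Rabs_pos (1 - q ^ 2)).
      apply Rmult_le_compat; try lra.
      - pos.
      - replace (x ^ 2) with (1 * (2 * 1 * (x ^ 2 / 2))) by field.
        apply Rmult_le_compat; try lra.
        + pos.
        + apply Rmult_le_compat; lra. }
    pose proof (T (mu * exp r) (Qf mu r 0) (Qf mu r x) ltac:(lra) ltac:(lra) ltac:(lra)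
      (Qf_difference mu r x)) as T1.
    pose proof (T (mu * exp (- r)) (Qf mu (- r) 0) (Qf mu (- r) x) ltac:(lra) ltac:(lra) ltac:(lra)
      (Qf_difference mu (- r) x)) as T2.
    unfold vs.
    assert (Halg : forall P Q P' Q', sg * (- a + (P + Q) / 2) - sg * (- a + (P' + Q') / 2)
       = sg * ((P - P') / 2 + (Q - Q') / 2)) by (intros; field).
    rewrite Halg.
    rewrite Rabs_mult, (admissible_sg_abs _ _ Ha), Rmult_1_l.
    rabs. }
  replace (vf sg mu a r s) with (vf sg mu a r s - vf sg mu a r 0) by (rewrite vf_0; ring).
  replace (e ^ 2 / 3 * s ^ 3) with (e ^ 2 / 3 * s ^ 3 - e ^ 2 / 3 * 0 ^ 3) by ring.
  apply (derive_dominated (vf sg mu a r) (fun s => e ^ 2 / 3 * s ^ 3) (vs sg mu a r)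
    (fun s => e ^ 2 * s ^ 2)); auto.
  - intros x _. apply phase_derivatives; auto. lra.
  - intros x _. derivative.
  - intros x Hx. apply Hvs; lra.
Qed.

(** The factor [exp (- n uf)] normalizes the integrand to be [1] at the saddle point; as in
    [oscillatory_regime] the constants are uniform up to coalescence. *)
Lemma saddle_regime (sg mu : R) : admissible sg mu ->
  exists C k, 0 < C /\ 0 < k /\ forall a n r b W,
    0 < n -> 0 < r <= (1 - Rabs mu) / 2 -> vs sg mu a r 0 = 0 ->
    sin (n * (sg * ((1 - a) * PI))) = 0 -> 0 < b -> b ^ 2 = n * curvh mu r ->
    0 < W <= b * PI ->
    Rabs (exp (- (n * uf sg mu a r 0)) * phase_integral sg mu a n - / b * half_gauss W)
      <= / b * (C * W ^ 3 / (b * r) * W + / (k * W)).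
Proof.
  intros Ha. destruct (modulus_decay _ _ Ha) as [k [Hk Hdec]].
  destruct (modulus_taylor _ _ Ha) as [C1 [HC1 Htay]].
  destruct (argument_taylor _ _ Ha) as [C2 [HC2 Harg]].
  destruct (curvh_lower _ _ Ha) as [kp [Hkp Hlow]].
  exists ((C1 + C2) / kp), k. split; [apply Rdiv_lt_0_compat; lra|]. split; auto.
  intros a n r b W Hn Hr Hvs Hsin Hb Hbn HW.
  destruct (annulus_bounds sg mu r Ha ltac:(lra)) as (B1 & B2 & Hrm & Hexp).
  pose proof (rmax_pos mu (admissible_abs _ _ Ha)).
  rewrite <- (phase_integral_shift sg mu a n r) by (auto; lra).
  set (x := fun s => n * (uf sg mu a r s - uf sg mu a r 0)).
  assert (Hder := fun s => phase_derivatives sg mu a r s Ha ltac:(lra)).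
  assert (Hcx : forall s, continuous x s).
  { intros s. destruct (Hder s) as (_ & _ & D3 & _).
    apply (is_derive_continuous _ _ (n * (us mu r s - 0))), derive_scal, derive_minus; auto.
    apply derive_const. }
  assert (Hcv : forall s, continuous (fun s => n * vf sg mu a r s) s).
  { intros s. destruct (Hder s) as (_ & _ & _ & D4).
    apply (is_derive_continuous _ _ _ (derive_scal _ n _ _ D4)). }
  assert (E : exp (- (n * uf sg mu a r 0))
       * RInt (fun s => exp (n * uf sg mu a r s) * cos (n * vf sg mu a r s)) 0 PI
       = RInt (fun s => exp (x s) * cos (n * vf sg mu a r s)) 0 PI).
  { rewrite <- (RInt_scal (V := R_CompleteNormedModule)
       (fun s => exp (n * uf sg mu a r s) * cos (n * vf sg mu a r s))).
    - apply RInt_ext. intros s _. unfold x, scal; simpl; unfold mult; simpl.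
      rewrite <- (Rmult_assoc (exp (- (n * uf sg mu a r 0)))), <- exp_plus. f_equal. f_equal. ring.
    - apply ex_RInt_cont. intros s. destruct (Hder s) as (_ & _ & D3 & _).
      apply (continuous_mult (fun s => exp (n * uf sg mu a r s)) (fun s => cos (n * vf sg mu a r s))).
      + apply continuous_exp_comp, (is_derive_continuous _ _ _ (derive_scal _ n _ _ D3)).
      + now apply continuous_cos_comp. }
  rewrite E. pose proof (Hlow r ltac:(lra)) as Hl.
  assert (Hkr : 0 < kp * r) by pos.
  apply laplace_window; auto; try lra.
  - intros s Hs. unfold x. rewrite Rpow_mult_distr, Hbn.
    pose proof (Hdec a r s ltac:(lra) ltac:(lra)). nra.
  - intros s Hs HsW. assert (HsP : s <= PI) by nra.
    assert (Hs3 : (b * s) ^ 3 <= W ^ 3) by (apply pow_incr; split; [pos|lra]).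
    apply Rle_trans with (n * (C1 * s ^ 3) + n * (C2 * s ^ 3)).
    + apply Rplus_le_compat; [|apply Rabs_scal_le; [lra|]; apply Harg; auto; lra].
      unfold x. rewrite Rpow_mult_distr, Hbn.
      replace (n * (uf sg mu a r s - uf sg mu a r 0) + n * curvh mu r * s ^ 2 / 2)
        with (n * (uf sg mu a r s - uf sg mu a r 0 + curvh mu r * s ^ 2 / 2)) by field.
      apply Rabs_scal_le; [lra|]. apply Htay; lra.
    + replace (n * (C1 * s ^ 3) + n * (C2 * s ^ 3))
        with ((C1 + C2) * (b * s) ^ 3 * (n / b ^ 2) * / b) by (field; lra).
      replace ((C1 + C2) / kp * W ^ 3 / (b * r)) with ((C1 + C2) * W ^ 3 * / (kp * r) * / b)
        by (field; lra).
      apply Rmult_le_compat_r; [pos|]. apply Rmult_le_compat; try pos.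
      * apply Rmult_le_compat_l; lra.
      * rewrite Hbn. replace (n / (n * curvh mu r)) with (/ curvh mu r) by (field; split; lra).
        apply Rinv_le_contravar; lra.
Qed.

(** * Coalescing critical points *)

Lemma slope_gap_lower (sg mu s : R) : admissible sg mu -> 0 <= s <= PI ->
  Rabs mu * slope_max mu / 128 * s ^ 2 <= slope_gap mu (1 - cos s).
Proof.
  intros Ha Hs. pose proof (admissible_abs _ _ Ha) as Hm.
  destruct (admissible_bounds _ _ Ha) as (H1 & H2 & H3 & H4).
  pose proof (admissible_modulus sg mu s Ha) as Hb.
  pose proof (one_minus_cos_lower s Hs) as Hc.
  unfold slope_gap.
  replace ((1 - mu) ^ 2 + 2 * mu * (1 - cos s)) with (1 + mu ^ 2 - 2 * mu * cos s) by ring.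
  set (D := 1 + mu ^ 2 - 2 * mu * cos s) in *.
  assert (HD : / 4 <= / D) by (apply Rinv_le_contravar; lra).
  assert (Hp : 0 < Rabs mu * slope_max mu) by pos.
  apply Rle_trans with (2 * Rabs mu * slope_max mu * (s ^ 2 / 64) * / 4); [right; field|].
  pose proof (pow2_ge_0 s).
  unfold Rdiv at 2. apply Rmult_le_compat; try lra.
  - pos.
  - apply Rmult_le_compat_l; lra.
Qed.

Lemma cube_le (x y : R) : 0 <= y -> x ^ 3 <= y ^ 3 -> x <= y.
Proof.
  intros Hy H. destruct (Rle_dec x y); auto. exfalso.
  assert (0 < (x - y) * (x ^ 2 + x * y + y ^ 2)) by (apply Rmult_lt_0_compat; nra). lra.
Qed.

Lemma Rpower_third_cube (x : R) : 0 < x -> Rpower x (1 / 3) ^ 3 = x.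
Proof.
  intros Hx. rewrite <- (Rpower_pow 3), Rpower_mult by apply exp_pos.
  replace (1 / 3 * INR 3) with 1 by (simpl; field). now apply Rpower_1.
Qed.

Lemma Rpower_third_sqr (x : R) : Rpower x (2 / 3) = Rpower x (1 / 3) ^ 2.
Proof.
  rewrite <- (Rpower_pow 2), Rpower_mult by apply exp_pos. f_equal. simpl. field.
Qed.

(** Near coalescence, for [n^(2/3) |tau|] bounded, the phase is close to its cubic Taylor
    polynomial in the window [nu * s <= W]; both there and in the Airy integral the rest is a
    tail to which van der Corput's test applies. *)
Lemma transition_regime (sg mu M e : R) : admissible sg mu -> 0 < M -> 0 < e ->
  exists n0, 0 < n0 /\ forall a n nu y, n0 <= n -> 0 < nu -> nu ^ 3 = n * cubic mu ->
    y * nu = n * tau sg mu a -> Rabs y <= M ->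
    Rabs (nu * phase_integral sg mu a n - PI * Airy y) <= e.
Proof.
  intros Ha HM He. pose proof (admissible_abs _ _ Ha) as Hm.
  destruct (admissible_bounds _ _ Ha) as (H1 & H2 & H3 & H4).
  destruct (slope_gap_circle _ _ Ha) as [C [HC Hgap]].
  set (c := cubic mu) in *.
  set (k := Rabs mu * slope_max mu / 128).
  assert (Hk : 0 < k) by (unfold k; pos).
  assert (H8e : 0 < 8 / e) by pos. assert (Hck : 0 < c / k) by pos.
  set (W := 1 + (M + 8 / e) * (1 + c / k)).
  assert (HW0 : 1 + (M + 8 / e) <= W) by (unfold W; nra).
  assert (HW1 : M + 8 / e <= W ^ 2) by nra.
  assert (HW2 : M + 8 / e <= k * W ^ 2 / c).
  { assert (Hw : (M + 8 / e) * (c / k) <= W) by (unfold W; nra).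
    apply Rle_trans with (k * W / c).
    - apply Rle_trans with (k * ((M + 8 / e) * (c / k)) / c); [right; field; lra|].
      unfold Rdiv. apply Rmult_le_compat_r; [pos|]. apply Rmult_le_compat_l; lra.
    - unfold Rdiv. apply Rmult_le_compat_r; [pos|]. apply Rmult_le_compat_l; nra. }
  assert (HW : 0 < W) by lra.
  assert (HCW : 0 < 4 * C * W ^ 5 / (c * e)) by pos.
  set (V := W + 4 * C * W ^ 5 / (c * e)).
  assert (HV : 0 < V) by (unfold V; lra).
  exists (V ^ 3 / c). split; [pos|].
  intros a n nu y Hn Hnu Hnu3 Hy HyM.
  assert (Hn3 : V ^ 3 <= nu ^ 3).
  { rewrite Hnu3. apply Rle_trans with (V ^ 3 / c * c); [right; field; lra|].
    apply Rmult_le_compat_r; lra. }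
  assert (HVnu : V <= nu) by (apply cube_le; lra).
  assert (Hn0 : 0 < n).
  { eapply Rlt_le_trans; [|exact Hn]. pos. }
  set (w := W / nu).
  assert (Hw : 0 < w) by (unfold w; pos).
  assert (Hnw : nu * w = W) by (unfold w; field; lra).
  assert (Hw1 : w <= 1).
  { apply Rmult_le_reg_l with nu; [lra|]. rewrite Hnw. unfold V in HVnu. lra. }
  pose proof PI2_3_2.
  pose proof PI_4.
  apply Rabs_le_between in HyM.
  assert (Hcont : forall s, continuous (fun s => cos (n * vf sg mu a 0 s)) s).
  { intros s. apply continuous_cos_comp.
    apply (is_derive_continuous _ _ _ (proj1 (derive_scaled_phase sg mu a n s Ha))). }
  (* outside the window the phase is steep *)
  assert (Hout : Rabs (RInt (fun s => cos (n * vf sg mu a 0 s)) w PI) <= 2 / (nu * (8 / e))).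
  { apply (van_der_corput (fun s => n * vf sg mu a 0 s) (fun s => n * vs sg mu a 0 s)
           (fun s => n * curv mu s)); try lra.
    - nra.
    - intros; now apply derive_scaled_phase.
    - intros; now apply derive_scaled_phase.
    - intros s Hs. apply Rmult_le_pos; [lra|]. apply (curv_nonneg sg); auto. lra.
    - left. rewrite (vs_critical_line sg) by auto.
      pose proof (slope_gap_lower sg mu w Ha ltac:(lra)) as Hg. fold k in Hg.
      assert (Hkw : n * (k * w ^ 2) = nu * (k * W ^ 2 / c)).
      { rewrite <- Hnw. replace n with (nu ^ 3 / c) by (rewrite Hnu3; field; lra). field. lra. }
      assert (n * (k * w ^ 2) <= n * slope_gap mu (1 - cos w)) by (apply Rmult_le_compat_l; lra).
      assert (nu * (M + 8 / e) <= nu * (k * W ^ 2 / c)) by (apply Rmult_le_compat_l; lra).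
      assert (nu * - M <= nu * y) by (apply Rmult_le_compat_l; lra).
      lra. }
  set (g := fun s => cos ((nu * s + 0) ^ 3 / 3 + y * (nu * s + 0))).
  assert (Hgc : forall s, continuous g s).
  { intros s. apply (continuous_affine (fun t => cos (t ^ 3 / 3 + y * t))).
    apply continuous_airy_integrand. }
  assert (Hairy : RInt g 0 w = / nu * airy_trunc y W).
  { unfold g. rewrite (RInt_affine (fun t => cos (t ^ 3 / 3 + y * t)))
      by (try lra; apply continuous_airy_integrand).
    unfold airy_trunc. f_equal. f_equal; rewrite <- ?Hnw; ring. }
  assert (Hin : Rabs (RInt (fun s => cos (n * vf sg mu a 0 s)) 0 w - RInt g 0 w)
                <= n * C * w ^ 4 * (w - 0)).
  { apply RInt_close; auto; try lra. intros s Hs. unfold g.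
    eapply Rle_trans; [apply cos_lipschitz|].
    assert (Hp : Rabs ((n * vf sg mu a 0 s - ((nu * s + 0) ^ 3 / 3 + y * (nu * s + 0)))
        - (n * vf sg mu a 0 0 - ((nu * 0 + 0) ^ 3 / 3 + y * (nu * 0 + 0))))
        <= n * C * s ^ 4 - n * C * 0 ^ 4).
    { apply (derive_dominated
        (fun s => n * vf sg mu a 0 s - ((nu * s + 0) ^ 3 / 3 + y * (nu * s + 0)))
        (fun s => n * C * s ^ 4)
        (fun s => n * vs sg mu a 0 s - (nu ^ 3 * s ^ 2 + y * nu))
        (fun s => n * C * (4 * s ^ 3))); try lra.
      - intros x _. apply derive_minus; [now apply derive_scaled_phase|].
        derivative.
      - intros x _. derivative.
      - intros x Hx. rewrite Hy, Hnu3, (vs_critical_line sg) by auto. fold c.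
        replace (n * (tau sg mu a + slope_gap mu (1 - cos x)) - (n * c * x ^ 2 + n * tau sg mu a))
          with (n * (slope_gap mu (1 - cos x) - c * x ^ 2)) by ring.
        rewrite (Rmult_assoc n C). apply Rabs_scal_le; [lra|].
        eapply Rle_trans; [apply Hgap; lra|]. apply Rmult_le_compat_l; [lra|].
        assert (0 <= x ^ 3) by pos. lra. }
    rewrite vf_0 in Hp.
    replace (n * vf sg mu a 0 s - ((nu * s + 0) ^ 3 / 3 + y * (nu * s + 0)) -
       (n * 0 - ((nu * 0 + 0) ^ 3 / 3 + y * (nu * 0 + 0))))
      with (n * vf sg mu a 0 s - ((nu * s + 0) ^ 3 / 3 + y * (nu * s + 0))) in Hp by field.
    eapply Rle_trans; [exact Hp|].
    assert (s ^ 4 <= w ^ 4) by (apply pow_incr; lra).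
    assert (0 < n * C) by nra. nra. }
  pose proof (airy_remainder y W (8 / e) ltac:(lra) ltac:(lra)) as Hrem.
  replace (2 / (8 / e)) with (e / 4) in Hrem by (field; lra).
  assert (Hin2 : Rabs (nu * RInt (fun s => cos (n * vf sg mu a 0 s)) 0 w - airy_trunc y W) <= e / 4).
  { rewrite Hairy in Hin.
    replace (nu * RInt (fun s => cos (n * vf sg mu a 0 s)) 0 w - airy_trunc y W)
      with (nu * (RInt (fun s => cos (n * vf sg mu a 0 s)) 0 w - / nu * airy_trunc y W))
      by (field; lra).
    apply Rle_trans with (nu * (n * C * w ^ 4 * (w - 0))); [apply Rabs_scal_le; lra|].
    replace (nu * (n * C * w ^ 4 * (w - 0))) with (C * W ^ 5 / c * / nu).
    2:{ rewrite <- Hnw. replace n with (nu ^ 3 / c) by (rewrite Hnu3; field; lra). field. lra. }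
    apply Rmult_le_reg_r with nu; [lra|]. rewrite Rmult_assoc, Rinv_l, Rmult_1_r by lra.
    apply Rle_trans with (e / 4 * (4 * C * W ^ 5 / (c * e))); [right; field; lra|].
    apply Rmult_le_compat_l; [lra|]. unfold V in HVnu. lra. }
  assert (Hout2 : Rabs (nu * RInt (fun s => cos (n * vf sg mu a 0 s)) w PI) <= e / 4).
  { apply Rle_trans with (nu * (2 / (nu * (8 / e)))); [apply Rabs_scal_le; lra|].
    right. field. lra. }
  unfold phase_integral. rewrite (RInt_split _ 0 w PI) by auto.
  set (I1 := RInt (fun s => cos (n * vf sg mu a 0 s)) 0 w) in *.
  set (I2 := RInt (fun s => cos (n * vf sg mu a 0 s)) w PI) in *.
  apply Rabs_le_between in Hrem. apply Rabs_le_between in Hin2. apply Rabs_le_between in Hout2.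
  apply Rabs_le. rewrite Rmult_plus_distr_l. lra.
Qed.

Lemma Rpower_between (x d : R) : 0 < d < 1 -> Rabs (x - 1) <= d ->
  0 < x /\ Rabs (Rpower x (2 / 3) - 1) <= d.
Proof.
  intros Hd Hx. apply Rabs_le_between in Hx. split; [lra|].
  unfold Rpower. rewrite <- (exp_ln x) in Hx by lra. rewrite <- exp_0 in *.
  set (l := ln x) in *. apply Rabs_le.
  destruct (Rle_dec 0 l).
  - pose proof (exp_le 0 (2 / 3 * l) ltac:(lra)). pose proof (exp_le (2 / 3 * l) l ltac:(lra)). lra.
  - pose proof (exp_le (2 / 3 * l) 0 ltac:(lra)). pose proof (exp_le l (2 / 3 * l) ltac:(lra)). lra.
Qed.

(** If the phase has size [F = 2/3 c s^3] at a critical point at distance [s] and the distance to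
    coalescence is [T = c s^2], to leading order, then [(3/2 F)^(2/3)], which is [|gamma^2|], is
    [T / c^(1/3)] to leading order. *)
Lemma gamma_ratio (c C e : R) : 0 < c -> 0 < C -> 0 < e ->
  exists h, 0 < h /\ forall s F T, 0 < s < h ->
    Rabs (F - 2 / 3 * c * s ^ 3) <= C * s ^ 4 -> Rabs (T - c * s ^ 2) <= C * s ^ 3 ->
    0 < F <= c * s ^ 3 /\ Rabs (Rpower (3 / 2 * F) (2 / 3) / (T / Rpower c (1 / 3)) - 1) <= e.
Proof.
  intros Hc HC He.
  set (d := Rmin (1 / 2) (e / 4)).
  assert (Hd : 0 < d <= 1 / 2) by (unfold d; split; [pos|apply Rmin_l]).
  assert (Hde : d <= e / 4) by apply Rmin_r.
  exists (d * c / (3 / 2 * C)). split; [pos|].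
  intros s F T Hs HF HT.
  assert (Hs1 : 3 / 2 * C * s <= d * c).
  { apply Rle_trans with (3 / 2 * C * (d * c / (3 / 2 * C))).
    - apply Rmult_le_compat_l; lra.
    - right. field. lra. }
  assert (Hcs2 : 0 < c * s ^ 2) by pos. assert (Hcs3 : 0 < c * s ^ 3) by pos.
  set (X := 3 / 2 * F / (c * s ^ 3)). set (Y := T / (c * s ^ 2)).
  assert (HX : Rabs (X - 1) <= d).
  { replace (X - 1) with (/ (c * s ^ 3) * (3 / 2 * (F - 2 / 3 * c * s ^ 3))) by (unfold X; field; lra).
    apply Rle_trans with (/ (c * s ^ 3) * (3 / 2 * (C * s ^ 4))).
    - apply Rabs_scal_le; [pos|]. apply Rabs_scal_le; [lra|auto].
    - replace (/ (c * s ^ 3) * (3 / 2 * (C * s ^ 4))) with (3 / 2 * C * s * / c) by (field; lra).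
      apply Rmult_le_reg_r with c; auto. rewrite Rmult_assoc, Rinv_l; lra. }
  assert (HY : Rabs (Y - 1) <= d).
  { replace (Y - 1) with (/ (c * s ^ 2) * (T - c * s ^ 2)) by (unfold Y; field; lra).
    apply Rle_trans with (/ (c * s ^ 2) * (C * s ^ 3)); [apply Rabs_scal_le; [pos|auto]|].
    replace (/ (c * s ^ 2) * (C * s ^ 3)) with (C * s * / c) by (field; lra).
    apply Rmult_le_reg_r with c; auto. rewrite Rmult_assoc, Rinv_l, Rmult_1_r by lra. nra. }
  assert (HFX : 3 / 2 * F = X * (c * s ^ 3)) by (unfold X; field; lra).
  assert (HTY : T = Y * (c * s ^ 2)) by (unfold Y; field; lra).
  destruct (Rpower_between X d ltac:(lra) HX) as [X0 HXp].
  apply Rabs_le_between in HX. apply Rabs_le_between in HY.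
  split; [nra|].
  rewrite HFX, HTY, <- Rpower_mult_distr by auto.
  assert (E : Rpower (c * s ^ 3) (2 / 3) = Rpower c (2 / 3) * s ^ 2).
  { rewrite <- Rpower_mult_distr by pos. f_equal.
    rewrite <- (Rpower_pow 3 s), Rpower_mult, <- (Rpower_pow 2 s) by lra. f_equal. simpl. field. }
  assert (E2 : c = Rpower c (1 / 3) * Rpower c (2 / 3)).
  { rewrite <- Rpower_plus. replace (1 / 3 + 2 / 3) with 1 by field. now rewrite Rpower_1. }
  assert (Hp1 : 0 < Rpower c (1 / 3)) by pos. assert (Hp2 : 0 < Rpower c (2 / 3)) by pos.
  rewrite E.
  replace (Rpower X (2 / 3) * (Rpower c (2 / 3) * s ^ 2) / (Y * (c * s ^ 2) / Rpower c (1 / 3)))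
    with (Rpower X (2 / 3) / Y).
  2:{ rewrite E2 at 2. field. repeat split; lra. }
  apply Rabs_le_between in HXp.
  set (Z := Rpower X (2 / 3)) in *.
  replace (Z / Y - 1) with ((Z - Y) * / Y) by (field; lra).
  assert (HiY : 0 < / Y <= / (1 / 2)) by (apply inv_bounds; lra).
  rewrite Rabs_mult, (Rabs_pos_eq (/ Y)) by lra.
  assert (Rabs (Z - Y) <= 2 * d) by (apply Rabs_le; lra).
  pose proof (Rabs_pos (Z - Y)). nra.
Qed.

Lemma cubic_expansion (g p : R -> R) (T c C s : R) :
  0 < s -> 0 < C -> g 0 = 0 -> p s = 0 ->
  (forall x, 0 <= x <= s -> is_derive g x (p x)) ->
  (forall x, 0 <= x <= s -> Rabs (p x - (c * x ^ 2 - T)) <= C * x ^ 3) ->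
  Rabs (- g s - 2 / 3 * c * s ^ 3) <= 2 * C * s ^ 4 /\ Rabs (T - c * s ^ 2) <= 2 * C * s ^ 3.
Proof.
  intros Hs HC Hg0 Hps Hg Hp.
  assert (Hs3 : 0 <= s ^ 3) by pos. assert (Hs4 : s ^ 4 = s * s ^ 3) by ring.
  pose proof (Hp s ltac:(lra)) as HT. rewrite Hps in HT.
  assert (H : Rabs ((g s - (c * s ^ 3 / 3 - T * s)) - (g 0 - (c * 0 ^ 3 / 3 - T * 0)))
              <= C * s ^ 4 - C * 0 ^ 4).
  { apply (derive_dominated (fun x => g x - (c * x ^ 3 / 3 - T * x)) (fun x => C * x ^ 4)
      (fun x => p x - (c * x ^ 2 - T)) (fun x => C * (4 * x ^ 3))); try lra.
    - intros x Hx. apply derive_minus; [now apply Hg|]. derivative.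
    - intros x _. derivative.
    - intros x Hx. eapply Rle_trans; [now apply Hp|].
      apply Rmult_le_compat_l; [lra|]. assert (0 <= x ^ 3) by pos. lra. }
  rewrite Hg0 in H. apply Rabs_le_between in H. apply Rabs_le_between in HT.
  assert (s * (- (C * s ^ 3)) <= s * (T - c * s ^ 2) <= s * (C * s ^ 3)).
  { split; apply Rmult_le_compat_l; lra. }
  assert (0 <= C * s ^ 3) by pos.
  split; apply Rabs_le; nra.
Qed.

Lemma stationary_expansion (sg mu : R) : admissible sg mu ->
  exists C, 0 < C /\ forall a s0, 0 < s0 <= 1 -> vs sg mu a 0 s0 = 0 ->
    Rabs (- vf sg mu a 0 s0 - 2 / 3 * cubic mu * s0 ^ 3) <= C * s0 ^ 4 /\
    Rabs (- tau sg mu a - cubic mu * s0 ^ 2) <= C * s0 ^ 3.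
Proof.
  intros Ha. destruct (slope_gap_circle _ _ Ha) as [C [HC Hgap]].
  exists (2 * C). split; [lra|]. intros a s0 Hs0 Hv.
  apply (cubic_expansion (vf sg mu a 0) (vs sg mu a 0)); auto using vf_0; try lra.
  - intros x _. now apply phase_on_circle.
  - intros x Hx. rewrite (vs_critical_line sg) by auto.
    replace (tau sg mu a + slope_gap mu (1 - cos x) - (cubic mu * x ^ 2 - - tau sg mu a))
      with (slope_gap mu (1 - cos x) - cubic mu * x ^ 2) by ring. apply Hgap; lra.
Qed.

Lemma saddle_expansion (sg mu : R) : admissible sg mu ->
  exists C, 0 < C /\ forall a r, 0 < r <= (1 - Rabs mu) / 2 -> vs sg mu a r 0 = 0 ->
    Rabs (- uf sg mu a r 0 - 2 / 3 * cubic mu * r ^ 3) <= C * r ^ 4 /\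
    Rabs (tau sg mu a - cubic mu * r ^ 2) <= C * r ^ 3.
Proof.
  intros Ha. destruct (slope_gap_hyperbolic _ _ Ha) as [C [HC Hgap]].
  pose proof (rmax_pos mu (admissible_abs _ _ Ha)).
  exists (2 * C). split; [lra|]. intros a r Hr Hv.
  apply (cubic_expansion (fun x => uf sg mu a x 0) (fun x => - vs sg mu a x 0));
    auto using uf_0; try lra.
  - intros x Hx. destruct (annulus_bounds sg mu x Ha ltac:(lra)) as (_ & _ & B & _).
    apply phase_derivatives; auto. lra.
  - intros x Hx. destruct (annulus_bounds sg mu x Ha ltac:(lra)) as (B1 & B2 & _).
    destruct (vs_imaginary_axis sg mu a x Ha ltac:(lra) ltac:(lra)) as (_ & _ & ->).
    replace (- (tau sg mu a + slope_gap mu (1 - cosh x)) - (cubic mu * x ^ 2 - tau sg mu a))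
      with (- slope_gap mu (1 - cosh x) - cubic mu * x ^ 2) by ring. apply Hgap; lra.
Qed.

Lemma exists_stationary (sg mu h : R) : admissible sg mu -> 0 < h <= 1 ->
  exists t, 0 < t /\ forall a, - t < tau sg mu a < 0 ->
    exists s0, 0 < s0 < h /\ vs sg mu a 0 s0 = 0.
Proof.
  intros Ha Hh. pose proof PI2_3_2.
  exists (slope_gap mu (1 - cos h)). split.
  - eapply Rlt_le_trans; [|apply (slope_gap_lower sg); auto; lra].
    destruct (admissible_bounds _ _ Ha) as (_ & H2 & _).
    pose proof (admissible_abs _ _ Ha).
    pos.
  - intros a Hta.
    assert (V0 : vs sg mu a 0 0 = tau sg mu a).
    { rewrite vs_critical_line, cos_0 by auto. unfold slope_gap, Rdiv. ring. }
    assert (Vh : 0 < vs sg mu a 0 h) by (rewrite vs_critical_line by auto; lra).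
    destruct (IVT_gen (vs sg mu a 0) 0 h 0) as [s0 [Hs0 Hv]].
    + intros x. apply continuity_pt_filterlim.
      apply (is_derive_continuous _ _ _ (derive_vs sg mu a x Ha)).
    + rewrite Rmin_left, Rmax_right by lra. lra.
    + rewrite Rmin_left, Rmax_right in Hs0 by lra. exists s0. split; auto.
      assert (s0 <> 0) by (intros ->; lra). assert (s0 <> h) by (intros ->; lra). lra.
Qed.

Lemma exists_saddle (sg mu h : R) : admissible sg mu -> 0 < h <= (1 - Rabs mu) / 2 ->
  exists t, 0 < t /\ forall a, 0 < tau sg mu a < t ->
    exists r, 0 < r < h /\ vs sg mu a r 0 = 0.
Proof.
  intros Ha Hh. pose proof (admissible_abs _ _ Ha) as Hm.
  destruct (admissible_bounds _ _ Ha) as (_ & H2 & _).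
  destruct (annulus_bounds sg mu h Ha ltac:(lra)) as (B1 & B2 & _).
  destruct (vs_imaginary_axis sg mu 0 h Ha ltac:(lra) ltac:(lra)) as (HD & _ & _).
  destruct (cosh_bounds h ltac:(lra)) as [[Hc _] _].
  exists (- slope_gap mu (1 - cosh h)). split.
  - unfold slope_gap.
    assert (0 < cosh h - 1) by nra.
    assert (0 < 2 * Rabs mu * slope_max mu * (cosh h - 1) / ((1 - mu) ^ 2 + 2 * mu * (1 - cosh h)))
      by pos.
    unfold Rdiv in *. lra.
  - intros a Hta.
    (* [vs] times its denominator, which is continuous for all [r] *)
    set (g := fun r => tau sg mu a * ((1 - mu) ^ 2 + 2 * mu * (1 - cosh r))
                       + 2 * Rabs mu * slope_max mu * (1 - cosh r)).
    assert (Hg : forall r, 0 < (1 - mu) ^ 2 + 2 * mu * (1 - cosh r) ->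
       g r = (tau sg mu a + slope_gap mu (1 - cosh r)) * ((1 - mu) ^ 2 + 2 * mu * (1 - cosh r))).
    { intros r Hr. unfold g, slope_gap. field. lra. }
    destruct (IVT_gen g 0 h 0) as [r [Hr Hv]].
    + intros x. apply continuity_pt_filterlim.
      apply (is_derive_continuous _ _ (tau sg mu a * (2 * mu * - sinh x)
         + 2 * Rabs mu * slope_max mu * - sinh x)).
      assert (D : is_derive (fun r => 1 - cosh r) x (- sinh x)).
      { replace (- sinh x) with (0 - sinh x) by ring. apply derive_minus; [apply derive_const|].
        apply is_derive_Reals, derivable_pt_lim_cosh. }
      apply derive_plus.
      * apply derive_scal. replace (2 * mu * - sinh x) with (0 + 2 * mu * - sinh x) by ring.
        apply derive_plus; [apply derive_const|]. now apply derive_scal.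
      * now apply derive_scal.
    + assert (g 0 > 0).
      { unfold g. replace (cosh 0) with 1 by (unfold cosh; rewrite Ropp_0, exp_0; lra).
        replace (1 - 1) with 0 by ring. rewrite !Rmult_0_r, !Rplus_0_r.
        apply Rmult_lt_0_compat; [lra|]. apply pow_lt. destruct Ha; lra. }
      assert (g h < 0).
      { rewrite Hg by auto. nra. }
      rewrite Rmin_right, Rmax_left by lra. lra.
    + rewrite Rmin_left, Rmax_right in Hr by lra.
      destruct (annulus_bounds sg mu r Ha ltac:(lra)) as (A1 & A2 & _).
      destruct (vs_imaginary_axis sg mu a r Ha ltac:(lra) ltac:(lra)) as (HDr & _ & Hvs).
      rewrite Hg in Hv by auto. apply Rmult_integral in Hv. 
      assert (Hv' : tau sg mu a + slope_gap mu (1 - cosh r) = 0) by (destruct Hv; lra).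
      exists r. split; [|lra].
      assert (r <> 0).
      { intros ->. replace (cosh 0) with 1 in Hv' by (unfold cosh; rewrite Ropp_0, exp_0; lra).
        unfold slope_gap, Rdiv in Hv'. replace (1 - 1) with 0 in Hv' by ring. lra. }
      assert (r <> h) by (intros ->; lra). lra.
Qed.

(** * Unimodular numbers *)

Lemma cis_plus (s t : R) : cis (s + t) = (cis s * cis t)%C.
Proof.
  unfold cis, Cmult; simpl. rewrite cos_plus, sin_plus. f_equal; ring.
Qed.

Lemma cis_0 : cis 0 = 1.
Proof. unfold cis. rewrite cos_0, sin_0. reflexivity. Qed.

Lemma cis_opp_r (t : R) : (cis t * cis (- t))%C = 1.
Proof. rewrite <- cis_plus, Rplus_opp_r. apply cis_0. Qed.

Lemma cis_neq_0 (t : R) : cis t <> 0.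
Proof.
  intros E. pose proof (cis_opp_r t) as H. rewrite E, Cmult_0_l in H.
  apply (f_equal fst) in H. simpl in H. lra.
Qed.

Lemma cis_inv (t : R) : (/ cis t)%C = cis (- t).
Proof.
  rewrite <- (Cmult_1_l (/ cis t)), <- (cis_opp_r t).
  rewrite (Cmult_comm (cis t)), <- Cmult_assoc, Cinv_r, Cmult_1_r; auto. apply cis_neq_0.
Qed.

Lemma cis_pow (n : nat) (t : R) : (cis t ^ n)%C = cis (INR n * t).
Proof.
  induction n.
  - simpl. rewrite Rmult_0_l. now rewrite cis_0.
  - rewrite Cpow_S, IHn, <- cis_plus, S_INR. f_equal. ring.
Qed.

(** A continuous argument of [b_mu] on the circle; see [blaschke_circle]. *)
Definition theta (mu s : R) : R := s + 2 * argm mu 0 s.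

Lemma vf_theta (sg mu a s : R) : vf sg mu a 0 s = sg * (theta mu s - a * s).
Proof. unfold vf, theta. rewrite Ropp_0. ring. Qed.

(** [b_mu z = z conj(w) / w] with [w = 1 - mu z], and [argm] is minus the argument of [w]. *)
Lemma blaschke_circle (mu t : R) : Rabs mu < 1 -> blaschke mu (cis t) = cis (theta mu t).
Proof.
  intros Hmu. unfold blaschke, theta, argm. rewrite exp_0, Rmult_1_r.
  pose proof (one_minus_qcos_pos mu t Hmu) as Hx.
  set (x := 1 - mu * cos t) in *. set (y := mu * sin t).
  assert (Hr : 0 < x ^ 2 + y ^ 2) by (pose proof (pow2_ge_0 y); nra).
  assert (E1 : (1 - mu * cis t)%C = (x, - y)).
  { unfold cis, x, y, Cminus, Cplus, Copp, Cmult, RtoC; simpl. f_equal; ring. }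
  assert (E2 : (cis t - mu)%C = (cis t * (x, y))%C).
  { unfold cis, x, y, Cminus, Cplus, Copp, Cmult, RtoC; simpl.
    pose proof (sin2_cos2 t) as Hs. unfold Rsqr in Hs.
    f_equal.
    - replace (cos t + - mu) with (cos t - mu * (sin t * sin t + cos t * cos t)) by (rewrite Hs; ring).
      ring.
    - ring. }
  assert (E3 : cis (2 * atan (y / x)) = ((x ^ 2 - y ^ 2) / (x ^ 2 + y ^ 2), 2 * x * y / (x ^ 2 + y ^ 2))).
  { unfold cis. rewrite cos_2a, sin_2a, cos_atan, sin_atan.
    assert (Hq : 0 < 1 + (y / x)²) by (pose proof (Rle_0_sqr (y / x)); lra).
    assert (Hsq : sqrt (1 + (y / x)²) * sqrt (1 + (y / x)²) = 1 + (y / x)²) by (apply sqrt_sqrt; lra).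
    assert (Hsp : 0 < sqrt (1 + (y / x)²)) by now apply sqrt_lt_R0.
    set (w := sqrt (1 + (y / x)²)) in *.
    assert (Hw : w * w = (x ^ 2 + y ^ 2) / x ^ 2) by (rewrite Hsq; unfold Rsqr; field; lra).
    f_equal.
    - transitivity ((1 - (y / x) * (y / x)) / (w * w)); [field; lra|].
      rewrite Hw. field. lra.
    - transitivity (2 * (y / x) / (w * w)); [field; lra|]. rewrite Hw. field. lra. }
  rewrite cis_plus, E3, E1, E2. unfold Cdiv. rewrite <- Cmult_assoc. f_equal.
  unfold Cinv, Cmult; simpl. f_equal; field; nra.
Qed.

(** * The Taylor coefficient as a cosine integral *)

Lemma cos_INR_PI (m : nat) (y : R) : cos (INR m * PI + y) = (-1) ^ m * cos y.
Proof.
  induction m.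
  - simpl. rewrite Rmult_0_l, Rplus_0_l. ring.
  - rewrite S_INR. replace ((INR m + 1) * PI + y) with (INR m * PI + y + PI) by ring.
    rewrite neg_cos, IHm. simpl. ring.
Qed.

Lemma continuous_theta (mu s : R) : 0 < Rabs mu < 1 -> continuous (theta mu) s.
Proof.
  intros Hm. assert (H : Rabs (mu * exp 0) < 1) by (rewrite exp_0, Rmult_1_r; lra).
  apply (is_derive_continuous _ _ (1 + 2 * ((mu * exp 0 * cos s - (mu * exp 0) ^ 2) / Qf mu 0 s))).
  apply derive_plus; [apply derive_id|]. apply derive_scal. now apply derive_argm_s.
Qed.

Lemma continuous_coef_phase (mu : R) (n k : nat) (t : R) : 0 < Rabs mu < 1 ->
  continuous (fun t => INR n * theta mu t - INR k * t) t.
Proof.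
  intros Hmu. apply (continuous_minus (fun t => INR n * theta mu t) (fun t => INR k * t)).
  - apply (continuous_scal_r (V := R_NormedModule) (INR n) (theta mu)). now apply continuous_theta.
  - apply (is_derive_continuous _ _ (INR k)). derivative.
Qed.

(* Complex conjugation. *)
Lemma theta_reflect (mu t : R) : theta mu (2 * PI - t) = 2 * PI - theta mu t.
Proof.
  unfold theta, argm. replace (2 * PI - t) with (- t + 2 * INR 1 * PI) by (simpl; ring).
  rewrite sin_period, cos_period, sin_neg, cos_neg.
  replace (mu * exp 0 * - sin t / (1 - mu * exp 0 * cos t))
    with (- (mu * exp 0 * sin t / (1 - mu * exp 0 * cos t))) by (unfold Rdiv; ring).
  rewrite atan_opp. simpl. ring.
Qed.

(** [z -> - conj z] exchanges [b_mu] and [b_(- mu)]; this moves the coalescence at [z = -1] to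
    [z = 1]. *)
Lemma theta_supplement (mu s : R) : theta mu (PI - s) = PI - theta (- mu) s.
Proof.
  unfold theta, argm. rewrite Rtrigo_facts.sin_pi_minus, Rtrigo_facts.cos_pi_minus.
  replace (- mu * exp 0 * sin s / (1 - - mu * exp 0 * cos s))
    with (- (mu * exp 0 * sin s / (1 - mu * exp 0 * - cos s))).
  - rewrite atan_opp. ring.
  - replace (1 - - mu * exp 0 * cos s) with (1 - mu * exp 0 * - cos s) by ring.
    unfold Rdiv. ring.
Qed.

Definition coef_integral (mu : R) (n k : nat) : R :=
  RInt (fun t => cos (INR n * theta mu t - INR k * t)) 0 PI.

(** The integrand is [exp (i (n theta - k t))]; conjugation symmetry removes the sine and halves
    the interval. *)
Lemma blaschke_coef_integral (lam : R) (n k : nat) :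
  0 < Rabs lam < 1 -> blaschke_coef lam n k = RtoC (/ PI * coef_integral lam n k).
Proof.
  intros Hl. unfold blaschke_coef, circle_integral.
  set (psi := fun t => INR n * theta lam t - INR k * t).
  assert (Hpsi : forall t, continuous psi t).
  { intros t. now apply continuous_coef_phase. }
  assert (Hc : forall t, continuous (fun t => cos (psi t)) t) by (intros; now apply continuous_cos_comp).
  assert (Hs : forall t, continuous (fun t => - sin (psi t)) t).
  { intros; apply (continuous_opp (fun t => sin (psi t))). now apply continuous_sin_comp. }
  assert (Hi : forall t, (blaschke lam (cis t) ^ n * / cis t ^ k * / cis t * (Ci * cis t))%C
      = (- sin (psi t), cos (psi t))).
  { intros t. rewrite blaschke_circle, <- Cpow_inv, cis_inv, !cis_pow by (try apply cis_neq_0; lra).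
    transitivity (Ci * (cis (INR n * theta lam t) * cis (INR k * - t)) * (cis t * cis (- t)))%C; [ring|].
    rewrite cis_opp_r, Cmult_1_r, <- cis_plus.
    unfold cis, Ci, Cmult, psi; simpl.
    replace (INR n * theta lam t + INR k * - t) with (INR n * theta lam t - INR k * t) by ring.
    f_equal; ring. }
  (* reflecting t into 2 PI - t changes the sign of psi modulo 2 PI *)
  assert (Hrefl : forall t, cos (psi (-1 * t + 2 * PI)) = cos (psi t)
                     /\ sin (psi (-1 * t + 2 * PI)) = - sin (psi t)).
  { intros t. replace (-1 * t + 2 * PI) with (2 * PI - t) by ring. unfold psi.
    rewrite theta_reflect.
    set (y := INR n * theta lam t - INR k * t).
    replace (INR n * (2 * PI - theta lam t) - INR k * (2 * PI - t))
      with (- (y + 2 * INR k * PI) + 2 * INR n * PI) by (unfold y; ring).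
    rewrite cos_period, sin_period, cos_neg, sin_neg, cos_period, sin_period. auto. }
  assert (Hhalf : forall f : R -> R, (forall t, continuous f t) ->
     RInt f PI (2 * PI) = RInt (fun t => f (-1 * t + 2 * PI)) 0 PI).
  { intros f Hf. rewrite (RInt_affine f (-1) (2 * PI)) by (auto; lra).
    replace (-1 * 0 + 2 * PI) with (2 * PI) by ring. replace (-1 * PI + 2 * PI) with PI by ring.
    rewrite <- (opp_RInt_swap (V := R_CompleteNormedModule) f) by now apply ex_RInt_cont.
    unfold opp; simpl. field. }
  assert (I1 : RInt (fun t => cos (psi t)) 0 (2 * PI) = 2 * coef_integral lam n k).
  { rewrite (RInt_split _ 0 PI) by auto. rewrite (Hhalf (fun t => cos (psi t))) by auto.
    rewrite (RInt_ext (fun t => cos (psi (-1 * t + 2 * PI))) (fun t => cos (psi t))).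
    - unfold coef_integral. fold psi.
      change (fun t => cos (INR n * theta lam t - INR k * t)) with (fun t => cos (psi t)).
      apply (Rplus_diag (RInt (fun t => cos (psi t)) 0 PI)).
    - intros t _. apply Hrefl. }
  assert (I2 : RInt (fun t => - sin (psi t)) 0 (2 * PI) = 0).
  { rewrite (RInt_split _ 0 PI) by auto. rewrite (Hhalf (fun t => - sin (psi t))) by auto.
    rewrite (RInt_ext (fun t => - sin (psi (-1 * t + 2 * PI))) (fun t => opp (- sin (psi t)))).
    - rewrite (RInt_opp (V := R_CompleteNormedModule) (fun t => - sin (psi t)))
        by now apply ex_RInt_cont.
      apply Rplus_opp_r.
    - intros t _. unfold opp; simpl. rewrite (proj2 (Hrefl t)). ring. }
  assert (E : RInt (V := C_R_CompleteNormedModule)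
      (fun t => (blaschke lam (cis t) ^ n * / cis t ^ k * / cis t * (Ci * cis t))%C) 0 (2 * PI)
      = (0, 2 * coef_integral lam n k)).
  { apply (is_RInt_unique (V := C_R_CompleteNormedModule)).
    apply (is_RInt_ext (V := C_R_NormedModule) (fun t => (- sin (psi t), cos (psi t)))).
    - intros t _. symmetry. apply Hi.
    - apply (is_RInt_fct_extend_pair (U := R_NormedModule) (V := R_NormedModule)
        (fun t => (- sin (psi t), cos (psi t)))); simpl.
      + pose proof (RInt_correct (V := R_CompleteNormedModule) _ _ _
          (ex_RInt_cont (fun t => - sin (psi t)) 0 (2 * PI) Hs)) as C1.
        rewrite I2 in C1. exact C1.
      + pose proof (RInt_correct (V := R_CompleteNormedModule) _ _ _
          (ex_RInt_cont (fun t => cos (psi t)) 0 (2 * PI) Hc)) as C1.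
        rewrite I1 in C1. exact C1. }
  rewrite E.
  pose proof PI_neq0 as HP.
  assert (E2 : (0, 2 * coef_integral lam n k) = (2 * Ci * PI * RtoC (/ PI * coef_integral lam n k))%C).
  { unfold Ci, Cmult, RtoC; simpl. f_equal; field; auto. }
  rewrite E2, Cmult_assoc, Cinv_l, Cmult_1_l; auto.
  apply Cmult_neq_0; [apply Cmult_neq_0|].
  - intros H. apply (f_equal fst) in H. simpl in H. lra.
  - intros H. apply (f_equal snd) in H. simpl in H. lra.
  - intros H. apply (f_equal fst) in H. simpl in H. lra.
Qed.

Lemma phase_integral_coef (sg mu : R) (n k : nat) :
  admissible sg mu -> (0 < n)%nat ->
  phase_integral sg mu (INR k / INR n) (INR n) = coef_integral mu n k.
Proof.
  intros Ha Hn. assert (0 < INR n) by now apply lt_0_INR.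
  unfold phase_integral, coef_integral. apply RInt_ext. intros s _. rewrite vf_theta.
  destruct Ha as [[-> _]|[-> _]].
  - f_equal. field. lra.
  - rewrite <- cos_neg. f_equal. field. lra.
Qed.

(** The substitution [t -> PI - t] trades [b_lam] for [b_(- lam)] and produces the sign
    [(-1)^(n - k)]. *)
Lemma coef_integral_neg (lam : R) (n k : nat) : 0 < Rabs lam < 1 -> (k <= n)%nat ->
  coef_integral lam n k = (-1) ^ (n - k) * coef_integral (- lam) n k.
Proof.
  intros Hl Hk. unfold coef_integral.
  set (f := fun t => cos (INR n * theta lam t - INR k * t)).
  set (g := fun t => cos (INR n * theta (- lam) t - INR k * t)).
  assert (Hf : forall t, continuous f t).
  { intros t. apply continuous_cos_comp. now apply continuous_coef_phase. }
  assert (Hg : forall t, continuous g t).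
  { intros t. apply continuous_cos_comp, continuous_coef_phase. now rewrite Rabs_Ropp. }
  assert (E : RInt (fun t => f (-1 * t + PI)) 0 PI = RInt f 0 PI).
  { rewrite (RInt_affine f (-1) PI) by (auto; lra).
    replace (-1 * 0 + PI) with PI by ring. replace (-1 * PI + PI) with 0 by ring.
    rewrite <- (opp_RInt_swap (V := R_CompleteNormedModule) f) by now apply ex_RInt_cont.
    unfold opp; simpl. field. }
  rewrite <- E.
  transitivity (RInt (fun t => scal ((-1) ^ (n - k)) (g t)) 0 PI).
  - apply RInt_ext. intros t _. unfold f, g, scal; simpl; unfold mult; simpl.
    replace (-1 * t + PI) with (PI - t) by ring. rewrite theta_supplement.
    replace (INR n * (PI - theta (- lam) t) - INR k * (PI - t))
      with (INR (n - k) * PI + - (INR n * theta (- lam) t - INR k * t))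
      by (rewrite minus_INR by auto; ring).
    now rewrite cos_INR_PI, cos_neg.
  - apply (RInt_scal (V := R_CompleteNormedModule) g). now apply ex_RInt_cont.
Qed.

(** * Branches of the logarithm *)

Lemma cis_inj (s t : R) : Rabs (s - t) < 2 * PI -> cis s = cis t -> s = t.
Proof.
  intros Hd E.
  assert (H : cis (s - t) = 1) by (unfold Rminus; rewrite cis_plus, E, <- cis_plus, Rplus_opp_r; apply cis_0).
  apply (f_equal fst) in H. simpl in H.
  assert (H2 : cos (Rabs (s - t)) = 1).
  { unfold Rabs. destruct (Rcase_abs (s - t)); [now rewrite cos_neg|auto]. }
  set (d := Rabs (s - t)) in *.
  assert (Hd0 : 0 <= d) by apply Rabs_pos.
  destruct (Req_dec d 0) as [Z|Z].
  - apply Rabs_eq_0_inv in Z. lra.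
  - exfalso. replace d with (2 * (d / 2)) in H2 by field. rewrite cos_2a_sin in H2.
    assert (0 < sin (d / 2)) by (apply sin_gt_0; lra). nra.
Qed.

Lemma Cmod_cis (t : R) : Cmod (cis t) = 1.
Proof.
  unfold Cmod, cis; simpl. rewrite !Rmult_1_r.
  pose proof (sin2_cos2 t) as H. unfold Rsqr in H. rewrite Rplus_comm, H. apply sqrt_1.
Qed.

Lemma Clog_polar (th rho t : R) :
  0 < rho -> th < t <= th + 2 * PI -> Clog th (rho * cis t)%C = (ln rho, t).
Proof.
  intros Hr Ht.
  assert (Hm : Cmod (rho * cis t) = rho).
  { rewrite Cmod_mult, Cmod_cis, Cmod_R, Rabs_pos_eq; lra. }
  unfold Clog. rewrite Hm. f_equal. unfold Carg. rewrite Hm.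
  apply (iota_unique (V := R_CompleteNormedModule)).
  - intros y [Hy E]. apply cis_inj.
    + apply Rabs_def1; lra.
    + apply (f_equal (Cmult (/ rho))) in E.
      assert (Hrr : (/ rho * rho)%C = 1).
      { apply Cinv_l. intros H. apply (f_equal fst) in H. simpl in H. lra. }
      now rewrite !Cmult_assoc, Hrr, !Cmult_1_l in E.
  - auto.
Qed.

Lemma Clog_cis (th t : R) : th < t <= th + 2 * PI -> Clog th (cis t) = (0, t).
Proof.
  intros Ht. rewrite <- (Cmult_1_l (cis t)). rewrite (Clog_polar th 1 t) by (auto; lra).
  now rewrite ln_1.
Qed.

Lemma cube_inj (x y : R) : x ^ 3 = y ^ 3 -> x = y.
Proof.
  intros H. assert (E : (x - y) * (x ^ 2 + x * y + y ^ 2) = 0) by lra.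
  apply Rmult_integral in E. destruct E as [E|E]; [lra|].
  assert (x + y / 2 = 0) by nra. assert (y = 0) by nra. lra.
Qed.

Lemma gamma2_unique (th lam a g : R) :
  (gamma3 th lam a ^ 2)%C = RtoC (g ^ 3) -> gamma2 th lam a = g.
Proof.
  intros H. unfold gamma2. apply (iota_unique (V := R_CompleteNormedModule)).
  - intros y Hy. rewrite H, <- RtoC_pow in Hy. apply cube_inj. now apply RtoC_inj.
  - now rewrite H, RtoC_pow.
Qed.

Lemma Rpower_two_thirds (x : R) : 0 < x -> Rpower x (2 / 3) ^ 3 = x ^ 2.
Proof.
  intros Hx. rewrite <- Rpower_pow by apply exp_pos.
  rewrite Rpower_mult, <- (Rpower_pow 2 x) by auto. f_equal. simpl. field.
Qed.

Lemma gamma3_sqr_coordinates (a x1 y1 x2 y2 x3 y3 x4 y4 : R) :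
  ((3 / 4 * (((x1, y1) - a * (x2, y2)) - ((x3, y3) - a * (x4, y4)))) ^ 2)%C
  = ((3 / 4 * ((x1 - a * x2) - (x3 - a * x4))) ^ 2 - (3 / 4 * ((y1 - a * y2) - (y3 - a * y4))) ^ 2,
     2 * (3 / 4 * ((x1 - a * x2) - (x3 - a * x4))) * (3 / 4 * ((y1 - a * y2) - (y3 - a * y4)))).
Proof.
  assert (E : (3 / 4 * (((x1, y1) - a * (x2, y2)) - ((x3, y3) - a * (x4, y4))))%C
    = (3 / 4 * ((x1 - a * x2) - (x3 - a * x4)), 3 / 4 * ((y1 - a * y2) - (y3 - a * y4)))).
  { unfold Cminus, Cplus, Copp, Cdiv, Cmult, Cinv, RtoC; simpl. f_equal; field. }
  rewrite E. unfold Cpow, Cmult, RtoC; simpl. f_equal; ring.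
Qed.

(** * The critical points *)

(* [X] is cos s at a stationary point s, or cosh r at a saddle point exp (+- r). *)
Lemma critical_point_formula (sg mu a X : R) :
  admissible sg mu -> 0 < 1 + mu ^ 2 - 2 * mu * X ->
  a = (1 - mu ^ 2) / (1 + mu ^ 2 - 2 * mu * X) ->
  0 < a /\ xcrit (Rabs mu) a = - sg * X /\
  Defs.Delta (Rabs mu) a = (2 * Rabs mu * a / (1 - mu ^ 2)) ^ 2 * (1 - X ^ 2).
Proof.
  intros Ha HD E. destruct (admissible_bounds _ _ Ha) as (H1 & _).
  assert (Hm2 : 0 < 1 - mu ^ 2) by nra.
  assert (Ha0 : 0 < a) by (rewrite E; apply Rdiv_lt_0_compat; lra).
  split; auto.
  unfold xcrit, Defs.Delta, alpha0.
  destruct Ha as [[-> Hmu]|[-> Hmu]].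
  - rewrite Rabs_left by lra. split; rewrite E; field; repeat split; lra.
  - rewrite Rabs_pos_eq by lra. split; rewrite E; field; repeat split; lra.
Qed.

Lemma stationary_slope (sg mu a s0 : R) : admissible sg mu -> vs sg mu a 0 s0 = 0 ->
  0 < 1 + mu ^ 2 - 2 * mu * cos s0 /\ a = (1 - mu ^ 2) / (1 + mu ^ 2 - 2 * mu * cos s0).
Proof.
  intros Ha Hv. rewrite vs_circle in Hv by auto.
  pose proof (admissible_modulus sg mu s0 Ha) as Hb.
  destruct (admissible_bounds _ _ Ha) as (_ & _ & _ & H4).
  split; [lra|]. apply Rmult_integral in Hv. destruct Hv as [Hv|Hv]; [destruct Ha; lra|lra].
Qed.

Lemma saddle_slope (sg mu a r : R) : admissible sg mu -> 0 <= r <= (1 - Rabs mu) / 2 ->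
  vs sg mu a r 0 = 0 ->
  0 < 1 + mu ^ 2 - 2 * mu * cosh r /\ a = (1 - mu ^ 2) / (1 + mu ^ 2 - 2 * mu * cosh r).
Proof.
  intros Ha Hr Hv. pose proof (admissible_abs _ _ Ha) as Hm.
  destruct (annulus_bounds sg mu r Ha Hr) as (B1 & B2 & _).
  destruct (vs_imaginary_axis sg mu a r Ha ltac:(lra) ltac:(lra)) as (HD & _ & Hvs).
  rewrite Hvs, <- slope_gap_spec in Hv by auto.
  replace ((1 - mu) ^ 2 + 2 * mu * (1 - cosh r)) with (1 + mu ^ 2 - 2 * mu * cosh r) in * by ring.
  split; auto. apply Rmult_integral in Hv. destruct Hv as [Hv|Hv]; [destruct Ha; lra|lra].
Qed.

(** The direction of the cut belonging to the end of the range that [sg] stands for. *)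
Definition branch (sg : R) : R := if Rle_dec 0 sg then 0 else - PI.

Lemma cosh_sinh_sqr (r : R) : cosh r ^ 2 - sinh r ^ 2 = 1.
Proof.
  unfold cosh, sinh. transitivity (exp r * exp (- r)); [field|apply exp_mul_opp].
Qed.

(* Keeps the arguments that occur near the coalescence inside the window of either branch. *)
Lemma theta_small (sg mu s : R) : admissible sg mu -> 0 <= s <= (1 - Rabs mu) ^ 2 ->
  Rabs (theta mu s) <= 1.
Proof.
  intros Ha Hs. destruct (admissible_bounds _ _ Ha) as (H1 & _ & _ & H4).
  pose proof (admissible_sg_abs _ _ Ha) as Hsg.
  assert (E : Rabs (theta mu s) = Rabs (vf sg mu 0 0 s - vf sg mu 0 0 0)).
  { rewrite !vf_theta. unfold theta at 3. rewrite argm_0.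
    replace (sg * (theta mu s - 0 * s) - sg * (0 + 2 * 0 - 0 * 0)) with (sg * theta mu s) by ring.
    rewrite Rabs_mult, Hsg. ring. }
  rewrite E. apply Rle_trans with (/ (1 - Rabs mu) ^ 2 * Rabs (s - 0)).
  - apply (lipschitz_on (vf sg mu 0 0) (vs sg mu 0 0) 0 s); try lra.
    + intros x _. now apply phase_on_circle.
    + intros x _. rewrite vs_circle by auto.
      pose proof (admissible_modulus sg mu x Ha) as Hb.
      rewrite Rabs_mult, Hsg, Rmult_1_l, Ropp_0, Rplus_0_l.
      assert (0 <= 1 - mu ^ 2 <= 1) by nra.
      rewrite Rabs_pos_eq by (apply Rdiv_le_0_compat; lra).
      rewrite <- (Rmult_1_l (/ (1 - Rabs mu) ^ 2)). apply Rmult_le_compat; try lra.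
      * left; apply Rinv_0_lt_compat; lra.
      * apply Rinv_le_contravar; lra.
  - rewrite Rminus_0_r, (Rabs_pos_eq s) by lra.
    apply Rmult_le_reg_l with ((1 - Rabs mu) ^ 2); [lra|].
    rewrite <- Rmult_assoc, Rinv_r; lra.
Qed.

(** The critical points [z_+-] are the two stationary points on the circle, conjugate to each
    other, so that [gamma^3 = 3/4 (Phi z_+ - Phi z_-)] is, up to sign, [3/2 i] times the phase
    there. *)
Lemma gamma2_stationary (sg mu a s0 : R) : admissible sg mu ->
  0 < s0 <= (1 - Rabs mu) ^ 2 -> s0 <= 1 -> vs sg mu a 0 s0 = 0 -> 0 < - vf sg mu a 0 s0 ->
  gamma2 (branch sg) (Rabs mu) a = - Rpower (3 / 2 * - vf sg mu a 0 s0) (2 / 3).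
Proof.
  intros Ha Hs0 Hs1 Hv HF. apply gamma2_unique.
  replace ((- Rpower (3 / 2 * - vf sg mu a 0 s0) (2 / 3)) ^ 3)
    with (- (Rpower (3 / 2 * - vf sg mu a 0 s0) (2 / 3)) ^ 3) by ring.
  rewrite Rpower_two_thirds by lra.
  destruct (stationary_slope _ _ _ _ Ha Hv) as [HD E].
  destruct (critical_point_formula sg mu a (cos s0) Ha HD E) as (Ha0 & Hx & _).
  pose proof (theta_small sg mu s0 Ha ltac:(lra)) as Hth. apply Rabs_le_between in Hth.
  pose proof PI2_3_2 as HPI.
  assert (Hsin : 0 < sin s0) by (apply sin_gt_0; lra).
  assert (Hsq : sqrt_xx1 (xcrit (Rabs mu) a) = (0, sin s0)).
  { unfold sqrt_xx1. rewrite Hx.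
    assert (Hss : (- sg * cos s0) ^ 2 = 1 - sin s0 ^ 2).
    { destruct (admissible_sg _ _ Ha) as [_ Hsg].
      pose proof (sin2_cos2 s0) as H2. unfold Rsqr in H2.
      replace ((- sg * cos s0) ^ 2) with (sg * sg * (cos s0 * cos s0)) by ring. rewrite Hsg. lra. }
    rewrite Hss. f_equal.
    - apply sqrt_neg_0. nra.
    - replace (1 - (1 - sin s0 ^ 2)) with (sin s0 ^ 2) by ring.
      rewrite sqrt_pow2; lra. }
  assert (Habs : Rabs mu < 1) by apply (admissible_abs sg), Ha.
  rewrite vf_theta in *.
  unfold gamma3, Phi, zplus, zminus. rewrite Hsq, Hx.
  destruct Ha as [[-> Hmu]|[-> Hmu]].
  - (* near alpha0 the stationary points are exp (i (PI -+ s0)) *)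
    unfold branch. destruct (Rle_dec 0 1); [|lra].
    replace (Rabs mu) with (- mu) in * by (rewrite Rabs_left; lra).
    assert (Zp : (RtoC (- (1) * cos s0) + (0, sin s0))%C = cis (PI - s0)).
    { unfold cis, Cplus, RtoC; simpl. rewrite Rtrigo_facts.sin_pi_minus, Rtrigo_facts.cos_pi_minus.
      f_equal; ring. }
    assert (Zm : (RtoC (- (1) * cos s0) - (0, sin s0))%C = cis (PI + s0)).
    { unfold cis, Cminus, Cplus, Copp, RtoC; simpl.
      rewrite (Rplus_comm PI), neg_sin, neg_cos. f_equal; ring. }
    rewrite Zp, Zm, !blaschke_circle by (rewrite Rabs_Ropp, Rabs_left; lra).
    rewrite theta_supplement, Ropp_involutive.
    assert (T2 : theta (- mu) (PI + s0) = PI + theta mu s0).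
    { replace (PI + s0) with (2 * PI - (PI - s0)) by ring.
      rewrite theta_reflect, theta_supplement, Ropp_involutive. ring. }
    rewrite T2, !Clog_cis by lra.
    rewrite gamma3_sqr_coordinates. unfold RtoC. f_equal; field.
  - (* near 1 / alpha0 the stationary points are exp (+- i s0) *)
    unfold branch. destruct (Rle_dec 0 (-1)); [lra|].
    replace (Rabs mu) with mu in * by (rewrite Rabs_pos_eq; lra).
    assert (Zp : (RtoC (- (-1) * cos s0) + (0, sin s0))%C = cis s0).
    { unfold cis, Cplus, RtoC; simpl. f_equal; ring. }
    assert (Zm : (RtoC (- (-1) * cos s0) - (0, sin s0))%C = cis (- s0)).
    { unfold cis, Cminus, Cplus, Copp, RtoC; simpl. rewrite sin_neg, cos_neg. f_equal; ring. }
    rewrite Zp, Zm, !blaschke_circle by (rewrite Rabs_pos_eq; lra).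
    assert (T2 : theta mu (- s0) = - theta mu s0).
    { unfold theta, argm. rewrite sin_neg, cos_neg.
      replace (mu * exp 0 * - sin s0 / (1 - mu * exp 0 * cos s0))
        with (- (mu * exp 0 * sin s0 / (1 - mu * exp 0 * cos s0))) by (unfold Rdiv; ring).
      rewrite atan_opp. ring. }
    rewrite T2, !Clog_cis by lra.
    rewrite gamma3_sqr_coordinates. unfold RtoC. f_equal; field.
Qed.

(* On the real axis the logarithm of the modulus of the Blaschke factor is a
   difference of two values of [lnmod]. *)
Lemma ln_blaschke_real (mu r : R) : Rabs (mu * exp r) < 1 -> Rabs (mu * exp (- r)) < 1 ->
  ln ((exp r - mu) / (1 - mu * exp r)) = r + lnmod mu (- r) 0 - lnmod mu r 0.
Proof.
  intros H1 H2. unfold lnmod, Qf. rewrite cos_0.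
  pose proof (exp_mul_opp r) as Hee.
  assert (P1 : 0 < 1 - mu * exp r) by (pose proof (Rle_abs (mu * exp r)); lra).
  assert (P2 : 0 < 1 - mu * exp (- r)) by (pose proof (Rle_abs (mu * exp (- r))); lra).
  replace (exp r - mu) with (exp r * (1 - mu * exp (- r))).
  2:{ rewrite Rmult_minus_distr_l. transitivity (exp r - mu * (exp r * exp (- r))); [ring|]. rewrite Hee; ring. }
  replace (1 + (mu * exp r) ^ 2 - 2 * (mu * exp r) * 1) with ((1 - mu * exp r) ^ 2) by ring.
  replace (1 + (mu * exp (- r)) ^ 2 - 2 * (mu * exp (- r)) * 1) with ((1 - mu * exp (- r)) ^ 2) by ring.
  pose proof (exp_pos r).
  rewrite !ln_pow by auto. unfold Rdiv.
  rewrite ln_mult by (try apply Rinv_0_lt_compat; auto; now apply Rmult_lt_0_compat).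
  rewrite ln_mult, ln_Rinv, ln_exp by auto. simpl. field.
Qed.

(** Here [z_+-] are the saddle points [exp (+- r)], up to the sign [- sg], where the arguments of
    [b_lam z] and [z] are the same; the difference of [Phi] is real. *)
Lemma gamma2_saddle (sg mu a r : R) : admissible sg mu ->
  0 < r <= (1 - Rabs mu) / 2 -> vs sg mu a r 0 = 0 -> 0 < - uf sg mu a r 0 ->
  gamma2 (branch sg) (Rabs mu) a = Rpower (3 / 2 * - uf sg mu a r 0) (2 / 3).
Proof.
  intros Ha Hr Hv HF. apply gamma2_unique. rewrite Rpower_two_thirds by lra.
  destruct (saddle_slope sg mu a r Ha ltac:(lra) Hv) as [HD E].
  destruct (critical_point_formula sg mu a (cosh r) Ha HD E) as (Ha0 & Hx & _).
  pose proof PI2_3_2 as HPI. pose proof (admissible_abs _ _ Ha) as Hm.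
  destruct (annulus_bounds sg mu r Ha ltac:(lra)) as (B1 & B2 & _).
  assert (L1 : Rabs (mu * exp r) < 1) by lra. assert (L2 : Rabs (mu * exp (- r)) < 1) by lra.
  assert (P1 : 0 < 1 - mu * exp r) by (pose proof (Rle_abs (mu * exp r)); lra).
  assert (P2 : 0 < 1 - mu * exp (- r)) by (pose proof (Rle_abs (mu * exp (- r))); lra).
  assert (Hsinh : 0 < sinh r) by (pose proof (sinh_bounds r); lra).
  pose proof (exp_mul_opp r) as Hee.
  pose proof (exp_pos r) as Ep. pose proof (exp_pos (- r)) as Em.
  assert (Hsq : sqrt_xx1 (xcrit (Rabs mu) a) = (sinh r, 0)).
  { unfold sqrt_xx1. rewrite Hx.
    assert (Hss : (- sg * cosh r) ^ 2 = 1 + sinh r ^ 2).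
    { destruct (admissible_sg _ _ Ha) as [_ Hsg]. pose proof (cosh_sinh_sqr r).
      replace ((- sg * cosh r) ^ 2) with (sg * sg * cosh r ^ 2) by ring. rewrite Hsg. lra. }
    rewrite Hss. f_equal.
    - replace (1 + sinh r ^ 2 - 1) with (sinh r ^ 2) by ring. rewrite sqrt_pow2; lra.
    - apply sqrt_neg_0. nra. }
  pose proof (ln_blaschke_real mu r L1 L2) as Lp.
  pose proof (ln_blaschke_real mu (- r) L2 ltac:(now rewrite Ropp_involutive)) as Lm.
  rewrite Ropp_involutive in Lm.
  assert (G1 : 0 < exp r - mu).
  { replace (exp r - mu) with (exp r * (1 - mu * exp (- r))); [now apply Rmult_lt_0_compat|].
    transitivity (exp r - mu * (exp r * exp (- r))); [ring|]. rewrite Hee; ring. }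
  assert (G2 : 0 < exp (- r) - mu).
  { replace (exp (- r) - mu) with (exp (- r) * (1 - mu * exp r)); [now apply Rmult_lt_0_compat|].
    transitivity (exp (- r) - mu * (exp r * exp (- r))); [ring|]. rewrite Hee; ring. }
  assert (Q1 : 0 < (exp r - mu) / (1 - mu * exp r)) by now apply Rdiv_lt_0_compat.
  assert (Q2 : 0 < (exp (- r) - mu) / (1 - mu * exp (- r))) by now apply Rdiv_lt_0_compat.
  unfold uf in *.
  unfold gamma3, Phi, zplus, zminus. rewrite Hsq, Hx.
  destruct Ha as [[-> Hmu]|[-> Hmu]].
  - unfold branch. destruct (Rle_dec 0 1); [|lra].
    replace (Rabs mu) with (- mu) in * by (rewrite Rabs_left; lra).
    assert (Zp : (RtoC (- (1) * cosh r) + (sinh r, 0))%C = (exp (- r) * cis PI)%C).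
    { unfold cis, Cplus, Cmult, RtoC; simpl. rewrite cos_PI, sin_PI. unfold cosh, sinh.
      f_equal; field. }
    assert (Zm : (RtoC (- (1) * cosh r) - (sinh r, 0))%C = (exp r * cis PI)%C).
    { unfold cis, Cminus, Cplus, Copp, Cmult, RtoC; simpl. rewrite cos_PI, sin_PI. unfold cosh, sinh.
      f_equal; field. }
    rewrite Zp, Zm.
    assert (Bb : forall x, 0 < 1 - mu * x -> blaschke (- mu) (x * cis PI)%C
        = (((x - mu) / (1 - mu * x))%R * cis PI)%C).
    { intros x Hx1. unfold blaschke, cis. rewrite cos_PI, sin_PI.
      unfold Cminus, Cplus, Copp, Cdiv, Cmult, Cinv, RtoC; simpl. f_equal; field; nra. }
    rewrite !Bb, !Clog_polar by (auto; lra).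
    rewrite Lp, Lm, !ln_exp.
    rewrite gamma3_sqr_coordinates. unfold RtoC. f_equal; field.
  - unfold branch. destruct (Rle_dec 0 (-1)); [lra|].
    replace (Rabs mu) with mu in * by (rewrite Rabs_pos_eq; lra).
    assert (Zp : (RtoC (- (-1) * cosh r) + (sinh r, 0))%C = (exp r * cis 0)%C).
    { unfold cis, Cplus, Cmult, RtoC; simpl. rewrite cos_0, sin_0. unfold cosh, sinh.
      f_equal; field. }
    assert (Zm : (RtoC (- (-1) * cosh r) - (sinh r, 0))%C = (exp (- r) * cis 0)%C).
    { unfold cis, Cminus, Cplus, Copp, Cmult, RtoC; simpl. rewrite cos_0, sin_0. unfold cosh, sinh.
      f_equal; field. }
    rewrite Zp, Zm.
    assert (Bb : forall x, 0 < 1 - mu * x -> blaschke mu (x * cis 0)%C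
        = (((x - mu) / (1 - mu * x))%R * cis 0)%C).
    { intros x Hx1. unfold blaschke, cis. rewrite cos_0, sin_0.
      unfold Cminus, Cplus, Copp, Cdiv, Cmult, Cinv, RtoC; simpl. f_equal; field; nra. }
    rewrite !Bb, !Clog_polar by (auto; lra).
    rewrite Lp, Lm, !ln_exp.
    rewrite gamma3_sqr_coordinates. unfold RtoC. f_equal; field.
Qed.

Lemma gamma2_coalescence (sg mu a : R) : admissible sg mu -> tau sg mu a = 0 ->
  gamma2 (branch sg) (Rabs mu) a = 0.
Proof.
  intros Ha Ht. apply gamma2_unique.
  assert (Hv : vs sg mu a 0 0 = 0).
  { rewrite vs_critical_line, Ht, cos_0 by auto. unfold slope_gap, Rdiv. ring. }
  destruct (stationary_slope _ _ _ _ Ha Hv) as [HD E].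
  destruct (critical_point_formula sg mu a (cos 0) Ha HD E) as (Ha0 & Hx & _).
  rewrite cos_0 in Hx.
  assert (Hsq : sqrt_xx1 (xcrit (Rabs mu) a) = 0).
  { unfold sqrt_xx1. rewrite Hx. replace ((- sg * 1) ^ 2) with (sg * sg) by ring.
    destruct (admissible_sg _ _ Ha) as [_ ->].
    replace (1 - 1) with 0 by ring. now rewrite sqrt_0. }
  unfold gamma3, zplus, zminus. rewrite Hsq.
  replace (xcrit (Rabs mu) a - 0)%C with (xcrit (Rabs mu) a + 0)%C by ring.
  replace (0 ^ 3) with 0 by ring. ring.
Qed.

(** * The amplitude *)

(** Since the slope of [theta] on the circle is [(1 - mu^2) / |1 - mu z|^2] and equals [a] at the
    stationary point, the second derivative of the phase there is [a |Delta|^(1/2)]. *)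
Lemma curv_Delta (sg mu a s0 : R) : admissible sg mu -> 0 < s0 <= 1 -> vs sg mu a 0 s0 = 0 ->
  0 < a /\ Defs.Delta (Rabs mu) a <> 0 /\ curv mu s0 = a * sqrt (Rabs (Defs.Delta (Rabs mu) a)).
Proof.
  intros Ha Hs0 Hv. destruct (stationary_slope _ _ _ _ Ha Hv) as [HD E].
  destruct (critical_point_formula sg mu a (cos s0) Ha HD E) as (Ha0 & _ & HDl).
  pose proof (admissible_abs _ _ Ha) as Hm. destruct (admissible_bounds _ _ Ha) as (H1 & _).
  assert (Hm2 : 0 < 1 - mu ^ 2) by nra. pose proof PI2_3_2.
  assert (Hsin : 0 < sin s0) by (apply sin_gt_0; lra).
  assert (Hk : 0 < 2 * Rabs mu * a / (1 - mu ^ 2)) by pos.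
  set (k := 2 * Rabs mu * a / (1 - mu ^ 2)) in *.
  assert (HDs : Defs.Delta (Rabs mu) a = (k * sin s0) ^ 2).
  { rewrite HDl. pose proof (sin2_cos2 s0) as Hs. unfold Rsqr in Hs.
    replace (1 - cos s0 ^ 2) with (sin s0 ^ 2) by lra. ring. }
  assert (Hks : 0 < k * sin s0) by now apply Rmult_lt_0_compat.
  split; auto. split; [rewrite HDs; apply Rgt_not_eq, pow_lt, Hks|].
  rewrite HDs, Rabs_pos_eq, sqrt_pow2 by (try lra; left; now apply pow_lt).
  unfold curv, k. rewrite E. field. split; lra.
Qed.

Lemma curvh_Delta (sg mu a r : R) : admissible sg mu -> 0 < r <= (1 - Rabs mu) / 2 ->
  vs sg mu a r 0 = 0 ->
  0 < a /\ Defs.Delta (Rabs mu) a <> 0 /\ curvh mu r = a * sqrt (Rabs (Defs.Delta (Rabs mu) a)).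
Proof.
  intros Ha Hr Hv. destruct (saddle_slope sg mu a r Ha ltac:(lra) Hv) as [HD E].
  destruct (critical_point_formula sg mu a (cosh r) Ha HD E) as (Ha0 & _ & HDl).
  pose proof (admissible_abs _ _ Ha) as Hm. destruct (admissible_bounds _ _ Ha) as (H1 & _).
  assert (Hm2 : 0 < 1 - mu ^ 2) by nra.
  assert (Hsinh : 0 < sinh r) by (pose proof (sinh_bounds r); lra).
  assert (Hk : 0 < 2 * Rabs mu * a / (1 - mu ^ 2)) by pos.
  set (k := 2 * Rabs mu * a / (1 - mu ^ 2)) in *.
  assert (HDs : Defs.Delta (Rabs mu) a = - (k * sinh r) ^ 2).
  { rewrite HDl. pose proof (cosh_sinh_sqr r) as Hs.
    replace (1 - cosh r ^ 2) with (- sinh r ^ 2) by lra. ring. }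
  assert (Hks : 0 < k * sinh r) by now apply Rmult_lt_0_compat.
  assert (Hks2 : 0 < (k * sinh r) ^ 2) by now apply pow_lt.
  split; auto. split; [rewrite HDs; lra|].
  rewrite HDs, Rabs_Ropp, Rabs_pos_eq, sqrt_pow2 by lra.
  destruct (annulus_bounds sg mu r Ha ltac:(lra)) as (B1 & B2 & _).
  destruct (vs_imaginary_axis sg mu a r Ha ltac:(lra) ltac:(lra)) as (_ & EE & _).
  assert (EQ : Qf mu r 0 * Qf mu (- r) 0 = (1 + mu ^ 2 - 2 * mu * cosh r) ^ 2).
  { replace (1 + mu ^ 2 - 2 * mu * cosh r) with ((1 - mu) ^ 2 + 2 * mu * (1 - cosh r)) by ring.
    rewrite <- EE. unfold Qf. rewrite cos_0. ring. }
  unfold curvh, k. rewrite EQ, E.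
  replace (exp r - exp (- r)) with (2 * sinh r) by (unfold sinh; field).
  field. split; lra.
Qed.

(** * Local form of gamma^2 *)

(** What the estimates use at a stationary point: position, phase value, and [gamma^2] both
    exactly and to leading order in [tau]. *)
Lemma stationary_structure (sg mu h e : R) : admissible sg mu -> 0 < h -> 0 < e ->
  exists t, 0 < t /\ forall a, - t < tau sg mu a < 0 -> exists s0,
    0 < s0 < h /\ s0 <= 1 /\ vs sg mu a 0 s0 = 0 /\
    0 < - vf sg mu a 0 s0 <= cubic mu * s0 ^ 3 /\
    gamma2 (branch sg) (Rabs mu) a = - Rpower (3 / 2 * - vf sg mu a 0 s0) (2 / 3) /\
    Rabs (gamma2 (branch sg) (Rabs mu) a / (tau sg mu a / Rpower (cubic mu) (1 / 3)) - 1) <= e.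
Proof.
  intros Ha Hh He. destruct (admissible_bounds _ _ Ha) as (H1 & H2 & H3 & H4).
  destruct (stationary_expansion _ _ Ha) as [C [HC Hexp]].
  destruct (gamma_ratio (cubic mu) C e H3 HC He) as [h1 [Hh1 Hrat]].
  set (h2 := Rmin (Rmin h h1) (Rmin 1 ((1 - Rabs mu) ^ 2))).
  assert (Hh2 : 0 < h2) by (unfold h2; pos).
  assert (B : h2 <= h /\ h2 <= h1 /\ h2 <= 1 /\ h2 <= (1 - Rabs mu) ^ 2).
  { pose proof (Rmin_l (Rmin h h1) (Rmin 1 ((1 - Rabs mu) ^ 2))) as B1.
    pose proof (Rmin_r (Rmin h h1) (Rmin 1 ((1 - Rabs mu) ^ 2))) as B2. fold h2 in B1, B2.
    pose proof (Rmin_l h h1). pose proof (Rmin_r h h1).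
    pose proof (Rmin_l 1 ((1 - Rabs mu) ^ 2)). pose proof (Rmin_r 1 ((1 - Rabs mu) ^ 2)). lra. }
  destruct (exists_stationary sg mu h2 Ha ltac:(lra)) as [t [Ht Hex]].
  exists t. split; auto. intros a Hta. destruct (Hex a Hta) as [s0 [Hs0 Hv]].
  destruct (Hexp a s0 ltac:(lra) Hv) as [E1 E2].
  destruct (Hrat s0 (- vf sg mu a 0 s0) (- tau sg mu a) ltac:(lra) E1 E2) as (HF & HR).
  pose proof (gamma2_stationary sg mu a s0 Ha ltac:(lra) ltac:(lra) Hv (proj1 HF)) as Hg.
  exists s0. repeat split; auto; try lra.
  rewrite Hg. eapply Rle_trans; [right|exact HR]. f_equal. f_equal.
  assert (0 < Rpower (cubic mu) (1 / 3)) by pos. field. split; lra.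
Qed.

Lemma saddle_structure (sg mu h e : R) : admissible sg mu -> 0 < h -> 0 < e ->
  exists t, 0 < t /\ forall a, 0 < tau sg mu a < t -> exists r,
    0 < r < h /\ r <= (1 - Rabs mu) / 2 /\ vs sg mu a r 0 = 0 /\
    0 < - uf sg mu a r 0 <= cubic mu * r ^ 3 /\
    gamma2 (branch sg) (Rabs mu) a = Rpower (3 / 2 * - uf sg mu a r 0) (2 / 3) /\
    Rabs (gamma2 (branch sg) (Rabs mu) a / (tau sg mu a / Rpower (cubic mu) (1 / 3)) - 1) <= e.
Proof.
  intros Ha Hh He. destruct (admissible_bounds _ _ Ha) as (H1 & H2 & H3 & H4).
  pose proof (admissible_abs _ _ Ha) as Hm.
  destruct (saddle_expansion _ _ Ha) as [C [HC Hexp]].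
  destruct (gamma_ratio (cubic mu) C e H3 HC He) as [h1 [Hh1 Hrat]].
  set (h2 := Rmin (Rmin h h1) ((1 - Rabs mu) / 2)).
  assert (Hh2 : 0 < h2) by (unfold h2; pos).
  assert (B : h2 <= h /\ h2 <= h1 /\ h2 <= (1 - Rabs mu) / 2).
  { pose proof (Rmin_l (Rmin h h1) ((1 - Rabs mu) / 2)) as B1.
    pose proof (Rmin_r (Rmin h h1) ((1 - Rabs mu) / 2)) as B2. fold h2 in B1, B2.
    pose proof (Rmin_l h h1). pose proof (Rmin_r h h1). lra. }
  destruct (exists_saddle sg mu h2 Ha ltac:(lra)) as [t [Ht Hex]].
  exists t. split; auto. intros a Hta. destruct (Hex a Hta) as [r [Hr Hv]].
  destruct (Hexp a r ltac:(lra) Hv) as [E1 E2].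
  destruct (Hrat r (- uf sg mu a r 0) (tau sg mu a) ltac:(lra) E1 E2) as (HF & HR).
  pose proof (gamma2_saddle sg mu a r Ha ltac:(lra) Hv (proj1 HF)) as Hg.
  exists r. repeat split; auto; try lra. now rewrite Hg.
Qed.

Lemma gamma2_near (sg mu e : R) : admissible sg mu -> 0 < e ->
  exists t, 0 < t /\ forall a, tau sg mu a <> 0 -> Rabs (tau sg mu a) < t ->
    Rabs (gamma2 (branch sg) (Rabs mu) a / (tau sg mu a / Rpower (cubic mu) (1 / 3)) - 1) <= e.
Proof.
  intros Ha He.
  destruct (stationary_structure sg mu 1 e Ha ltac:(lra) He) as [t1 [Ht1 K1]].
  destruct (saddle_structure sg mu 1 e Ha ltac:(lra) He) as [t2 [Ht2 K2]].
  exists (Rmin t1 t2). split; [now apply Rmin_pos|]. intros a Hn Ht.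
  pose proof (Rmin_l t1 t2). pose proof (Rmin_r t1 t2). apply Rabs_def2 in Ht.
  destruct (Rlt_dec (tau sg mu a) 0).
  - destruct (K1 a ltac:(lra)) as (s0 & _ & _ & _ & _ & _ & H'). exact H'.
  - destruct (K2 a ltac:(lra)) as (r & _ & _ & _ & _ & _ & H'). exact H'.
Qed.

Lemma tau_abs (sg mu a : R) : admissible sg mu -> Rabs (tau sg mu a) = Rabs (a - slope_max mu).
Proof.
  intros Ha. unfold tau. rewrite Rabs_mult, Rabs_minus_sym.
  rewrite (admissible_sg_abs _ _ Ha). ring.
Qed.

Lemma gamma2_is_lim (sg mu : R) : admissible sg mu ->
  is_lim (fun a => gamma2 (branch sg) (Rabs mu) a / (tau sg mu a / Rpower (cubic mu) (1 / 3)))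
    (slope_max mu) 1.
Proof.
  intros Ha. apply is_lim_spec. intros e. pose proof (cond_pos e) as He.
  destruct (gamma2_near sg mu (e / 2) Ha ltac:(lra)) as [t [Ht K]].
  exists (mkposreal t Ht). intros a Hball Hne.
  apply Rle_lt_trans with (e / 2); [|lra]. apply K.
  - intros Hz. apply Hne. pose proof (tau_abs sg mu a Ha) as E. rewrite Hz, Rabs_R0 in E.
    symmetry in E. apply Rabs_eq_0_inv in E. lra.
  - rewrite tau_abs by auto. exact Hball.
Qed.

Lemma Delta_abs (sg mu a : R) : admissible sg mu ->
  Rabs (Defs.Delta (Rabs mu) a) = Rabs (tau sg mu a) * Rabs (/ slope_max mu - a).
Proof.
  intros Ha. rewrite <- Rabs_mult.
  assert (E : Defs.Delta (Rabs mu) a = - (sg * tau sg mu a) * (/ slope_max mu - a)).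
  { unfold Defs.Delta, alpha0, tau, slope_max. destruct Ha as [[-> Hmu]|[-> Hmu]].
    - rewrite Rabs_left by lra. field. lra.
    - rewrite Rabs_pos_eq by lra. field. lra. }
  rewrite E, !Rabs_mult, Rabs_Ropp, Rabs_mult.
  rewrite (admissible_sg_abs _ _ Ha). ring.
Qed.

(** * The amplitude near coalescence *)

Definition famp (sg mu a : R) : R :=
  sqrt (2 / a) * gamma_Delta_factor (branch sg) (Rabs mu) a.

Lemma sqrt_Rpower (x : R) : 0 < x -> sqrt x = Rpower x (1 / 2).
Proof. intros Hx. rewrite <- Rpower_sqrt by auto. f_equal. field. Qed.

(** This identity makes [cubic^(- 1 / 3)] the value of the amplitude at the coalescence. *)
Lemma slope_max_gap (sg mu : R) : admissible sg mu ->
  / slope_max mu - slope_max mu <> 0 /\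
  Rabs (/ slope_max mu - slope_max mu) = 4 * cubic mu / slope_max mu ^ 2.
Proof.
  intros Ha. destruct (admissible_bounds _ _ Ha) as (H1 & H2 & H3 & H4).
  assert (E : Rabs (/ slope_max mu - slope_max mu) = 4 * cubic mu / slope_max mu ^ 2).
  { unfold slope_max, cubic. destruct Ha as [[-> Hmu]|[-> Hmu]].
    - replace (/ ((1 + mu) / (1 - mu)) - (1 + mu) / (1 - mu))
        with (- 4 * mu / ((1 + mu) * (1 - mu))) by (field; lra).
      rewrite Rabs_pos_eq by (apply Rdiv_le_0_compat; nra).
      rewrite Rabs_left by lra. field. lra.
    - replace (/ ((1 + mu) / (1 - mu)) - (1 + mu) / (1 - mu))
        with (- (4 * mu / ((1 + mu) * (1 - mu)))) by (field; lra).
      rewrite Rabs_Ropp, Rabs_pos_eq by (apply Rdiv_le_0_compat; nra).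
      rewrite Rabs_pos_eq by lra. field. lra. }
  split; auto. intros Z. rewrite Z, Rabs_R0 in E.
  assert (0 < 4 * cubic mu / slope_max mu ^ 2) by pos. lra.
Qed.

(** In [(|gamma^2| / |Delta|)^(1/4)] both quantities are proportional to [tau], to leading
    order. *)
Lemma quotient_is_lim (sg mu : R) : admissible sg mu ->
  is_lim (gamma_Delta_quotient (branch sg) (Rabs mu)) (slope_max mu)
    (Rpower (1 * (/ Rpower (cubic mu) (1 / 3) / Rabs (/ slope_max mu - slope_max mu))) (1 / 4)).
Proof.
  intros Ha. destruct (admissible_bounds _ _ Ha) as (H1 & H2 & H3 & H4).
  set (A := slope_max mu) in *.
  set (k := / Rpower (cubic mu) (1 / 3)).
  assert (Hk : 0 < k) by (unfold k; pos).
  destruct (slope_max_gap sg mu Ha) as [HA1 _]. fold A in HA1.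
  set (g := fun a => gamma2 (branch sg) (Rabs mu) a / (tau sg mu a / Rpower (cubic mu) (1 / 3))).
  assert (L1 : is_lim (fun a => g a * (k / Rabs (/ A - a))) A (1 * (k / Rabs (/ A - A)))).
  { apply (is_lim_mult g (fun a => k / Rabs (/ A - a)) A 1 (k / Rabs (/ A - A))).
    - exact (gamma2_is_lim sg mu Ha).
    - apply (is_lim_continuity (fun a => k / Rabs (/ A - a)) A). apply continuity_pt_filterlim.
      apply (continuous_mult (fun _ => k) (fun a => / Rabs (/ A - a))).
      + apply continuous_const.
      + apply continuous_Rinv_comp.
        * apply (continuous_comp (fun a => / A - a) Rabs).
          -- apply (is_derive_continuous _ _ (-1)). derivative.
          -- apply continuous_Rabs.
        * now apply Rabs_no_R0.
    - simpl. auto. }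
  assert (Hl : 0 < 1 * (k / Rabs (/ A - A))).
  { rewrite Rmult_1_l. apply Rdiv_lt_0_compat; auto. now apply Rabs_pos_lt. }
  apply (is_lim_ext_loc (fun a => Rpower (g a * (k / Rabs (/ A - a))) (1 / 4))).
  - destruct (gamma2_near sg mu (1 / 2) Ha ltac:(lra)) as [t [Ht K]].
    assert (Hd : 0 < Rmin t (Rabs (/ A - A))) by (apply Rmin_pos; auto; now apply Rabs_pos_lt).
    exists (mkposreal _ Hd). intros a Hball Hne.
    change (Rabs (a - A) < Rmin t (Rabs (/ A - A))) in Hball.
    assert (Hb1 : Rabs (a - A) < t) by (eapply Rlt_le_trans; [exact Hball|apply Rmin_l]).
    assert (Hb2 : Rabs (a - A) < Rabs (/ A - A)) by (eapply Rlt_le_trans; [exact Hball|apply Rmin_r]).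
    assert (Hn : / A - a <> 0).
    { intros Hz. replace (a - A) with (/ A - A) in Hb2 by lra. lra. }
    assert (Hpn : 0 < Rabs (/ A - a)) by now apply Rabs_pos_lt.
    pose proof (tau_abs sg mu a Ha) as Ht2. fold A in Ht2.
    assert (Ht3 : tau sg mu a <> 0).
    { intros Hz. rewrite Hz, Rabs_R0 in Ht2. symmetry in Ht2.
      apply (Rabs_no_R0 (a - A)); auto. intros Hz2. apply Hne. simpl in *; lra. }
    specialize (K a Ht3 ltac:(rewrite Ht2; auto)). fold (g a) in K. apply Rabs_le_between in K.
    assert (Hg : 0 < g a) by lra.
    assert (HT : 0 < Rabs (tau sg mu a)) by now apply Rabs_pos_lt.
    assert (Hc : 0 < Rpower (cubic mu) (1 / 3)) by apply exp_pos.
    assert (HG : Rabs (gamma2 (branch sg) (Rabs mu) a) = g a * (Rabs (tau sg mu a) * k)).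
    { replace (gamma2 (branch sg) (Rabs mu) a) with (g a * (tau sg mu a * k)) by (unfold g, k; field; lra).
      rewrite !Rabs_mult, (Rabs_pos_eq (g a)), (Rabs_pos_eq k); lra. }
    unfold gamma_Delta_quotient, gamma_abs. rewrite HG, (Delta_abs sg) by auto. fold A.
    set (T := Rabs (tau sg mu a)) in *. set (D := Rabs (/ A - a)) in *.
    assert (P : 0 < g a * (T * k)) by (apply Rmult_lt_0_compat; auto; now apply Rmult_lt_0_compat).
    rewrite (sqrt_Rpower (g a * (T * k))), sqrt_Rpower, Rpower_mult by (auto; apply exp_pos).
    replace (1 / 2 * (1 / 2)) with (1 / 4) by field.
    replace (g a * (T * k)) with (g a * (k / D) * (T * D)) by (field; lra).
    rewrite <- (Rpower_mult_distr (g a * (k / D)) (T * D)).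
    + field. apply Rgt_not_eq, exp_pos.
    + apply Rmult_lt_0_compat; auto. now apply Rdiv_lt_0_compat.
    + now apply Rmult_lt_0_compat.
  - apply (is_lim_comp_continuous (fun a => g a * (k / Rabs (/ A - a))) (fun y => Rpower y (1 / 4))
      A (1 * (k / Rabs (/ A - A)))); auto.
    unfold Rpower. apply continuous_exp_comp.
    apply (continuous_scal_r (V := R_NormedModule) (1 / 4) ln).
    apply (is_derive_continuous _ _ _ (is_derive_ln _ Hl)).
Qed.

(** At the coalescence itself the quotient is by definition its limit, so the neighbourhood may
    contain that point. *)
Lemma famp_near (sg mu e : R) : admissible sg mu -> 0 < e ->
  exists t, 0 < t /\ forall a, Rabs (a - slope_max mu) < t ->
    Rabs (famp sg mu a - / Rpower (cubic mu) (1 / 3)) <= e.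
Proof.
  intros Ha He. destruct (admissible_bounds _ _ Ha) as (H1 & H2 & H3 & H4).
  pose proof (quotient_is_lim sg mu Ha) as HL.
  set (A := slope_max mu) in *. set (k := / Rpower (cubic mu) (1 / 3)) in *.
  assert (Hk : 0 < k) by (unfold k; pos).
  destruct (slope_max_gap sg mu Ha) as [HA1 E4]. fold A in HA1, E4.
  assert (HA1' : 0 < Rabs (/ A - A)) by now apply Rabs_pos_lt.
  set (L0 := Rpower (1 * (k / Rabs (/ A - A))) (1 / 4)) in *.
  assert (HK : sqrt (2 / A) * L0 = k).
  { assert (HA2 : 0 < 2 / A) by pos.
    assert (E5 : sqrt (2 / A) = Rpower ((2 / A) ^ 2) (1 / 4)).
    { rewrite sqrt_Rpower by auto. rewrite <- (Rpower_pow 2) by auto. rewrite Rpower_mult.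
      f_equal. simpl. field. }
    assert (Hlk : 0 < 1 * (k / Rabs (/ A - A))).
    { rewrite Rmult_1_l. apply Rdiv_lt_0_compat; auto. }
    unfold L0. rewrite E5, Rpower_mult_distr by (auto; apply pow_lt; auto).
    rewrite E4.
    replace ((2 / A) ^ 2 * (1 * (k / (4 * cubic mu / A ^ 2)))) with (k * / cubic mu) by (field; lra).
    replace (/ cubic mu) with (k ^ 3).
    - replace (k * k ^ 3) with (k ^ 4) by ring.
      rewrite <- (Rpower_pow 4) by auto. rewrite Rpower_mult.
      replace (INR 4 * (1 / 4)) with 1 by (simpl; field). now rewrite Rpower_1.
    - unfold k. rewrite pow_inv, Rpower_third_cube; auto. }
  assert (HL2 : is_lim (fun a => sqrt (2 / a) * gamma_Delta_quotient (branch sg) (Rabs mu) a) A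
                  (sqrt (2 / A) * L0)).
  { apply (is_lim_mult (fun a => sqrt (2 / a)) _ A (sqrt (2 / A)) L0); auto.
    - apply (is_lim_continuity (fun a => sqrt (2 / a)) A), continuity_pt_filterlim.
      apply (continuous_comp (fun a => 2 / a) sqrt).
      + apply (is_derive_continuous _ _ (- 2 / A ^ 2)). auto_derive; [lra|]. field. lra.
      + apply continuous_sqrt.
    - simpl. auto. }
  rewrite HK in HL2. apply is_lim_spec in HL2. destruct (HL2 (mkposreal e He)) as [d Hd].
  assert (Hmin : 0 < Rmin d (Rabs (/ A - A))) by (apply Rmin_pos; auto; apply cond_pos).
  exists (Rmin d (Rabs (/ A - A))). split; auto. intros a Hball.
  assert (Hb1 : Rabs (a - A) < d) by (eapply Rlt_le_trans; [exact Hball|apply Rmin_l]).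
  assert (Hb2 : Rabs (a - A) < Rabs (/ A - A)) by (eapply Rlt_le_trans; [exact Hball|apply Rmin_r]).
  pose proof (Delta_abs sg mu a Ha) as HD. rewrite (tau_abs sg mu a Ha) in HD. fold A in HD.
  unfold famp, gamma_Delta_factor.
  destruct (Req_dec a A) as [->|Hne].
  - rewrite Rminus_eq_0, Rabs_R0, Rmult_0_l in HD.
    destruct (Req_EM_T (Defs.Delta (Rabs mu) A) 0) as [Z|Z];
      [|exfalso; now apply (Rabs_no_R0 _ Z)].
    rewrite (is_lim_unique _ _ _ HL). simpl. rewrite HK, Rminus_eq_0, Rabs_R0. lra.
  - destruct (Req_EM_T (Defs.Delta (Rabs mu) a) 0) as [Z|Z].
    + exfalso. rewrite Z, Rabs_R0 in HD. symmetry in HD. apply Rmult_integral in HD.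
      destruct HD as [HD|HD].
      * apply Rabs_eq_0_inv in HD. lra.
      * apply Rabs_eq_0_inv in HD. replace (a - A) with (/ A - A) in Hb2 by lra. lra.
    + left. apply (Hd a); auto.
Qed.

Lemma famp_curvature (sg mu a : R) :
  0 < a -> Defs.Delta (Rabs mu) a <> 0 -> gamma2 (branch sg) (Rabs mu) a <> 0 ->
  famp sg mu a = sqrt (2 * sqrt (Rabs (gamma2 (branch sg) (Rabs mu) a))
                       / (a * sqrt (Rabs (Defs.Delta (Rabs mu) a)))).
Proof.
  intros Ha HD Hg. unfold famp, gamma_Delta_factor.
  destruct (Req_EM_T (Defs.Delta (Rabs mu) a) 0) as [Z|_]; [contradiction|].
  unfold gamma_Delta_quotient, gamma_abs.
  set (g := Rabs (gamma2 (branch sg) (Rabs mu) a)). set (D := Rabs (Defs.Delta (Rabs mu) a)).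
  assert (Pg : 0 < g) by now apply Rabs_pos_lt. assert (PD : 0 < D) by now apply Rabs_pos_lt.
  assert (Sg : 0 < sqrt g) by now apply sqrt_lt_R0. assert (SD : 0 < sqrt D) by now apply sqrt_lt_R0.
  assert (E : Rpower D (1 / 4) = sqrt (sqrt D)).
  { rewrite (sqrt_Rpower D), sqrt_Rpower, Rpower_mult by (auto; apply exp_pos). f_equal. field. }
  assert (P2 : 0 < 2 / a) by (apply Rdiv_lt_0_compat; lra).
  assert (P3 : 0 < sqrt g / sqrt D) by now apply Rdiv_lt_0_compat.
  rewrite E, <- sqrt_div, <- sqrt_mult by lra.
  f_equal. field. lra.
Qed.

(** Here [r^2] is the modulus of the argument of the Airy function, [b^2] is [n] times the second
    derivative [B] of the phase of the coefficient, and [bA^2 = 2 r] is that of the phase of the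
    Airy integral at its own critical points. The value of a phase integral at a nondegenerate
    critical point scales as the inverse square root of the second derivative, so this is the
    reason for the shape of the amplitude. *)
Lemma amplitude_ratio (sg mu a n F B r bA b : R) :
  0 < n -> 0 < a -> 0 < F -> 0 < B -> Defs.Delta (Rabs mu) a <> 0 ->
  Rabs (gamma2 (branch sg) (Rabs mu) a) = Rpower (3 / 2 * F) (2 / 3) ->
  B = a * sqrt (Rabs (Defs.Delta (Rabs mu) a)) ->
  r = Rpower n (1 / 3) * Rpower (3 / 2 * F) (1 / 3) ->
  0 < bA -> bA ^ 2 = 2 * r -> 0 < b -> b ^ 2 = n * B ->
  famp sg mu a / Rpower n (1 / 3) = bA / b /\
  r ^ 3 = 3 / 2 * (n * F) /\ 0 < r /\
  Rpower n (2 / 3) * Rabs (gamma2 (branch sg) (Rabs mu) a) = r ^ 2.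
Proof.
  intros Hn Ha HF HB HD Hg HBD Hr HbA HbA2 Hb Hb2.
  set (G := Rpower (3 / 2 * F) (1 / 3)) in *. set (m := Rpower n (1 / 3)) in *.
  assert (PG : 0 < G) by apply exp_pos. assert (Pm : 0 < m) by apply exp_pos.
  assert (Hm3 : m ^ 3 = n) by now apply Rpower_third_cube.
  assert (HG3 : G ^ 3 = 3 / 2 * F) by (apply Rpower_third_cube; lra).
  assert (Hg2 : Rabs (gamma2 (branch sg) (Rabs mu) a) = G ^ 2) by (rewrite Hg; apply Rpower_third_sqr).
  assert (Hgn : gamma2 (branch sg) (Rabs mu) a <> 0).
  { intros Z. rewrite Z, Rabs_R0 in Hg2. nra. }
  split; [|split; [|split]].
  - rewrite famp_curvature, <- HBD, Hg2, sqrt_pow2 by (auto; lra).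
    assert (Hsq : sqrt (2 * G / B) = bA / b * m).
    { apply Rsqr_inj; [apply sqrt_pos| |].
      - apply Rlt_le, Rmult_lt_0_compat; auto. now apply Rdiv_lt_0_compat.
      - rewrite Rsqr_sqrt by (apply Rlt_le, Rdiv_lt_0_compat; lra).
        unfold Rsqr. replace (bA / b * m * (bA / b * m)) with (bA ^ 2 * m ^ 2 / b ^ 2) by (field; lra).
        rewrite HbA2, Hb2, Hr, <- Hm3. field. split; lra. }
    rewrite Hsq. field. lra.
  - rewrite Hr. replace ((m * G) ^ 3) with (m ^ 3 * G ^ 3) by ring. rewrite Hm3, HG3. field.
  - rewrite Hr. now apply Rmult_lt_0_compat.
  - rewrite Hg2, Rpower_third_sqr. fold m. rewrite Hr. ring.
Qed.

(** * The regimes of the Airy argument *)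

Definition xarg (sg mu n a : R) : R := Rpower n (2 / 3) * gamma2 (branch sg) (Rabs mu) a.
Definition amp (sg mu n a : R) : R := famp sg mu a / Rpower n (1 / 3).

(** Once the Airy argument exceeds [1 + Y^2 / q], both the coefficient and the Airy integral have
    their critical point at a distance of at least [Y] widths [1 / b], resp. [1 / bA], from the point
    of coalescence. *)
Lemma far_scales (sg mu a n F B s0 k Y : R) :
  0 < cubic mu -> 0 < n -> 0 < a -> 0 < s0 -> 0 < F <= cubic mu * s0 ^ 3 -> 0 < k -> k * s0 <= B ->
  Defs.Delta (Rabs mu) a <> 0 ->
  Rabs (gamma2 (branch sg) (Rabs mu) a) = Rpower (3 / 2 * F) (2 / 3) ->
  B = a * sqrt (Rabs (Defs.Delta (Rabs mu) a)) ->
  0 < Y -> 1 + Y ^ 2 / Rmin (2 * k / (3 * cubic mu)) 2 <= Rabs (xarg sg mu n a) ->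
  exists r bA b, 1 <= r /\ 0 < bA /\ 0 < b /\ bA ^ 2 = 2 * r /\ b ^ 2 = n * B /\
    r ^ 3 = 3 / 2 * (n * F) /\ amp sg mu n a = bA / b /\ Rabs (xarg sg mu n a) = r ^ 2 /\
    Y <= bA * r /\ Y <= b * s0.
Proof.
  intros Hc Hn Ha0 Hs0 HF Hk HkB HD Hgabs HB HY HM.
  set (c := cubic mu) in *. set (q := Rmin (2 * k / (3 * c)) 2) in *.
  pose proof (Rmin_l (2 * k / (3 * c)) 2) as Hq1. pose proof (Rmin_r (2 * k / (3 * c)) 2) as Hq2.
  fold q in Hq1, Hq2.
  assert (Hq : 0 < q) by (unfold q; pos).
  assert (Hks : 0 < k * s0) by pos.
  assert (HB0 : 0 < B) by lra.
  set (r := Rpower n (1 / 3) * Rpower (3 / 2 * F) (1 / 3)).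
  assert (Hr0 : 0 < r) by (unfold r; pos).
  assert (Hnc : 0 < n * B) by pos.
  exists r, (sqrt (2 * r)), (sqrt (n * B)).
  set (b := sqrt (n * B)). set (bA := sqrt (2 * r)).
  assert (Hb : 0 < b) by now apply sqrt_lt_R0.
  assert (HbA : 0 < bA) by (apply sqrt_lt_R0; lra).
  assert (Hb2 : b ^ 2 = n * B) by (apply pow2_sqrt; lra).
  assert (HbA2 : bA ^ 2 = 2 * r) by (apply pow2_sqrt; lra).
  destruct (amplitude_ratio sg mu a n F B r bA b Hn Ha0 (proj1 HF) HB0 HD Hgabs HB
    eq_refl HbA HbA2 Hb Hb2) as (Hamp & Hr3 & _ & Hx).
  assert (Hxr : Rabs (xarg sg mu n a) = r ^ 2).
  { unfold xarg. rewrite <- Hx, Rabs_mult, (Rabs_pos_eq (Rpower n (2 / 3))); auto.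
    left. apply exp_pos. }
  rewrite Hxr in HM. assert (HYq : 0 < Y ^ 2 / q) by pos.
  assert (Hr1 : 1 <= r) by nra.
  assert (Hr23 : r ^ 2 <= r ^ 3) by nra.
  assert (HYr : Y ^ 2 <= q * r ^ 3).
  { apply Rle_trans with (q * (Y ^ 2 / q)); [right; field; lra|].
    apply Rmult_le_compat_l; lra. }
  assert (sqle : forall z, 0 < z -> q * r ^ 3 <= z ^ 2 -> Y <= z).
  { intros z Hz Hzz. destruct (Rle_dec Y z); auto. exfalso. nra. }
  assert (Hr3p : 0 < r ^ 3) by pos.
  repeat (split; [assumption|]). split.
  - apply sqle; [pos|]. rewrite Rpow_mult_distr, HbA2.
    replace (2 * r * r ^ 2) with (2 * r ^ 3) by ring. apply Rmult_le_compat_r; lra.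
  - apply sqle; [pos|]. rewrite Rpow_mult_distr, Hb2.
    apply Rle_trans with (2 * k / (3 * c) * r ^ 3); [apply Rmult_le_compat_r; lra|].
    rewrite Hr3.
    replace (2 * k / (3 * c) * (3 / 2 * (n * F))) with (n * (k / c * F)) by (field; lra).
    rewrite Rmult_assoc. apply Rmult_le_compat_l; [lra|].
    apply Rle_trans with (k / c * (c * s0 ^ 3)).
    + apply Rmult_le_compat_l; [pos|lra].
    + replace (k / c * (c * s0 ^ 3)) with (k * s0 * s0 ^ 2) by (field; lra).
      apply Rmult_le_compat_r; [apply pow2_ge_0|lra].
Qed.

(** For Airy arguments towards minus infinity: stationary phase gives the coefficient and the Airy
    function as the same Fresnel integral, with the same phase value [2/3 r^3], divided by their
    scales [b] and [bA]. *)
Lemma far_oscillatory (sg mu : R) : admissible sg mu ->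
  exists t, 0 < t /\ forall e, 0 < e -> exists M, 0 < M /\ forall n a, 0 < n ->
    - t < tau sg mu a < 0 -> M <= Rabs (xarg sg mu n a) ->
    0 < amp sg mu n a /\ xarg sg mu n a < 0 /\
    Rabs (phase_integral sg mu a n - amp sg mu n a * (PI * Airy (xarg sg mu n a)))
      <= e * (amp sg mu n a * Rpower (1 + Rabs (xarg sg mu n a)) (- (1 / 4))).
Proof.
  intros Ha. destruct (admissible_bounds _ _ Ha) as (_ & _ & Hc & _).
  destruct (stationary_structure sg mu 1 1 Ha ltac:(lra) ltac:(lra)) as [t [Ht Hst]].
  exists t. split; auto. intros e He.
  destruct (oscillatory_regime _ _ Ha) as [K [HK Hosc]].
  destruct (curv_lower _ _ Ha) as [k [Hk Hlow]].
  set (c := cubic mu) in *.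
  (* of the two errors 8 / W each is a quarter of the allowance *)
  set (W := 32 / e). assert (HW : 0 < W) by (unfold W; pos).
  assert (HW4 : 0 < W ^ 4) by pos.
  assert (HY3 : 0 < 4 * (K + 1) * W ^ 4 / e) by pos.
  set (Y := 2 * W + 2 * K * W + 4 * (K + 1) * W ^ 4 / e).
  assert (HKW : 0 < K * W) by pos.
  assert (HY : 0 < Y) by (unfold Y; lra).
  exists (1 + Y ^ 2 / Rmin (2 * k / (3 * c)) 2).
  split; [assert (0 < Y ^ 2 / Rmin (2 * k / (3 * c)) 2) by pos; lra|]. intros n a Hn Hta HM.
  destruct (Hst a Hta) as (s0 & Hs0 & Hs1 & Hv & HF & Hg & _).
  destruct (curv_Delta sg mu a s0 Ha ltac:(lra) Hv) as (Ha0 & HD & HB).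
  set (F := - vf sg mu a 0 s0) in *.
  assert (Hgabs : Rabs (gamma2 (branch sg) (Rabs mu) a) = Rpower (3 / 2 * F) (2 / 3)).
  { rewrite Hg, Rabs_Ropp. apply Rabs_pos_eq. left; apply exp_pos. }
  destruct (far_scales sg mu a n F (curv mu s0) s0 k Y Hc Hn Ha0 (proj1 Hs0) HF Hk
    (Hlow s0 ltac:(lra)) HD Hgabs HB HY HM)
    as (r & bA & b & Hr1 & HbA & Hb & HbA2 & Hb2 & Hr3 & Hampb & Hxabs & HbAr & Hbs).
  assert (Hr0 : 0 < r) by lra.
  assert (Hx0 : xarg sg mu n a < 0).
  { unfold xarg. rewrite Hg. assert (0 < Rpower n (2 / 3) * Rpower (3 / 2 * F) (2 / 3)) by pos. lra. }
  assert (Hxr : xarg sg mu n a = - r ^ 2) by (rewrite Rabs_left in Hxabs; lra).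
  pose proof (Hosc a n s0 b W Hn ltac:(lra) Hv Hb Hb2 HW ltac:(unfold Y in *; lra)
    ltac:(unfold Y in *; lra)) as O1.
  pose proof (airy_oscillatory r bA W Hr0 HbA HbA2 HW ltac:(unfold Y in *; lra)) as O2.
  replace (n * vf sg mu a 0 s0) with (- (2 / 3 * r ^ 3)) in O1 by (rewrite Hr3; unfold F; field).
  set (J := fresnel W (- (2 / 3 * r ^ 3))) in *.
  assert (Hib : 0 < / b) by pos.
  split; [rewrite Hampb; pos|].
  split; [exact Hx0|].
  rewrite Hampb, Hxr.
  set (P := phase_integral sg mu a n) in *. set (Z := PI * Airy (- r ^ 2)) in *.
  assert (T1 : 2 * K * W ^ 4 / (b * s0) <= 2 * K * W ^ 4 / Y).
  { unfold Rdiv. apply Rmult_le_compat_l; [pos|]. apply Rinv_le_contravar; lra. }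
  assert (T2 : 2 * 1 * W ^ 4 / (bA * r) <= 2 * 1 * W ^ 4 / Y).
  { unfold Rdiv. apply Rmult_le_compat_l; [lra|]. apply Rinv_le_contravar; lra. }
  assert (T3 : 2 * K * W ^ 4 / Y + 2 * 1 * W ^ 4 / Y <= e / 2).
  { replace (2 * K * W ^ 4 / Y + 2 * 1 * W ^ 4 / Y) with (e / 2 * (4 * (K + 1) * W ^ 4 / e) * / Y)
      by (field; lra).
    apply Rmult_le_reg_r with Y; auto. rewrite Rmult_assoc, Rinv_l, Rmult_1_r by lra.
    apply Rmult_le_compat_l; [lra|]. unfold Y; lra. }
  assert (T4 : 8 / W = e / 4) by (unfold W; field; lra).
  assert (T5 : Rabs (P - bA / b * Z) <= / b * e).
  { replace (P - bA / b * Z) with ((P - / b * J) - / b * (bA * (Z - / bA * J))) by (field; lra).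
    assert (O3 : Rabs (bA * (Z - / bA * J)) <= 8 / W + 2 * 1 * W ^ 4 / (bA * r)).
    { apply Rle_trans with (bA * (/ bA * (8 / W + 2 * 1 * W ^ 4 / (bA * r)))).
      - apply Rabs_scal_le; lra.
      - right. field. lra. }
    eapply Rle_trans; [apply Rabs_triang|]. rewrite Rabs_Ropp, (Rabs_mult (/ b)), (Rabs_pos_eq (/ b)) by lra.
    apply Rle_trans with (/ b * (8 / W + 2 * K * W ^ 4 / (b * s0))
                          + / b * (8 / W + 2 * 1 * W ^ 4 / (bA * r))).
    - apply Rplus_le_compat; auto. apply Rmult_le_compat_l; lra.
    - rewrite <- Rmult_plus_distr_l. apply Rmult_le_compat_l; lra. }
  eapply Rle_trans; [exact T5|].
  assert (T6 : / bA <= Rpower (1 + Rabs (- r ^ 2)) (- (1 / 4))).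
  { rewrite Rabs_Ropp, Rabs_pos_eq by apply pow2_ge_0.
    rewrite Rpower_Ropp. apply Rinv_le_contravar; [apply exp_pos|].
    rewrite <- (sqrt_pow2 bA), HbA2, sqrt_Rpower by lra.
    replace (Rpower (2 * r) (1 / 2)) with (Rpower ((2 * r) ^ 2) (1 / 4)).
    - pose proof (pow_R1_Rle r 2 Hr1). apply Rle_Rpower_l; [lra|].
      replace ((2 * r) ^ 2) with (4 * r ^ 2) by ring. lra.
    - rewrite <- (Rpower_pow 2), Rpower_mult by lra. f_equal. simpl. field. }
  rewrite (Rmult_comm (/ b)). apply Rmult_le_compat_l; [lra|].
  apply Rle_trans with (bA / b * / bA); [right; field; lra|].
  apply Rmult_le_compat_l; [pos|auto].
Qed.

Lemma half_gauss_lower (W : R) : 1 <= W -> exp (- (1 / 2)) <= half_gauss W.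
Proof.
  intros HW. unfold half_gauss.
  pose proof continuous_half_gauss as Hg.
  rewrite (RInt_split _ 0 1 W) by auto.
  set (f := fun v => exp (- (v ^ 2 / 2))).
  assert (H1 : exp (- (1 / 2)) * 1 - exp (- (1 / 2)) * 0 <= RInt f 0 1 - RInt f 0 0).
  { apply (derive_le (fun y => exp (- (1 / 2)) * y) (fun y => RInt f 0 y)
      (fun _ => exp (- (1 / 2))) f); try lra.
    - intros; derivative.
    - intros; now apply is_derive_RInt_upper.
    - intros x Hx. apply exp_le. nra. }
  assert (H2 : 0 * W - 0 * 1 <= RInt f 1 W - RInt f 1 1).
  { apply (derive_le (fun y => 0 * y) (fun y => RInt f 1 y) (fun _ => 0) f); try lra.
    - intros; derivative.
    - intros; now apply is_derive_RInt_upper.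
    - intros x Hx. left; apply exp_pos. }
  rewrite !RInt_point in *. unfold zero in *; simpl in *. lra.
Qed.

(** For Airy arguments towards plus infinity: Laplace's method on the contours through the saddle
    points gives [exp (2/3 r^3)] times the coefficient and the Airy function as the same Gaussian
    integral, divided by [b] and [bA]. That integral is bounded below, so that the estimate is
    relative to the value of the Airy function, whose positivity is part of the conclusion. *)
Lemma far_saddle (sg mu : R) : admissible sg mu ->
  exists t, 0 < t /\ forall e, 0 < e -> exists M, 0 < M /\ forall n a, 0 < n ->
    0 < tau sg mu a < t -> sin (n * (sg * ((1 - a) * PI))) = 0 -> M <= Rabs (xarg sg mu n a) ->
    0 < amp sg mu n a /\ 0 < xarg sg mu n a /\ 0 < PI * Airy (xarg sg mu n a) /\
    Rabs (phase_integral sg mu a n - amp sg mu n a * (PI * Airy (xarg sg mu n a)))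
      <= e * (amp sg mu n a * (PI * Airy (xarg sg mu n a))).
Proof.
  intros Ha. destruct (admissible_bounds _ _ Ha) as (_ & _ & Hc & _).
  pose proof (admissible_abs _ _ Ha) as Hm.
  destruct (saddle_structure sg mu 1 1 Ha ltac:(lra) ltac:(lra)) as [t [Ht Hst]].
  exists t. split; auto. intros e He.
  destruct (saddle_regime _ _ Ha) as [C [k1 [HC [Hk1 Hsad]]]].
  destruct (curvh_lower _ _ Ha) as [k [Hk Hlow]].
  set (c := cubic mu) in *.
  set (g1 := exp (- (1 / 2))). assert (Hg1 : 0 < g1) by apply exp_pos.
  set (e' := Rmin (g1 / 2) (e * g1 / 4)).
  assert (He' : 0 < e') by (unfold e'; pos).
  assert (He1 : e' <= g1 / 2) by apply Rmin_l. assert (He2 : e' <= e * g1 / 4) by apply Rmin_r.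
  assert (Hik1 : 0 < / k1) by pos.
  assert (HW1 : 0 < 2 / e' * (/ k1 + 2)) by pos.
  set (W := 1 + 2 / e' * (/ k1 + 2)).
  assert (HW : 1 <= W) by (unfold W; lra).
  assert (HW4 : 0 < W ^ 4) by pos.
  assert (HY3 : 0 < 2 * (C + 1) * W ^ 4 / e') by pos.
  set (Y := W + 2 * (C + 1) * W ^ 4 / e').
  assert (HY : 0 < Y) by (unfold Y; lra).
  exists (1 + Y ^ 2 / Rmin (2 * k / (3 * c)) 2).
  split; [assert (0 < Y ^ 2 / Rmin (2 * k / (3 * c)) 2) by pos; lra|]. intros n a Hn Hta Hsin HM.
  destruct (Hst a Hta) as (s0 & Hs0 & Hs1 & Hv & HF & Hg & _).
  destruct (curvh_Delta sg mu a s0 Ha ltac:(lra) Hv) as (Ha0 & HD & HB).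
  set (F := - uf sg mu a s0 0) in *.
  assert (Hgabs : Rabs (gamma2 (branch sg) (Rabs mu) a) = Rpower (3 / 2 * F) (2 / 3)).
  { rewrite Hg. apply Rabs_pos_eq. left; apply exp_pos. }
  destruct (far_scales sg mu a n F (curvh mu s0) s0 k Y Hc Hn Ha0 (proj1 Hs0) HF Hk
    (Hlow s0 ltac:(lra)) HD Hgabs HB HY HM)
    as (r & bA & b & Hr1 & HbA & Hb & HbA2 & Hb2 & Hr3 & Hampb & Hxabs & HbAr & Hbs).
  assert (Hr0 : 0 < r) by lra.
  assert (Hx0 : 0 < xarg sg mu n a) by (unfold xarg; rewrite Hg; pos).
  assert (Hxr : xarg sg mu n a = r ^ 2) by (rewrite Rabs_pos_eq in Hxabs; lra).
  pose proof PI2_3_2 as HPI.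
  assert (HWb : W <= b * PI).
  { assert (W <= Y) by (unfold Y; lra).
    assert (b * s0 <= b * PI) by (apply Rmult_le_compat_l; lra). lra. }
  pose proof (Hsad a n s0 b W Hn ltac:(lra) Hv Hsin Hb Hb2 ltac:(lra)) as O1.
  pose proof (airy_recessive r bA W Hr0 HbA HbA2 ltac:(lra)) as O2.
  replace (- (n * uf sg mu a s0 0)) with (2 / 3 * r ^ 3) in O1 by (rewrite Hr3; unfold F; field).
  set (S := exp (2 / 3 * r ^ 3)) in *. assert (HS : 0 < S) by apply exp_pos.
  pose proof (half_gauss_lower W HW) as HG. fold g1 in HG. set (G := half_gauss W) in *.
  assert (Hib : 0 < / b) by pos. assert (HibA : 0 < / bA) by pos.
  split; [rewrite Hampb; pos|].
  split; [exact Hx0|].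
  rewrite Hampb, Hxr.
  set (P := phase_integral sg mu a n) in *. set (Z := PI * Airy (r ^ 2)) in *.
  assert (HYe : (C + 1) * W ^ 4 / Y <= e' / 2).
  { replace ((C + 1) * W ^ 4 / Y) with (e' / 2 * (2 * (C + 1) * W ^ 4 / e') * / Y) by (field; lra).
    apply Rmult_le_reg_r with Y; auto. rewrite Rmult_assoc, Rinv_l, Rmult_1_r by lra.
    apply Rmult_le_compat_l; [lra|]. unfold Y; lra. }
  assert (HiY : 0 < / Y) by pos.
  assert (HWY : 0 < W ^ 4 * / Y) by pos.
  assert (T1 : C * W ^ 3 / (b * s0) * W <= e' / 2).
  { apply Rle_trans with ((C + 1) * W ^ 4 / Y); auto.
    replace (C * W ^ 3 / (b * s0) * W) with (C * W ^ 4 * / (b * s0)) by (field; lra).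
    unfold Rdiv. apply Rmult_le_compat; try pos.
    apply Rinv_le_contravar; lra. }
  assert (T2 : W ^ 3 / (3 * bA ^ 3) * W <= e' / 2).
  { apply Rle_trans with ((C + 1) * W ^ 4 / Y); auto.
    replace (W ^ 3 / (3 * bA ^ 3) * W) with (W ^ 4 * / (3 * (bA ^ 2 * bA))) by (field; lra).
    rewrite HbA2. unfold Rdiv. apply Rmult_le_compat; try pos.
    - rewrite <- (Rmult_1_l (W ^ 4)) at 1. apply Rmult_le_compat_r; lra.
    - apply Rinv_le_contravar; [lra|].
      replace (3 * (2 * r * bA)) with (6 * (bA * r)) by ring. lra. }
  assert (HiW : / W <= e' / 2 * / (/ k1 + 2)).
  { replace (e' / 2 * / (/ k1 + 2)) with (/ (2 / e' * (/ k1 + 2))).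
    - apply Rinv_le_contravar; [auto|unfold W; lra].
    - field. repeat split; try lra. }
  assert (HW3 : / W * (/ k1 + 2) <= e' / 2).
  { apply Rle_trans with (e' / 2 * / (/ k1 + 2) * (/ k1 + 2)); [apply Rmult_le_compat_r; lra|].
    rewrite Rmult_assoc, Rinv_l; lra. }
  assert (HiW0 : 0 < / W) by pos.
  assert (HWk : 0 < / W * / k1) by pos.
  assert (T3 : / (k1 * W) <= e' / 2) by (rewrite Rinv_mult; lra).
  assert (T4 : / (1 / 2 * W) <= e' / 2).
  { replace (/ (1 / 2 * W)) with (2 * / W) by (field; lra). lra. }
  assert (A1 : Rabs (b * (S * P) - G) <= e').
  { replace (b * (S * P) - G) with (b * (S * P - / b * G)) by (field; lra).
    apply Rle_trans with (b * (/ b * (C * W ^ 3 / (b * s0) * W + / (k1 * W)))).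
    - apply Rabs_scal_le; lra.
    - rewrite <- Rmult_assoc, Rinv_r; lra. }
  assert (A2 : Rabs (bA * (S * Z) - G) <= e').
  { replace (bA * (S * Z) - G) with (bA * (S * Z - / bA * G)) by (field; lra).
    apply Rle_trans with (bA * (/ bA * (W ^ 3 / (3 * bA ^ 3) * W + / (1 / 2 * W)))).
    - apply Rabs_scal_le; lra.
    - rewrite <- Rmult_assoc, Rinv_r; lra. }
  apply Rabs_le_between in A1. apply Rabs_le_between in A2.
  assert (HZ : g1 / 2 <= bA * (S * Z)) by lra.
  assert (HZ0 : 0 < Z).
  { destruct (Rlt_dec 0 Z); auto. exfalso.
    assert (HbS : 0 < bA * S) by pos.
    assert (0 <= bA * S * - Z) by (apply Rmult_le_pos; lra). lra. }
  split; auto.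
  replace (P - bA / b * Z) with (/ (b * S) * (b * (S * P) - bA * (S * Z))) by (field; lra).
  replace (e * (bA / b * Z)) with (/ (b * S) * (e * (bA * (S * Z)))) by (field; lra).
  apply Rabs_scal_le; [pos|].
  assert (e * (g1 / 2) <= e * (bA * (S * Z))) by (apply Rmult_le_compat_l; lra).
  apply Rabs_le. lra.
Qed.

Lemma airy_bounded (M : R) : 0 < M -> exists B, 0 < B /\ forall x, Rabs x <= M ->
  Rabs (PI * Airy x) <= B.
Proof.
  intros HM. exists (3 + M). split; [lra|]. intros x Hx. apply Rabs_le_between in Hx.
  pose proof (airy_remainder x (1 + M) 1 ltac:(lra) ltac:(split; nra)) as H.
  assert (H2 : Rabs (airy_trunc x (1 + M)) <= 1 * (1 + M) - 1 * 0).
  { apply (RInt_dominated _ (fun y => 1 * y) (fun _ => 1)); try lra.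
    - intros; apply continuous_airy_integrand.
    - intros; derivative.
    - intros y _. apply Rabs_le, COS_bound. }
  rabs.
Qed.

Lemma airy_lower_on (M : R) : 0 < M ->
  exists l, 0 < l /\ forall x, 0 <= x <= M -> l <= PI * Airy x.
Proof.
  intros HM.
  set (h := sqrt M). assert (Hh : 0 < h) by (apply sqrt_lt_R0; lra).
  set (lowA := (1 - cos (1 / 3)) * (10 / 64) * exp (- (h * 4) - 2 / 3 * h ^ 3)).
  assert (Hcos : 0 < 1 - cos (1 / 3)).
  { pose proof PI2_3_2. pose proof (cos_decreasing_1 0 (1 / 3)) as Hd. rewrite cos_0 in Hd. lra. }
  assert (HlowA : 0 < lowA) by (unfold lowA; pos).
  exists lowA. split; auto.
  intros x Hx. set (s := sqrt x).
  assert (Hs : 0 <= s <= h) by (split; [apply sqrt_pos|apply sqrt_le_1_alt; lra]).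
  assert (Hs2 : s ^ 2 = x) by (apply pow2_sqrt; lra).
  pose proof (airy_lower_bound s (proj1 Hs)) as HL. rewrite Hs2 in HL.
  set (S := exp (2 / 3 * s ^ 3)) in *. assert (HS : 0 < S) by apply exp_pos.
  apply Rmult_le_reg_l with S; auto. eapply Rle_trans; [|exact HL].
  unfold lowA. rewrite <- Rmult_assoc, (Rmult_comm S), !Rmult_assoc.
  apply Rmult_le_compat_l; [lra|]. apply Rmult_le_compat_l; [lra|].
  unfold S. rewrite <- exp_plus.
  assert (s ^ 3 <= h ^ 3) by (apply pow_incr; lra).
  apply exp_le. lra.
Qed.

(** While the Airy argument stays bounded, [tau] is of order [n^(-2/3)], so that [gamma^2] may be
    replaced by its linear part and the amplitude by its value at the coalescence. *)
Lemma near_transition (sg mu : R) : admissible sg mu ->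
  exists t, 0 < t /\ forall M e, 0 < M -> 0 < e -> exists N, 0 < N /\ forall n a, N <= n ->
    Rabs (tau sg mu a) < t -> Rabs (xarg sg mu n a) <= M ->
    0 < amp sg mu n a /\
    Rabs (phase_integral sg mu a n - amp sg mu n a * (PI * Airy (xarg sg mu n a)))
      <= e * amp sg mu n a.
Proof.
  intros Ha. destruct (admissible_bounds _ _ Ha) as (_ & _ & Hc & _).
  destruct (gamma2_near sg mu (1 / 2) Ha ltac:(lra)) as [t [Ht Hhalf]].
  exists t. split; auto. intros M e HM He.
  destruct (airy_bounded M HM) as [B [HB Hbd]].
  set (c3 := Rpower (cubic mu) (1 / 3)) in *. assert (Hc3 : 0 < c3) by apply exp_pos.
  set (e2 := e / 8). assert (He2 : 0 < e2) by (unfold e2; lra).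
  set (e3 := Rmin (/ (2 * c3)) (e / (4 * c3 * B))).
  assert (He3 : 0 < e3) by (unfold e3; pos).
  destruct (famp_near sg mu e3 Ha He3) as [t3 [Ht3 Hfamp]].
  assert (H8 : 0 < 8 / e2) by pos.
  set (L := 1 + 2 * M + 8 / e2).
  set (e1 := e2 / (4 * M * L ^ 2)).
  assert (HL : 1 <= L) by (unfold L; lra).
  assert (He1 : 0 < e1) by (unfold e1; pos).
  destruct (gamma2_near sg mu e1 Ha He1) as [t1 [Ht1 Hfine]].
  destruct (transition_regime sg mu (2 * M) e2 Ha ltac:(lra) He2) as [n0 [Hn0 Htr]].
  set (tm := Rmin t1 t3). assert (Htm : 0 < tm) by (unfold tm; pos).
  assert (HT : 0 < 2 * M * c3 / tm) by pos.
  (* this forces [|tau| < tm] when [n^(2/3) |tau| <= 2 M c3] *)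
  set (N1 := (1 + 2 * M * c3 / tm) ^ 3).
  assert (HN1 : 0 < N1) by (unfold N1; pos).
  exists (n0 + N1). split; [lra|]. intros n a Hn Hta Hx.
  assert (Hn' : 0 < n) by lra.
  set (m := Rpower n (1 / 3)). assert (Hm : 0 < m) by apply exp_pos.
  assert (Hm3 : m ^ 3 = n) by now apply Rpower_third_cube.
  assert (Hm2 : Rpower n (2 / 3) = m ^ 2) by apply Rpower_third_sqr.
  assert (Hm1 : 1 + 2 * M * c3 / tm <= m).
  { apply cube_le; [lra|]. fold N1. lra. }
  unfold xarg in *. rewrite Hm2 in *.
  set (ta := tau sg mu a) in *. set (g := gamma2 (branch sg) (Rabs mu) a) in *.
  set (y := m ^ 2 * (ta / c3)).
  assert (Hy : Rabs y <= 2 * M /\ Rabs (m ^ 2 * g - y) <= e1 * (2 * M) /\ Rabs ta < tm).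
  { destruct (Req_dec ta 0) as [Hz|Hz].
    - assert (Hg0 : g = 0) by now apply gamma2_coalescence.
      unfold y. rewrite Hg0, Hz. unfold Rdiv. rewrite Rmult_0_l, Rmult_0_r, Rminus_0_r, Rabs_R0.
      repeat split; try lra. apply Rmult_le_pos; lra.
    - set (rho := g / (ta / c3)).
      assert (Hrho : m ^ 2 * g = rho * y) by (unfold rho, y; field; split; lra).
      pose proof (Hhalf a Hz Hta) as K1. fold ta g rho in K1.
      rewrite Hrho in *. rewrite Rabs_mult in Hx.
      assert (Hrho2 : 1 / 2 <= Rabs rho).
      { apply Rabs_le_between in K1. pose proof (Rle_abs rho). lra. }
      assert (Hy2 : Rabs y <= 2 * M) by (pose proof (Rabs_pos y); nra).
      assert (Htm2 : Rabs ta < tm).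
      { assert (E : Rabs ta = Rabs y * c3 / m ^ 2).
        { unfold y. rewrite Rabs_mult, (Rabs_pos_eq (m ^ 2)) by apply pow2_ge_0.
          unfold Rdiv. rewrite Rabs_mult, (Rabs_pos_eq (/ c3)) by pos.
          field. lra. }
        rewrite E. apply Rmult_lt_reg_r with (m ^ 2); [pos|].
        replace (Rabs y * c3 / m ^ 2 * m ^ 2) with (Rabs y * c3) by (field; lra).
        assert (Hmm : 2 * M * c3 / tm < m ^ 2) by nra.
        apply Rle_lt_trans with (tm * (2 * M * c3 / tm)).
        - replace (tm * (2 * M * c3 / tm)) with (2 * M * c3) by (field; lra).
          apply Rmult_le_compat_r; lra.
        - apply Rmult_lt_compat_l; lra. }
      repeat split; auto.
      assert (Ht1' : Rabs ta < t1) by (eapply Rlt_le_trans; [exact Htm2|apply Rmin_l]).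
      pose proof (Hfine a Hz Ht1') as K2. fold ta g rho in K2.
      replace (rho * y - y) with ((rho - 1) * y) by ring. rewrite Rabs_mult.
      apply Rmult_le_compat; auto; apply Rabs_pos. }
  destruct Hy as (Hy1 & Hy2 & Hy3).
  set (x := m ^ 2 * g) in *.
  assert (R1 : Rabs (m * c3 * phase_integral sg mu a n - PI * Airy y) <= e2).
  { apply (Htr a n (m * c3) y); try lra.
    - pos.
    - replace ((m * c3) ^ 3) with (m ^ 3 * c3 ^ 3) by ring. rewrite Hm3. unfold c3. rewrite Rpower_third_cube; auto.
    - unfold y. fold ta. rewrite <- Hm3. field. lra. }
  assert (R2 : Rabs (PI * Airy x - PI * Airy y) <= e2).
  { apply Rabs_le_between in Hx. apply Rabs_le_between in Hy1.
    pose proof (airy_lipschitz x y L (8 / e2) ltac:(lra) H8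
      ltac:(unfold L in *; nra) ltac:(unfold L in *; nra)) as HAi.
    replace (4 / (8 / e2)) with (e2 / 2) in HAi by (field; lra).
    assert (L ^ 2 * Rabs (x - y) <= L ^ 2 * (e1 * (2 * M))).
    { apply Rmult_le_compat_l; [apply pow2_ge_0|auto]. }
    replace (L ^ 2 * (e1 * (2 * M))) with (e2 / 2) in H by (unfold e1; field; split; lra). lra. }
  assert (R3 : Rabs (famp sg mu a - / c3) <= e3).
  { apply Hfamp. rewrite <- (tau_abs sg) by auto. eapply Rlt_le_trans; [exact Hy3|apply Rmin_r]. }
  assert (R4 : Rabs (PI * Airy x) <= B) by now apply Hbd.
  assert (He3a : e3 <= / (2 * c3)) by apply Rmin_l.
  assert (He3b : e3 <= e / (4 * c3 * B)) by apply Rmin_r.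
  assert (Hfp : / (2 * c3) <= famp sg mu a).
  { apply Rabs_le_between in R3. replace (/ c3) with (2 * / (2 * c3)) in R3 by (field; lra). lra. }
  unfold amp. fold m.
  assert (Hic : 0 < / (2 * c3)) by pos. assert (Hif : 0 < famp sg mu a) by lra.
  split; [pos|].
  set (P := phase_integral sg mu a n) in *. set (Z := PI * Airy x) in *. set (f := famp sg mu a) in *.
  replace (P - f / m * Z) with (/ m * ((m * c3 * P - Z) / c3 + (/ c3 - f) * Z)) by (field; lra).
  replace (e * (f / m)) with (/ m * (e * f)) by (field; lra).
  apply Rabs_scal_le; [pos|].
  assert (S1 : Rabs (m * c3 * P - Z) <= 2 * e2) by rabs.
  assert (S2 : Rabs ((/ c3 - f) * Z) <= e / (4 * c3 * B) * B).
  { rewrite Rabs_mult, Rabs_minus_sym. apply Rmult_le_compat; try apply Rabs_pos; lra. }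
  assert (S3 : Rabs ((m * c3 * P - Z) / c3) <= 2 * e2 / c3).
  { unfold Rdiv. rewrite !(Rmult_comm _ (/ c3)). apply Rabs_scal_le; [pos|auto]. }
  eapply Rle_trans; [apply Rabs_triang|].
  apply Rle_trans with (e * / (2 * c3)); [|apply Rmult_le_compat_l; lra].
  replace (e * / (2 * c3)) with (2 * e2 / c3 + e / (4 * c3 * B) * B) by (unfold e2; field; lra).
  lra.
Qed.

(** * Uniform asymptotics *)

Definition airy_estimate (sg mu e n a : R) : Prop :=
  0 < amp sg mu n a /\
  (0 <= xarg sg mu n a -> 0 < PI * Airy (xarg sg mu n a) /\
    Rabs (phase_integral sg mu a n - amp sg mu n a * (PI * Airy (xarg sg mu n a)))
      <= e * (amp sg mu n a * (PI * Airy (xarg sg mu n a)))) /\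
  (xarg sg mu n a < 0 ->
    Rabs (phase_integral sg mu a n - amp sg mu n a * (PI * Airy (xarg sg mu n a)))
      <= e * (amp sg mu n a * Rpower (1 + Rabs (xarg sg mu n a)) (- (1 / 4)))).

(** The far regimes hold beyond some [M]. On the remaining bounded set of Airy arguments [x] the
    error of [near_transition] is absolute, and it becomes relative because the Airy function is
    bounded below for [0 <= x <= M], and the weight [(1 + |x|)^(-1/4)] for [|x| <= M]. *)
Lemma uniform_asymptotics (sg mu : R) : admissible sg mu ->
  exists t, 0 < t /\ forall e, 0 < e -> exists N, 0 < N /\ forall n a, N <= n ->
    Rabs (tau sg mu a) < t -> sin (n * (sg * ((1 - a) * PI))) = 0 ->
    airy_estimate sg mu e n a.
Proof.
  intros Ha.
  destruct (far_oscillatory _ _ Ha) as [t1 [Ht1 F1]].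
  destruct (far_saddle _ _ Ha) as [t2 [Ht2 F2]].
  destruct (near_transition _ _ Ha) as [t3 [Ht3 F3]].
  exists (Rmin t1 (Rmin t2 t3)).
  split; [now repeat apply Rmin_pos|]. intros e He.
  destruct (F1 e He) as [M1 [HM1 K1]]. destruct (F2 e He) as [M2 [HM2 K2]].
  set (M := Rmax M1 M2).
  assert (HMa : M1 <= M) by apply Rmax_l. assert (HMb : M2 <= M) by apply Rmax_r.
  destruct (airy_lower_on M ltac:(lra)) as [lowA [HlowA Hairy]].
  set (low := Rmin lowA (Rpower (1 + M) (- (1 / 4)))).
  assert (Hlow : 0 < low) by (unfold low; pos).
  destruct (F3 M (e * low) ltac:(lra) ltac:(pos)) as [N [HN K3]].
  exists N. split; auto. intros n a Hn Hta Hsin.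
  assert (Hb1 : Rabs (tau sg mu a) < t1) by (eapply Rlt_le_trans; [exact Hta|apply Rmin_l]).
  pose proof (Rlt_le_trans _ _ _ Hta (Rmin_r _ _)) as Hb.
  assert (Hb2 : Rabs (tau sg mu a) < t2) by (eapply Rlt_le_trans; [exact Hb|apply Rmin_l]).
  assert (Hb3 : Rabs (tau sg mu a) < t3) by (eapply Rlt_le_trans; [exact Hb|apply Rmin_r]).
  assert (Hn0 : 0 < n) by lra.
  unfold airy_estimate.
  destruct (Rle_dec (Rabs (xarg sg mu n a)) M) as [HxM|HxM].
  - destruct (K3 n a Hn Hb3 HxM) as [Hamp Hest]. split; auto.
    set (x := xarg sg mu n a) in *. set (A := amp sg mu n a) in *.
    assert (HeA : 0 < e * A) by now apply Rmult_lt_0_compat.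
    split; intros Hx.
    + rewrite Rabs_pos_eq in HxM by auto. pose proof (Hairy x ltac:(lra)) as Hl.
      split; [lra|]. eapply Rle_trans; [exact Hest|].
      assert (low <= PI * Airy x) by (eapply Rle_trans; [apply Rmin_l|auto]).
      replace (e * low * A) with (e * A * low) by ring. rewrite <- Rmult_assoc.
      apply Rmult_le_compat_l; lra.
    + eapply Rle_trans; [exact Hest|].
      assert (low <= Rpower (1 + Rabs x) (- (1 / 4))).
      { eapply Rle_trans; [apply Rmin_r|]. rewrite !Rpower_Ropp.
        apply Rinv_le_contravar; [apply exp_pos|]. apply Rle_Rpower_l; [lra|].
        pose proof (Rabs_pos x). lra. }
      replace (e * low * A) with (e * A * low) by ring. rewrite <- Rmult_assoc.
      apply Rmult_le_compat_l; lra.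
  - assert (Hxn : xarg sg mu n a <> 0) by (intros Z; rewrite Z, Rabs_R0 in HxM; lra).
    apply Rabs_def2 in Hb1. apply Rabs_def2 in Hb2.
    destruct (Rtotal_order (tau sg mu a) 0) as [Hs|[Hs|Hs]].
    + destruct (K1 n a Hn0 ltac:(lra) ltac:(lra)) as (A1 & A2 & A3).
      split; auto. split; [lra|auto].
    + exfalso. apply Hxn. unfold xarg. rewrite (gamma2_coalescence sg mu a Ha Hs). ring.
    + destruct (K2 n a Hn0 ltac:(lra) Hsin ltac:(lra)) as (A1 & A2 & A3 & A4).
      split; auto. split; [auto|lra].
Qed.

Lemma Rpower_div_cube (x q : R) : 0 < x -> 0 < q ->
  Rpower (x / q ^ 3) (1 / 3) = Rpower x (1 / 3) / q.
Proof.
  intros Hx Hq. unfold Rdiv at 1. rewrite <- Rpower_mult_distr by pos. unfold Rdiv at 3. f_equal.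
  rewrite <- (Rpower_pow 3), <- Rpower_Ropp, Rpower_mult by auto.
  replace (- INR 3 * (1 / 3)) with (- (1)) by (simpl; field).
  rewrite Rpower_Ropp, Rpower_1; auto.
Qed.

Lemma filterlim_RtoC (F : (nat -> Prop) -> Prop) (FF : Filter F) (u : nat -> C) (v : nat -> R) (l : R) :
  F (fun n => u n = RtoC (v n)) ->
  (forall e, 0 < e -> F (fun n => Rabs (v n - l) < e)) ->
  filterlim u F (locally (RtoC l)).
Proof.
  intros Hu Hv. apply filterlim_locally. intros eps.
  generalize (filter_and _ _ Hu (Hv eps (cond_pos eps))). apply filter_imp.
  intros n [E Hn]. rewrite E. split.
  - exact Hn.
  - apply ball_center.
Qed.

(** Since the estimates are uniform in [a], they apply along every sequence [a = k(n) / n]. As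
    [n (1 - a)] is an integer, [z^(- k) b_mu(z)^n] is real on the negative axis, which is the
    condition on the sine. *)
Lemma airy_equiv_uniform (sg mu : R) (k : nat -> nat) (S : nat -> R) (t : R) :
  admissible sg mu ->
  (forall e, 0 < e -> exists N, 0 < N /\ forall n a, N <= n ->
    Rabs (tau sg mu a) < t -> sin (n * (sg * ((1 - a) * PI))) = 0 ->
    airy_estimate sg mu e n a) ->
  (forall n, S n <> 0) ->
  eventually (fun n => Rabs (tau sg mu (INR (k n) / INR n)) < t) ->
  eventually (fun n => blaschke_coef (Rabs mu) n (k n)
     = RtoC (S n * (/ PI * phase_integral sg mu (INR (k n) / INR n) (INR n)))) ->
  airy_equiv
    (fun n => blaschke_coef (Rabs mu) n (k n))
    (fun n => S n * amplitude (branch sg) (Rabs mu) n (k n))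
    (fun n => airy_arg (branch sg) (Rabs mu) n (k n)).
Proof.
  intros Ha Hunif HS Ht Hcoef.
  set (a := fun n => INR (k n) / INR n).
  set (P := fun n => phase_integral sg mu (a n) (INR n)).
  set (A := fun n => amp sg mu (INR n) (a n)).
  set (x := fun n => xarg sg mu (INR n) (a n)).
  assert (HPI : 0 < PI) by apply PI_RGT_0.
  assert (Hsin : forall n, (0 < n)%nat -> sin (INR n * (sg * ((1 - a n) * PI))) = 0).
  { intros n Hn. apply sin_eq_0_1.
    assert (0 < INR n) by now apply lt_0_INR.
    assert (E : INR n * (1 - a n) = IZR (Z.of_nat n - Z.of_nat (k n))).
    { rewrite minus_IZR, <- !INR_IZR_INZ. unfold a. field. lra. }
    destruct Ha as [[-> _]|[-> _]].
    - exists (Z.of_nat n - Z.of_nat (k n))%Z. rewrite <- E. ring.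
    - exists (- (Z.of_nat n - Z.of_nat (k n)))%Z. rewrite opp_IZR, <- E. ring. }
  assert (Hev : forall e, 0 < e -> eventually (fun n => 0 < A n /\
    (0 <= x n -> 0 < PI * Airy (x n) /\
      Rabs (P n - A n * (PI * Airy (x n))) <= e * (A n * (PI * Airy (x n)))) /\
    (x n < 0 -> Rabs (P n - A n * (PI * Airy (x n)))
        <= e * (A n * Rpower (1 + Rabs (x n)) (- (1 / 4)))))).
  { intros e He. destruct (Hunif e He) as [N [HN HK]]. destruct Ht as [n1 Hn1].
    destruct (nfloor_ex N) as [n2 Hn2]; [lra|].
    exists (n1 + n2 + 1)%nat. intros n Hn. apply HK.
    - apply Rle_trans with (INR n2 + 1); [lra|]. rewrite <- S_INR. apply le_INR. lia.
    - apply Hn1. lia.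
    - apply Hsin. lia. }
  split.
  - apply (filterlim_RtoC _ _ _ (fun n => P n / (A n * (PI * Airy (x n))))).
    + unfold within. generalize (filter_and _ _ Hcoef (Hev 1 ltac:(lra))). apply filter_imp.
      intros n (Hc & HA & H0 & _) Hx. destruct (H0 Hx) as [HAi _].
      change (airy_arg (branch sg) (Rabs mu) n (k n)) with (x n).
      change (amplitude (branch sg) (Rabs mu) n (k n)) with (A n).
      rewrite Hc. fold (a n) (P n).
      assert (HAi2 : 0 < Airy (x n)) by nra.
      assert (Hnz : S n * A n * Airy (x n) <> 0).
      { apply Rmult_integral_contrapositive_currified; [|lra].
        apply Rmult_integral_contrapositive_currified; [auto|lra]. }
      unfold Cdiv. rewrite <- RtoC_inv, <- RtoC_mult by auto. f_equal. field.
      repeat split; auto; lra.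
    + intros e He. unfold within. generalize (Hev (e / 2) ltac:(lra)). apply filter_imp.
      intros n (HA & H0 & _) Hx. destruct (H0 Hx) as [HAi Hest].
      assert (HD : 0 < A n * (PI * Airy (x n))) by now apply Rmult_lt_0_compat.
      set (D := A n * (PI * Airy (x n))) in *.
      replace (P n / D - 1) with ((P n - D) * / D) by (field; lra).
      rewrite Rabs_mult, (Rabs_pos_eq (/ D)) by (left; now apply Rinv_0_lt_compat).
      apply Rle_lt_trans with (e / 2 * D * / D).
      * apply Rmult_le_compat_r; [left; now apply Rinv_0_lt_compat|auto].
      * rewrite Rmult_assoc, Rinv_r; lra.
  - exists (fun n => RtoC ((P n / (PI * A n) - Airy (x n)) / Rpower (1 + Rabs (x n)) (- (1 / 4)))).
    split.
    + apply (filterlim_RtoC _ _ _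
        (fun n => (P n / (PI * A n) - Airy (x n)) / Rpower (1 + Rabs (x n)) (- (1 / 4)))).
      * apply filter_forall. auto.
      * intros e He. unfold within. generalize (Hev e He). apply filter_imp.
        intros n (HA & _ & H0) Hx. specialize (H0 Hx).
        set (w := Rpower (1 + Rabs (x n)) (- (1 / 4))) in *.
        assert (Hw : 0 < w) by apply exp_pos.
        rewrite Rminus_0_r.
        replace ((P n / (PI * A n) - Airy (x n)) / w)
          with ((P n - A n * (PI * Airy (x n))) * / (PI * A n * w)) by (field; lra).
        assert (HPw : 0 < PI * A n * w) by (apply Rmult_lt_0_compat; auto; now apply Rmult_lt_0_compat).
        rewrite Rabs_mult, (Rabs_pos_eq (/ _)) by (left; now apply Rinv_0_lt_compat).
        apply Rle_lt_trans with (e * (A n * w) * / (PI * A n * w)).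
        -- apply Rmult_le_compat_r; [left; now apply Rinv_0_lt_compat|auto].
        -- replace (e * (A n * w) * / (PI * A n * w)) with (e / PI) by (field; lra).
           pose proof PI2_3_2. apply Rmult_lt_reg_r with PI; auto.
           replace (e / PI * PI) with e by (field; lra). nra.
    + generalize (filter_and _ _ Hcoef (Hev 1 ltac:(lra))). apply filter_imp.
      intros n (Hc & HA & _) _.
      change (airy_arg (branch sg) (Rabs mu) n (k n)) with (x n).
      change (amplitude (branch sg) (Rabs mu) n (k n)) with (A n).
      rewrite Hc. fold (a n) (P n).
      set (w := Rpower (1 + Rabs (x n)) (- (1 / 4))).
      assert (Hw : 0 < w) by apply exp_pos.
      rewrite <- RtoC_mult, <- RtoC_plus, <- RtoC_mult. f_equal. field. repeat split; lra.
Qed.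

Theorem proposition3 :
  forall lam : R, 0 < lam < 1 ->
  exists delta : R, 0 < delta /\
  forall alpha beta : R,
    0 < alpha < alpha0 lam -> alpha0 lam < beta < 1 ->
    alpha0 lam - alpha < delta -> beta - alpha0 lam < delta ->
  ((forall k : nat -> nat,
      eventually (fun n => alpha <= INR (k n) / INR n <= beta) ->
      airy_equiv
        (fun n => blaschke_coef lam n (k n))
        (fun n => (-1) ^ (n - k n) * amplitude 0 lam n (k n))
        (fun n => airy_arg 0 lam n (k n))) /\
   is_lim
     (fun a => gamma2 0 lam a /
        ((alpha0 lam - a) * (1 + lam) / Rpower (lam * (1 - lam)) (1 / 3)))
     (alpha0 lam) 1) /\
  ((forall k : nat -> nat,
      eventually (fun n => / beta <= INR (k n) / INR n <= / alpha) ->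
      airy_equiv
        (fun n => blaschke_coef lam n (k n))
        (fun n => amplitude (- PI) lam n (k n))
        (fun n => airy_arg (- PI) lam n (k n))) /\
   is_lim
     (fun a => gamma2 (- PI) lam a /
        ((a - / alpha0 lam) * (1 - lam) / Rpower (lam * (1 + lam)) (1 / 3)))
     (/ alpha0 lam) 1).
Proof.
  intros lam Hlam.
  assert (Ha1 : admissible 1 (- lam)) by (left; lra).
  assert (Ha2 : admissible (-1) lam) by (right; lra).
  destruct (uniform_asymptotics 1 (- lam) Ha1) as [t1 [Ht1 U1]].
  destruct (uniform_asymptotics (-1) lam Ha2) as [t2 [Ht2 U2]].
  assert (Hs1 : slope_max (- lam) = alpha0 lam).
  { unfold slope_max, alpha0. f_equal; ring. }
  assert (Hs2 : slope_max lam = / alpha0 lam).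
  { unfold slope_max, alpha0. field. lra. }
  assert (Hr1 : Rabs (- lam) = lam) by (rewrite Rabs_Ropp, Rabs_pos_eq; lra).
  assert (Hr2 : Rabs lam = lam) by (rewrite Rabs_pos_eq; lra).
  assert (Hb1 : branch 1 = 0) by (unfold branch; destruct (Rle_dec 0 1); lra).
  assert (Hb2 : branch (-1) = - PI) by (unfold branch; destruct (Rle_dec 0 (-1)); lra).
  assert (Ha0 : 0 < alpha0 lam < 1).
  { unfold alpha0. split; [apply Rdiv_lt_0_compat; lra|].
    apply Rmult_lt_reg_r with (1 + lam); [lra|]. unfold Rdiv. rewrite Rmult_assoc, Rinv_l; lra. }
  set (A := alpha0 lam) in *.
  (* for [alpha >= A / 2] the map [a -> 1 / a] has Lipschitz constant at most [2 / A^2] *)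
  set (delta := Rmin t1 (Rmin (A / 2) (t2 * A ^ 2 / 2))).
  assert (Hd : 0 < delta) by (assert (0 < A) by lra; unfold delta; pos).
  assert (D1 : delta <= t1) by apply Rmin_l.
  assert (D2 : delta <= A / 2) by (eapply Rle_trans; [apply Rmin_r|apply Rmin_l]).
  assert (D3 : delta <= t2 * A ^ 2 / 2) by (eapply Rle_trans; [apply Rmin_r|apply Rmin_r]).
  exists delta. split; auto. intros alpha beta Halpha Hbeta Hda Hdb.
  assert (Hn0 : forall k : nat -> nat, forall lo hi n, 0 < lo -> lo <= INR (k n) / INR n <= hi ->
            (0 < n)%nat).
  { intros k lo hi n Hlo H. destruct n; [|lia]. exfalso.
    simpl in H. unfold Rdiv in H. rewrite Rinv_0, Rmult_0_r in H. lra. }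
  split; split.
  - intros k Hk.
    pose proof (airy_equiv_uniform 1 (- lam) k (fun n => (-1) ^ (n - k n)) t1 Ha1 U1) as E.
    rewrite Hr1, Hb1 in E. apply E.
    + intros n. apply pow_nonzero. lra.
    + revert Hk. apply filter_imp. intros n Hn. rewrite tau_abs, Hs1 by auto. apply Rabs_def1; lra.
    + revert Hk. apply filter_imp. intros n Hn.
      pose proof (Hn0 k alpha beta n ltac:(lra) Hn) as Hpos.
      assert (Hpn : 0 < INR n) by now apply lt_0_INR.
      assert (Hkn : (k n <= n)%nat).
      { apply INR_le. apply Rle_trans with (INR (k n) / INR n * INR n); [right; field; lra|].
        apply Rle_trans with (1 * INR n); [apply Rmult_le_compat_r; lra|lra]. }
      rewrite blaschke_coef_integral, phase_integral_coef by (auto; lra).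
      rewrite coef_integral_neg by (auto; lra). f_equal. ring.
  - pose proof (gamma2_is_lim 1 (- lam) Ha1) as L. rewrite Hr1, Hb1, Hs1 in L.
    eapply is_lim_ext; [|exact L]. intros a. cbv beta. f_equal.
    unfold tau. rewrite Hs1. fold A. rewrite Rmult_1_l. unfold Rdiv at 1 3. rewrite Rmult_assoc. f_equal.
    unfold cubic. rewrite Hr1.
    replace (lam * (1 + - lam) / (1 - - lam) ^ 3) with (lam * (1 - lam) / (1 + lam) ^ 3) by (field; lra).
    rewrite Rpower_div_cube by (try lra; apply Rmult_lt_0_compat; lra).
    field. split; [apply Rgt_not_eq, exp_pos|lra].
  - intros k Hk.
    pose proof (airy_equiv_uniform (-1) lam k (fun _ => 1) t2 Ha2 U2) as E.
    rewrite Hr2, Hb2 in E.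
    assert (Hib : 0 < / beta) by (apply Rinv_0_lt_compat; lra).
    assert (H1 : airy_equiv (fun n => blaschke_coef lam n (k n))
      (fun n => 1 * amplitude (- PI) lam n (k n)) (fun n => airy_arg (- PI) lam n (k n))).
    { apply E.
      - intros _. lra.
      - revert Hk. apply filter_imp. intros n Hn. rewrite tau_abs, Hs2 by auto. fold A.
        assert (B1 : / alpha - / A < t2).
        { replace (/ alpha - / A) with ((A - alpha) * / (alpha * A)) by (field; lra).
          apply Rmult_lt_reg_r with (alpha * A); [nra|].
          rewrite Rmult_assoc, Rinv_l, Rmult_1_r by nra.
          apply Rlt_le_trans with (t2 * A ^ 2 / 2); [lra|].
          assert (A ^ 2 / 2 <= alpha * A) by nra. nra. }
        assert (B2 : / A - / beta < t2).
        { replace (/ A - / beta) with ((beta - A) * / (beta * A)) by (field; lra).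
          apply Rmult_lt_reg_r with (beta * A); [nra|].
          rewrite Rmult_assoc, Rinv_l, Rmult_1_r by nra.
          apply Rlt_le_trans with (t2 * A ^ 2 / 2); [lra|].
          assert (A ^ 2 / 2 <= beta * A) by nra. nra. }
        apply Rabs_def1; lra.
      - revert Hk. apply filter_imp. intros n Hn.
        pose proof (Hn0 k _ _ n Hib Hn) as Hpos.
        rewrite blaschke_coef_integral, phase_integral_coef by (auto; lra). f_equal. ring. }
    destruct H1 as [G1 [e [G2 G3]]]. split.
    + eapply filterlim_ext; [|exact G1]. intros n. cbv beta. now rewrite Rmult_1_l.
    + exists e. split; auto. revert G3. apply filter_imp. intros n Hn Hx.
      rewrite (Hn Hx). now rewrite Rmult_1_l.
  - pose proof (gamma2_is_lim (-1) lam Ha2) as L. rewrite Hr2, Hb2, Hs2 in L.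
    eapply is_lim_ext; [|exact L]. intros a. cbv beta. f_equal.
    unfold tau. rewrite Hs2. fold A.
    replace (-1 * (/ A - a)) with (a - / A) by ring. unfold Rdiv at 1 3. rewrite Rmult_assoc. f_equal.
    unfold cubic. rewrite Hr2.
    rewrite Rpower_div_cube by (try lra; apply Rmult_lt_0_compat; lra).
    field. split; [apply Rgt_not_eq, exp_pos|lra].
Qed.
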